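(* Let $n\ge3$, let $f\in\mathcal F(\mathbb K^n)$ be a quasihomogeneous polynomial of degree $\mathrm N$ with respect to weights $w_1,\dots,w_n$, with $f(0)=0$ and of finite codimension $c$, and let $\Lambda=f\,\frac{\partial}{\partial x_1}\wedge\dots\wedge\frac{\partial}{\partial x_n}$. Let $\mathcal B$ be a monomial basis of $Q_f$ and $\omega=dx_1\wedge\dots\wedge dx_n$. Let $\alpha\in\Omega^n(\mathbb K^n)$. Then there exist unique polynomials $h_1,h_2$ (possibly zero) such that - $h_1$ is quasihomogeneous of degree $\mathrm N-\sum_i w_i$, - $h_2$ is a linear combination of monomials of $\mathcal B$, and $$\alpha=(h_2+fh_1)\,\omega\quad\mathrm{mod}\ B^n_{f,n-2}(\mathbb K^n).$$ In particular, the dimension of $H^2_\Lambda(\mathbb K^n)$ is $c+s$.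
   Context: $\mathbb K=\mathbb R$ or $\mathbb C$. One works in a fixed category: holomorphic ($\mathbb K=\mathbb C$), real analytic or $C^\infty$ ($\mathbb K=\mathbb R$), or formal. $\mathcal F(\mathbb K^n)$, $\Omega^k(\mathbb K^n)$, $\mathcal X(\mathbb K^n)$ denote the germs at $0$ of functions, $k$-forms and vector fields in that category (formal power series, and objects with such coefficients, in the formal case). $Q_f=\mathcal F(\mathbb K^n)/I_f$, with $I_f$ the ideal generated by the partial derivatives of $f$; $f$ has finite codimension if $c=\dim_{\mathbb K}Q_f<\infty$. A monomial basis $\mathcal B$ of $Q_f$ is a set of monomials whose classes form a basis of $Q_f$. The weights $w_1,\dots,w_n$ are positive integers and $W=\sum_iw_ix_i\frac{\partial}{\partial x_i}$; a tensor $T$ is quasihomogeneous of degree $d$ if $\mathcal L_WT=dT$ (so $W.f=\mathrm Nf$). $s$ is the dimension of the space of quasihomogeneous polynomials of degree $\mathrm N-\sum_i w_i$. $d_f^{(p)}:\Omega^k(\mathbb K^n)\to\Omega^{k+1}(\mathbb K^n)$ is $d_f^{(p)}\alpha=f\,d\alpha-(k-p)\,df\wedge\alpha$; thus $B^n_{f,n-2}(\mathbb K^n)=\{f\,d\beta-df\wedge\beta:\beta\in\Omega^{n-1}(\mathbb K^n)\}$. $H^2_\Lambda(\mathbb K^n)$ is the quotient of the space of germs at $0$ of $n$-vectors by the subspace $\{[X,\Lambda]: X\in\mathcal X(\mathbb K^n)\}$ (Schouten bracket). *)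

(* Defs.v *)
From HB Require Import structures.
From mathcomp Require Import all_boot all_order all_algebra finmap complex.
From mathcomp Require Import boolp classical_sets functions reals topology.
From mathcomp Require Import normedtype derive summability.
From mathcomp Require Import -(notations) mpoly.

Set Implicit Arguments.
Unset Strict Implicit.
Unset Printing Implicit Defensive.

Import Order.TTheory GRing.Theory Num.Theory.
Import numFieldNormedType.Exports.

Local Open Scope classical_set_scope.
Local Open Scope ring_scope.

(* The classes of the [e i] form a basis of [V / U]; here [V] is a linear
   subspace of [E] and [U] a linear subspace of [V]. *)
Definition basis_mod (K : fieldType) (E : lmodType K) (V U : set E)
    (I : finType) (e : I -> E) : Prop :=
  [/\ forall i, V (e i),
      forall a : I -> K, U (\sum_i a i *: e i) -> forall i, a i = 0
    & forall v, V v -> exists a : I -> K, U (v - \sum_i a i *: e i)].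

Definition quotient_dim (K : fieldType) (E : lmodType K) (V U : set E)
    (d : nat) : Prop :=
  exists e : 'I_d -> E, basis_mod V U e.

(* Germs are handled through representatives: the germs of the category are
   the elements of [rep] satisfying [in_cat], taken up to [germ_eq]. *)
Record germ_model (K : numFieldType) (n : nat) := GermModel {
  rep : lmodType K;
  in_cat : set rep;
  germ_eq : rep -> rep -> Prop;
  gmul : rep -> rep -> rep;
  pd : 'I_n -> rep -> rep;
  gpoly : mpoly n K -> rep }.

Arguments in_cat {K n} g _.
Arguments germ_eq {K n} g _ _.
Arguments gmul {K n g} _ _.
Arguments pd {K n g} _ _.
Arguments gpoly {K n g} _.

Section FunctionGerms.
Variables (K : numFieldType) (n : nat).

Definition fun_rep : lmodType K := 'rV[K]_n -> K^o.

Definition fun_pd (i : 'I_n) (g : fun_rep) : fun_rep :=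
  fun x => 'D_('e_i : 'rV[K]_n) (g : 'rV[K]_n -> K^o) x.

(* The functions are total; their values away from 0 are irrelevant. *)
Definition fun_germs (C : set fun_rep) : germ_model K n :=
  @GermModel K n fun_rep C
    (fun g h => \forall x \near (0 : 'rV[K]_n), g x = h x)
    (fun g h x => (g x : K) * h x)
    fun_pd
    (fun p x => meval (fun i => x ord0 i) p).

(* [g] is near 0 the sum of a convergent power series. The sums over the
   finite sets of multi-indices converge along [totally], i.e. the
   multiple series converges unconditionally. Over C this is Weierstrass'
   definition of a holomorphic germ. *)
Definition analytic (g : fun_rep) : Prop :=
  exists c : multinom n -> K, \forall x \near (0 : 'rV[K]_n),
    partial_sum (fun m : multinom n =>
      (c m * \prod_(i < n) (x : 'rV[K]_n) ord0 i ^+ m i : K^o)) @ totally --> (g x : K^o).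

Definition iter_pd (s : seq 'I_n) (g : fun_rep) : fun_rep := foldr fun_pd g s.

Definition smooth (g : fun_rep) : Prop :=
  \forall x \near (0 : 'rV[K]_n), forall s : seq 'I_n,
    {for x, continuous (iter_pd s g : 'rV[K]_n -> K^o)} /\
    forall i, derivable (iter_pd s g : 'rV[K]_n -> K^o) x 'e_i.

End FunctionGerms.

Section FormalGerms.
Variables (K : numFieldType) (n : nat).

(* A formal power series is the family of its coefficients. *)
Definition formal_rep : lmodType K := multinom n -> K^o.

Definition formal_mul (a b : formal_rep) : formal_rep := fun m =>
  \sum_(k : bmultinom n (mdeg m).+1 *
            bmultinom n (mdeg m).+1
        | m == mnm_add k.1 k.2) (a k.1 : K) * b k.2.

Definition formal_germs : germ_model K n :=
  @GermModel K n formal_rep setT eq formal_mul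
    (fun i a m => ((m i).+1%:R : K) * a (mnm_add m (mnm1 i)))
    (fun p m => mcoeff m p).

End FormalGerms.

Inductive ground := Reals | Complexes.

Definition ground_field (R : realType) (k : ground) : numFieldType :=
  match k with Reals => R | Complexes => R[i] end.

Inductive category : ground -> Type :=
| Holomorphic : category Complexes
| RealAnalytic : category Reals
| Smooth : category Reals
| Formal k : category k.

Definition germs (R : realType) (k : ground) (cat : category k) (n : nat) :
    germ_model (ground_field R k) n :=
  match cat in category k return germ_model (ground_field R k) n with
  | Holomorphic => fun_germs (@analytic (ground_field R Complexes) n)
  | RealAnalytic => fun_germs (@analytic (ground_field R Reals) n)
  | Smooth => fun_germs (@smooth (ground_field R Reals) n)
  | Formal k => formal_germs (ground_field R k) n
  end.

Section Tensors.
Variables (K : numFieldType) (n : nat) (G : germ_model K n).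

(* Coefficients on the basis of the exterior algebra indexed by the subsets
   {i_1 < ... < i_k} of {1..n}: [t S] is the coefficient of
   dx_{i_1} /\ ... /\ dx_{i_k} for a form, and of
   d/dx_{i_1} /\ ... /\ d/dx_{i_k} for a multivector field. *)
Definition tensor : lmodType K := {ffun {set 'I_n} -> rep G}.

Definition homogeneous (k : nat) : set tensor :=
  [set t | forall S : {set 'I_n},
     in_cat G (t S) /\ (#|S| != k -> t S = 0)].

Definition tensor_eq (t u : tensor) : Prop := forall S, germ_eq G (t S) (u S).

Definition scalar (g : rep G) : tensor :=
  [ffun S : {set 'I_n} => if S == finset.set0 then g else 0].

Definition top (g : rep G) : tensor :=
  [ffun S : {set 'I_n} => if S == [set: 'I_n]%SET then g else 0].

Definition shuffle_sign (A B : {set 'I_n}) : K :=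
  (-1) ^+ #|[set u : 'I_n * 'I_n |
              [&& u.1 \in A, u.2 \in B & (u.2 < u.1)%N]]%SET|.

Definition wedge (t u : tensor) : tensor :=
  [ffun S : {set 'I_n} => \sum_(A : {set 'I_n} | A \subset S)
     shuffle_sign A (S :\: A) *: gmul (t A) (u (S :\: A))].

Definition extd (t : tensor) : tensor :=
  [ffun S : {set 'I_n} => \sum_(i in S)
     shuffle_sign [set i]%SET (S :\ i) *: pd i (t (S :\ i))].

(* d_f^(p) a, where k is the degree of the form a *)
Definition df_op (f : rep G) (p k : nat) (a : tensor) : tensor :=
  wedge (scalar f) (extd a)
  - (k%:R - p%:R) *: wedge (extd (scalar f)) a.

(* B^k_{f,p}, for k > 0 *)
Definition Bf (f : rep G) (p k : nat) : set tensor :=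
  [set a | exists2 b, homogeneous k.-1 b & tensor_eq a (df_op f p k.-1 b)].

Definition tensor_pd (i : 'I_n) (t : tensor) : tensor :=
  [ffun S : {set 'I_n} => pd i (t S)].

(* Right derivative with respect to the odd variable z_i = d/dx_i: it sends
   z_{i_1} ... z_{i_(k-1)} z_i to z_{i_1} ... z_{i_(k-1)}. *)
Definition rderiv (i : 'I_n) (t : tensor) : tensor :=
  [ffun S : {set 'I_n} =>
     if i \in S then 0 else shuffle_sign S [set i]%SET *: t (i |: S)].

(* [P, Q] = sum_i (dP/dz_i) /\ (dQ/dx_i)
            - (-1)^((p-1)(q-1)) (dQ/dz_i) /\ (dP/dx_i)
   for a p-vector P and a q-vector Q; the exponent is shifted by even
   numbers to avoid truncated subtraction. On vector fields this is the Lie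
   bracket, and [X, Q] is the Lie derivative of Q along X. *)
Definition schouten (p q : nat) (P Q : tensor) : tensor :=
  \sum_i (wedge (rderiv i P) (tensor_pd i Q)
          - (-1) ^+ (p.+1 * q.+1) *: wedge (rderiv i Q) (tensor_pd i P)).

(* L is an n-vector field. *)
Definition H2_dim (L : tensor) (d : nat) : Prop :=
  quotient_dim (homogeneous n)
    [set P | exists2 X, homogeneous 1 X & tensor_eq P (schouten 1 n X L)] d.

Definition jacobian_ideal (f : rep G) : set (rep G) :=
  [set g | exists2 X : 'I_n -> rep G, forall i, in_cat G (X i)
         & germ_eq G g (\sum_i gmul (X i) (pd i f))].

Definition codim (f : rep G) (c : nat) : Prop :=
  quotient_dim (in_cat G) (jacobian_ideal f) c.

Definition monomial_basis (f : rep G) (B : {fset multinom n}) : Prop :=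
  basis_mod (in_cat G) (jacobian_ideal f)
    (fun m : B => gpoly (mpolyX K (val m))).

End Tensors.

(* W.p = d p, where W = sum_i w_i x_i d/dx_i *)
Definition quasihomogeneous (K : numFieldType) (n : nat) (w : 'I_n -> nat)
    (d : int) : set (mpoly n K) :=
  [set p | \sum_(i < n)
     (w i)%:R *: (mpolyX K (mnm1 i) * mderiv i p)
     = d%:~R *: p].

(* Main.v *)
(* Contracting with dx_1 /\ ... /\ dx_n (resp. taking the components of X)
   turns both B^n_{f,n-2} and {[X, Lambda]} into the space of all
   f div X - X f.

   Existence: a = h_2 + Y f by definition of a monomial basis, Y f is congruent
   to f div Y, and f b is congruent to f h_1 as soon as
   W g - (N - sum_i w_i) g = b - h_1, by taking X = g W. This Euler equation is
   solved by splitting off a Taylor polynomial of b until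
   W g + (k + 1) g = b remains, which is solved coefficientwise for power
   series, and by g(x) = int_0^1 t^k b(t^w x) dt for smooth germs.

   Uniqueness: if h_2 + f h_1 = f div X - X f, then h_2 lies in I_f, hence
   h_2 = 0. Since f h_1 is homogeneous, replacing X by a suitable homogeneous
   component P of its Taylor expansion gives f h_1 = f div P - P f, and
   Y = P - ((div P - h_1) / N) W satisfies Y f = 0. As I_f contains a power of
   each x_i, the partial derivatives of f form a Koszul-acyclic sequence, so
   the i-th component of Y lies in the ideal generated by the d_j f, j <> i.
   For n >= 3 its degree is too small for that, so Y = 0, and comparing
   divergences gives h_1 = 0. *)

Require Import Defs.
From Corelib Require Import -(notations) Setoid Morphisms.
From mathcomp Require Import all_boot all_order all_algebra finmap complex.
From mathcomp Require Import ring lra zify.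
From mathcomp Require Import boolp classical_sets functions reals topology.
From mathcomp Require Import normedtype derive summability.
From mathcomp Require Import ereal measure lebesgue_measure lebesgue_integral.
From mathcomp Require Import realfun ftc.
From mathcomp Require Import -(notations) mpoly.

Set Implicit Arguments.
Unset Strict Implicit.
Unset Printing Implicit Defensive.

Import Order.TTheory GRing.Theory Num.Theory.
Import numFieldNormedType.Exports.

Local Open Scope ring_scope.

(** * The first Koszul homology of a regular sequence *)

(** The obstacle is to treat four categories at once. Germs enter only through the record
    [germ_axioms]: as [f] is a polynomial, it is enough that polynomials act on germs, and the only
    analytic inputs are Hadamard's lemma and an Euler equation without resonance. Coefficients are
    compared in the polynomial ring alone: a germ is replaced by a Taylor polynomial modulo a power
    of the ideal of germs vanishing at 0, and since every weight is at least 1, weighted components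
    of degree below that power do not see the error. Flat smooth functions are thereby harmless.

    The polynomial [h_1] is a resonance: on weighted degree e the operator [W - d] is multiplication
    by [e - d], so degree [d = N - \sum w] is the only one that it cannot reach.

    Acyclicity is obtained without dimension theory. The regular sequence is made of the powers of
    the variables, whose regularity is visible on monomials; they are n elements of the ideal of the
    n partial derivatives, and each element of that ideal kills the Koszul homology. *)

Section Koszul.
Variable A : comNzRingType.
Implicit Types (s a c : seq A) (t x y : A).

(** Membership in the ideal generated by [s], peeling off one generator at a time so that it
    recurses along [s] as [reg] and [kos] do. *)
Fixpoint idl s x : Prop :=
  if s is t :: s' then exists q y, x = t * q + y /\ idl s' y else x = 0.

Lemma idl0 s : idl s 0.
Proof. by elim: s => //= t s IH; exists 0, 0; rewrite mulr0 addr0. Qed.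

Lemma idlD s x y : idl s x -> idl s y -> idl s (x + y).
Proof.
elim: s x y => [x y /= -> ->|t s IH x y /= [q [u [-> hu]]] [r [v [-> hv]]]].
  by rewrite addr0.
by exists (q + r), (u + v); split; [ring | exact: IH].
Qed.

Lemma idlM s b x : idl s x -> idl s (b * x).
Proof.
elim: s x => [x /= ->|t s IH x /= [q [u [-> hu]]]]; first by rewrite mulr0.
by exists (b * q), (b * u); split; [ring | exact: IH].
Qed.

(* [reg [:: t; ...]]: each entry is a nonzerodivisor modulo the later ones. *)
Fixpoint reg s : Prop :=
  if s is t :: s' then reg s' /\ forall x, idl s' (t * x) -> idl s' x else True.

(** Here and in [wd], [head 0] and [behead] pad a short [c] with zeros. *)
Fixpoint dot s c : A :=
  if s is t :: s' then t * head 0 c + dot s' (behead c) else 0.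

Lemma idl_dot s x : idl s x -> exists c, x = dot s c.
Proof.
elim: s x => [x /= ->|t s IH x /= [q [y [-> /IH[c ->]]]]]; first by exists [::].
by exists (q :: c).
Qed.

(* The pair [(u, v)] over [t :: s] stands for u + e_t /\ v. On this model of
   the Koszul complex, [bd] is the differential, [wd c] the exterior product
   with [c], [hk k] selects the degree [k] and [inK J] the coefficients in J. *)
Fixpoint kos s : lmodType A :=
  if s is _ :: s' then (kos s' * kos s')%type : lmodType A else A^o.

Fixpoint bd s : kos s -> kos s :=
  match s with
  | [::] => fun _ => 0
  | t :: s' => fun z => (bd z.1 + t *: z.2, - bd z.2)
  end.

Fixpoint wd s c : kos s -> kos s :=
  match s with
  | [::] => fun _ => 0
  | t :: s' => fun z => (wd (behead c) z.1, head 0 c *: z.1 - wd (behead c) z.2)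
  end.

Fixpoint hk s (k : nat) : kos s -> Prop :=
  match s with
  | [::] => fun z => k <> 0%N -> z = 0
  | t :: s' => fun z => hk k z.1 /\ (if k is k'.+1 then hk k' z.2 else z.2 = 0)
  end.

Fixpoint inK (J : A -> Prop) s : kos s -> Prop :=
  match s with
  | [::] => fun z => J z
  | t :: s' => fun z => inK J z.1 /\ inK J z.2
  end.

Lemma bd_lin s b (u v : kos s) : bd (b *: u + v) = b *: bd u + bd v.
Proof.
elim: s u v => [u v|t s IH [u1 u2] [v1 v2]] /=; first by rewrite scaler0 addr0.
apply: injective_projections; rewrite /= !IH; last by rewrite opprD -scalerN.
by rewrite !scalerDr !scalerA [t * b]mulrC addrACA.
Qed.

Lemma wd_lin s c b (u v : kos s) : wd c (b *: u + v) = b *: wd c u + wd c v.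
Proof.
elim: s c u v => [c u v|t s IH c [u1 u2] [v1 v2]] /=.
  by rewrite scaler0 addr0.
apply: injective_projections; rewrite /= !IH // !scalerDr !scalerA opprD -scalerN.
by rewrite [head 0 c * b]mulrC addrACA.
Qed.

Lemma bd0 s : bd (0 : kos s) = 0.
Proof. by have := bd_lin (-1) (0 : kos s) 0; rewrite scaler0 addr0 scaleN1r addNr. Qed.
Lemma bdD s (u v : kos s) : bd (u + v) = bd u + bd v.
Proof. by have := bd_lin 1 u v; rewrite !scale1r. Qed.
Lemma bdZ s b (u : kos s) : bd (b *: u) = b *: bd u.
Proof. by have := bd_lin b u 0; rewrite bd0 !addr0. Qed.
Lemma bdN s (u : kos s) : bd (- u) = - bd u.
Proof. by rewrite -scaleN1r bdZ scaleN1r. Qed.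
Lemma wd0 s c : wd c (0 : kos s) = 0.
Proof. by have := wd_lin c (-1) (0 : kos s) 0; rewrite scaler0 addr0 scaleN1r addNr. Qed.
Lemma wdD s c (u v : kos s) : wd c (u + v) = wd c u + wd c v.
Proof. by have := wd_lin c 1 u v; rewrite !scale1r. Qed.
Lemma wdZ s c b (u : kos s) : wd c (b *: u) = b *: wd c u.
Proof. by have := wd_lin c b u 0; rewrite wd0 !addr0. Qed.
Lemma wdN s c (u : kos s) : wd c (- u) = - wd c u.
Proof. by rewrite -scaleN1r wdZ scaleN1r. Qed.

Lemma bd_bd s (z : kos s) : bd (bd z) = 0.
Proof.
elim: s z => [z|t s IH [u v]] //=; apply: injective_projections => /=.
  by rewrite bdD bdZ IH scalerN add0r subrr.
by rewrite bdN IH !oppr0.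
Qed.

(** Exterior multiplication by [c] is a homotopy between 0 and multiplication by [dot s c]. Hence
    every element of the ideal of [s] kills the Koszul homology. *)
Lemma bd_wd s c (z : kos s) : bd (wd c z) + wd c (bd z) = dot s c *: z.
Proof.
elim: s c z => [c z|t s IH c [u v]] /=; first by rewrite scale0r addr0.
apply: injective_projections => /=.
  rewrite wdD wdZ scalerBr scalerA scalerDl -IH.
  by rewrite addrACA subrK addrAC [_ + _ + wd _ _]addrAC addrC.
rewrite bdD bdZ !bdN wdN scalerDl -IH scalerDr scalerA [t * _]mulrC.
by rewrite opprB opprK !addrA subrK [in RHS]addrAC addrC addrA addrC addrA.
Qed.

Lemma hk0 s k : hk k (0 : kos s).
Proof. by elim: s k => [k|t s IH [|k]] //=; split=> //; exact: IH. Qed.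

Lemma hk_lin s k b (u v : kos s) : hk k u -> hk k v -> hk k (b *: u + v).
Proof.
elim: s k u v => [k u v /= hu hv k0|t s IH [|k] [u1 u2] [v1 v2] /= [a1 a2] [b1 b2]].
- by rewrite hu // hv // scaler0 addr0.
- by split; [exact: IH | rewrite a2 b2 scaler0 addr0].
- by split; exact: IH.
Qed.

Lemma hkD s k (u v : kos s) : hk k u -> hk k v -> hk k (u + v).
Proof. by rewrite -{2}[u]scale1r; exact: hk_lin. Qed.

Lemma hkZ s k b (u : kos s) : hk k u -> hk k (b *: u).
Proof. by rewrite -[b *: u]addr0 => h; apply: hk_lin => //; exact: hk0. Qed.

Lemma hkN s k (u : kos s) : hk k u -> hk k (- u).
Proof. by rewrite -scaleN1r; exact: hkZ. Qed.

Lemma hk_wd s c k (z : kos s) : hk k z -> hk k.+1 (wd c z).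
Proof.
elim: s c k z => [//|t s IH c [|k] [u v] /= [h1 h2]].
  by split; [exact: IH | rewrite h2 wd0 subr0; apply: hkZ].
by split; [exact: IH | apply: hkD; [exact: hkZ | apply/hkN/IH]].
Qed.

Lemma bd_hk0 s (z : kos s) : hk 0 z -> bd z = 0.
Proof.
elim: s z => [//|t s IH [u v] /= [h1 ->]].
by rewrite IH // bd0 scaler0 addr0 oppr0.
Qed.

Lemma hk_bd s k (z : kos s) : hk k.+1 z -> hk k (bd z).
Proof.
elim: s k z => [//|t s IH k [u v] /= [h1 h2]]; split.
  by apply: hkD; [exact: IH | exact: hkZ].
by case: k h1 h2 => [|k] h1 h2; [rewrite bd_hk0 ?oppr0 | apply/hkN/IH].
Qed.

Lemma hk_gt s k (z : kos s) : (size s < k)%N -> hk k z -> z = 0.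
Proof.
elim: s k z => [[|k] // z _ /= -> //|t s IH [|k] //= [u v] hk1 [/= h1 h2]].
by rewrite (IH _ _ (ltnW hk1) h1) (IH _ _ hk1 h2).
Qed.

Section InK.
Variable a : seq A.

Lemma inK_lin s b (u v : kos s) :
  inK (idl a) u -> inK (idl a) v -> inK (idl a) (b *: u + v).
Proof.
elim: s u v => [u v hu hv|t s IH [u1 u2] [v1 v2] [a1 a2] [b1 b2]] /=.
  by apply: idlD => //; apply: idlM.
by split; exact: IH.
Qed.

Lemma inK0 s : inK (idl a) (0 : kos s).
Proof. by elim: s => [|t s IH] //=; exact: idl0. Qed.

Lemma inKZ s b (u : kos s) : inK (idl a) u -> inK (idl a) (b *: u).
Proof. by move=> h; rewrite -[b *: u]addr0; apply: inK_lin => //; exact: inK0. Qed.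

Lemma inKD s (u v : kos s) :
  inK (idl a) u -> inK (idl a) v -> inK (idl a) (u + v).
Proof. by rewrite -{2}[u]scale1r; exact: inK_lin. Qed.

Lemma inKN s (u : kos s) : inK (idl a) u -> inK (idl a) (- u).
Proof. by rewrite -scaleN1r; exact: inKZ. Qed.

Lemma inK_bd s (z : kos s) : inK (idl a) z -> inK (idl a) (bd z).
Proof.
elim: s z => [z _|t s IH [u v] [h1 h2]] /=; first exact: idl0.
by split; [apply: inKD; [exact: IH | exact: inKZ] | apply/inKN/IH].
Qed.

Lemma inK_wd s c (z : kos s) : inK (idl a) z -> inK (idl a) (wd c z).
Proof.
elim: s c z => [c z _|t s IH c [u v] [h1 h2]] /=; first exact: idl0.
by split; [exact: IH | apply: inKD; [exact: inKZ | apply/inKN/IH]].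
Qed.

(** Division by [t], coefficient by coefficient. The quotient is kept in degree [k] because it will
    be the chain whose boundary is sought. *)
Lemma inK_cons s t k (z : kos s) : hk k z -> inK (idl (t :: a)) z ->
  exists v w, [/\ z = t *: v + w, hk k v & inK (idl a) w].
Proof.
elim: s k z => [|t' s IH] k z.
  case: k => [|k] hz /=; last by exists 0, 0; rewrite hz // scaler0 addr0; split=> //; exact: idl0.
  by move=> [q [y [-> hy]]]; exists q, y; split.
case: z => z1 z2 [/= h1 h2] [/= i1 i2].
have [v1 [w1 [e1 hv1 hw1]]] := IH _ _ h1 i1.
case: k h1 h2 hv1 => [|k] h1 h2 hv1.
  exists (v1, 0), (w1, 0); split=> //=; last by split=> //; exact: inK0.
  by congr pair => //=; rewrite h2 scaler0 addr0.
have [v2 [w2 [e2 hv2 hw2]]] := IH _ _ h2 i2.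
by exists (v1, v2), (w1, w2); split=> //=; apply: injective_projections.
Qed.

Lemma inK_reg s t (z : kos s) : (forall x, idl a (t * x) -> idl a x) ->
  inK (idl a) (t *: z) -> inK (idl a) z.
Proof.
move=> ht; elim: s z => [z /= /ht //|t' s IH [u v] [h1 h2]] /=.
by split; exact: IH.
Qed.
End InK.

Lemma inK_nil s (z : kos s) : inK (idl [::]) z -> z = 0.
Proof. by elim: s z => [//|t s IH [u v] [/= /IH -> /IH ->]]. Qed.

(* Descending induction on the length of [a]: if [t] kills the homology and is
   regular modulo [a], a cycle z modulo [a] gives the cycle c /\ z modulo
   [t :: a], one degree higher, and c /\ z = bd u + t v forces z = bd v. *)
Lemma koszul_acyclic s b a k (z : kos s) :
  size (b ++ a) = size s -> reg (b ++ a) -> {in b, forall t, idl s t} ->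
  (size a < k)%N -> hk k z -> inK (idl a) (bd z) ->
  exists u, hk k.+1 u /\ inK (idl a) (z - bd u).
Proof.
elim/last_ind: b a k z => [|b t IH] a k z sz rg hb hk1 hz hbz.
  exists 0; split; first exact: hk0.
  by rewrite (hk_gt _ hz) -?sz // bd0 subr0; exact: inK0.
have [c tE] : exists c, t = dot s c.
  by apply/idl_dot/hb; rewrite mem_rcons mem_head.
have ht x : idl a (t * x) -> idl a x.
  have: reg (t :: a) by move: rg; rewrite cat_rcons; elim: (b) => //= ? ? IHb [/IHb].
  by case=> _; apply.
have hy := hk_wd c hz.
have ey : bd (wd c z) = t *: z - wd c (bd z) by rewrite tE -(bd_wd c) addrK.
have [|||||u [hu iu]] := IH (t :: a) k.+1 (wd c z) _ _ _ _ hy.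
- by rewrite -cat_rcons.
- by rewrite -cat_rcons.
- by move=> x xb; apply: hb; rewrite mem_rcons inE xb orbT.
- by [].
- have sub (x : A) : idl a x -> idl (t :: a) x by exists 0, x; rewrite mulr0 add0r.
  have subK (s' : seq A) (x : kos s') : inK (idl a) x -> inK (idl (t :: a)) x.
    by elim: s' x => [x /sub //|t' s' IH' [x y] [/= h1 h2]]; split; exact: IH'.
  rewrite ey; apply: (@inKD (t :: a)); last by apply/inKN/subK/inK_wd.
  have tt : idl (t :: a) t by exists 1, 0; split; [ring | exact: idl0].
  elim: (s) z {hz hbz hy ey} => [z|t' s' IH' [x y]] /=; last by split; exact: IH'.
  by exists z, 0; split; [rewrite addr0 | exact: idl0].
have hyu : hk k.+1 (wd c z - bd u) by apply: hkD => //; apply/hkN/hk_bd.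
have [v [w [e hv hw]]] := inK_cons hyu iu.
exists v; split=> //; apply: (inK_reg ht).
have := congr1 (@bd s) e; rewrite bdD bdN bd_bd subr0 ey bdD bdZ => e'.
suff -> : t *: (z - bd v) = bd w + wd c (bd z).
  by apply: inKD; [exact: inK_bd | exact: inK_wd].
by rewrite scalerBr -[t *: z](subrK (wd c (bd z))) e' addrAC [_ + bd w]addrC addrK.
Qed.

(** The coefficient on the empty exterior product; [unitK] is a section of it. *)
Fixpoint aug s : kos s -> A :=
  match s with [::] => id | t :: s' => fun z => aug z.1 end.

Fixpoint unitK s (x : A) : kos s :=
  match s with [::] => x | t :: s' => (unitK s' x, 0) end.

Lemma aug_bd s (z : kos s) : idl s (aug (bd z)).
Proof.
elim: s z => [z|t s IH [u v]] //=.
have augD (s' : seq A) b (x y : kos s') : aug (b *: x + y) = b * aug x + aug y.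
  by elim: s' x y => //= t' s' IH' [x1 x2] [y1 y2] /=; rewrite IH'.
by rewrite addrC augD; exists (aug v), (aug (bd u)).
Qed.

(** The relation [c], multiplied by the unit, is a 1-cycle. With as many regular elements in the
    ideal as there are generators, acyclicity starts in degree 1, so this cycle is [bd u]. Its
    coefficient on e_t is [head 0 c], that of [bd u] is a boundary over [s], and [aug] sends
    boundaries into the ideal of [s]. *)
Lemma koszul_head t s a c : size a = (size s).+1 -> reg a ->
  {in a, forall x, idl (t :: s) x} -> dot (t :: s) c = 0 -> idl s (head 0 c).
Proof.
move=> sz rg ha dc.
pose e := unitK (t :: s) 1; pose z := wd c e.
have he : hk 0 e.
  have h (s' : seq A) : hk 0 (unitK s' 1) by elim: s' => //= t' s' IH; split.
  exact: h.
have bz : bd z = 0 by have := bd_wd c e; rewrite dc scale0r (bd_hk0 he) wd0 addr0.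
have [|||||u [_ /inK_nil /subr0_eq zu]] :=
    @koszul_acyclic (t :: s) a [::] 1 z _ _ _ _ (hk_wd c he) => //.
- by rewrite cats0 sz.
- by rewrite cats0.
- by rewrite bz; exact: inK0.
have := congr1 snd zu; rewrite /z /= wd0 subr0 => /(congr1 (@aug s)).
have augZ (s' : seq A) b : aug (b *: unitK s' 1) = b by elim: s' => //=; exact: mulr1.
rewrite augZ => ->; rewrite -bdN; exact: aug_bd.
Qed.

End Koszul.

(** * Polynomials and weights *)

Section Monomials.
Variables (K : fieldType) (n : nat).
Implicit Types (p q : mpoly n K) (m : multinom n) (M : 'I_n -> nat).

Local Notation "''X' i" := (mpolyX K (mnm1 i)) (at level 8, i at level 2).

Lemma mcoeffMXm p m k :
  mcoeff k (p * mpolyX K m) = if lem m k then mcoeff (mnm_sub k m) p else 0.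
Proof.
case: ifP => [mk|mk]; first by rewrite -{1}(submK mk) addmC mcoeffMX.
apply/memN_msupp_eq0/negP; rewrite (perm_mem (msuppMX _ _)) => /mapP[m' _ kE].
by move: mk; rewrite kE lem_addr.
Qed.

Lemma mcoeffXM i p k :
  mcoeff k ('X i * p) = if k i == 0%N then 0 else mcoeff (mnm_sub k (mnm1 i)) p.
Proof. by rewrite mulrC mcoeffMXm lep1mP if_neg. Qed.

(** A monomial ideal is spanned by the monomials that it contains, so membership is a condition on
    the support alone. *)
Lemma idl_monomials (r : seq 'I_n) M p :
  idl [seq 'X i ^+ M i | i <- r] p <->
  forall m, m \in msupp p -> has (fun i => M i <= m i)%N r.
Proof.
have le_Xn i m : lem (mnm_muln (mnm1 i) (M i)) m = (M i <= m i)%N.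
  apply/mnm_lepP/idP => [/(_ i)|h j]; rewrite mulmnE mnm1E.
    by rewrite eqxx mul1n.
  by case: eqP => [<-|_]; rewrite ?mul1n // mul0n.
split.
  elim: r p => [p /= -> m|i r IH p /= [q [y [-> /IH hy]]] m]; first by rewrite msupp0.
  move=> /msuppD_le; rewrite mem_cat => /orP[|/hy h]; last by rewrite /= h orbT.
  rewrite mcoeff_msupp mulrC mpolyXn mcoeffMXm le_Xn.
  by case: ifP => //=; rewrite eqxx.
move=> h; rewrite [p]mpolyE big_seq; elim/big_ind: _ => [||m /h].
- exact: idl0.
- exact: idlD.
move=> hm; rewrite -mul_mpolyC; apply: idlM.
elim: r hm {h} => [//|i r IH] /= /orP[hi|/IH hr]; last first.
  by exists 0, (mpolyX K m); rewrite mulr0 add0r.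
exists (mpolyX K (mnm_sub m (mnm_muln (mnm1 i) (M i)))), 0; split; last exact: idl0.
by rewrite addr0 mpolyXn -mpolyXD addmC submK // le_Xn.
Qed.

(** Multiplication by a power of ['X i] changes only the exponent of ['X i], to which the later
    generators are blind. *)
Lemma reg_monomials (r : seq 'I_n) M :
  uniq r -> reg [seq 'X i ^+ M i | i <- r].
Proof.
elim: r => //= i r IH /andP[ir /IH rg]; split=> // p /idl_monomials hp.
apply/idl_monomials => m mp.
have /hp : mnm_add m (mnm_muln (mnm1 i) (M i)) \in msupp ('X i ^+ M i * p).
  by rewrite mcoeff_msupp mulrC mpolyXn addmC mcoeffMX -mcoeff_msupp.
move=> /hasP[j jr hj]; apply/hasP; exists j => //; move: hj.
rewrite mnmDE mulmnE mnm1E; case: eqP => [ij|_]; last by rewrite mul0n addn0.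
by rewrite ij jr in ir.
Qed.

Lemma idl_sum (A : comNzRingType) (r : seq 'I_n) (g : 'I_n -> A) x :
  uniq r -> idl (map g r) x ->
  exists q : 'I_n -> A, x = \sum_(i <- r) q i * g i.
Proof.
elim: r x => [x _ /= ->|i r IH x /= /andP[ir ur] [q [y [-> hy]]]].
  by exists (fun=> 0); rewrite big_nil.
have [h ->] := IH y ur hy.
exists (fun j => if j == i then q else h j).
rewrite big_cons eqxx mulrC; congr (_ + _); apply: eq_big_seq => j jr.
by case: eqP => // ji; rewrite -ji jr in ir.
Qed.

Lemma sum_idl (A : comNzRingType) (r : seq 'I_n) (g q : 'I_n -> A) :
  idl (map g r) (\sum_(i <- r) q i * g i).
Proof.
elim: r => [|i r IH] /=; first by rewrite big_nil.
by exists (q i), (\sum_(i <- r) q i * g i); rewrite big_cons mulrC.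
Qed.

Lemma dot_map (A : comNzRingType) (r : seq 'I_n) (g q : 'I_n -> A) :
  dot (map g r) (map q r) = \sum_(i <- r) q i * g i.
Proof.
elim: r => [|i r IH] /=; first by rewrite big_nil.
by rewrite big_cons IH mulrC.
Qed.

(** The regular sequence fed to [koszul_head] consists of the powers of the variables, not of the
    [g j]; the index [i] is moved to the front so that [Y i] is the head. *)
Lemma syzygy_in_ideal (g Y : 'I_n -> mpoly n K) M :
  (forall i, exists q : 'I_n -> mpoly n K, 'X i ^+ M i = \sum_j q j * g j) ->
  \sum_j Y j * g j = 0 ->
  forall i, exists q : 'I_n -> mpoly n K, Y i = \sum_(j | j != i) q j * g j.
Proof.
move=> hM hY i.
pose r := [seq j <- index_enum 'I_n | j != i].
have pr : perm_eq (index_enum 'I_n) (i :: r).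
  apply: uniq_perm; rewrite /= ?filter_uniq ?index_enum_uniq //.
    by rewrite mem_filter eqxx.
  by move=> j; rewrite inE mem_filter mem_index_enum andbT orbN.
have ur : uniq (i :: r) by rewrite -(perm_uniq pr) index_enum_uniq.
have rr : uniq r by case/andP: ur.
have sumr (F : 'I_n -> mpoly n K) : \sum_(j <- i :: r) F j = \sum_j F j.
  by rewrite (perm_big _ pr).
have /(idl_sum rr) [q qE] : idl (map g r) (Y i).
  apply: (@koszul_head _ (g i) (map g r)
            [seq 'X i ^+ M i | i <- i :: r] (map Y (i :: r))).
  - by rewrite /= !size_map.
  - exact: reg_monomials.
  - move=> _ /mapP[j _ ->]; have [q ->] := hM j.
    by rewrite -sumr; exact: (sum_idl (i :: r)).
  - by rewrite -[_ :: map g r]/(map g (i :: r)) dot_map sumr.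
by exists q; rewrite qE big_filter.
Qed.

Lemma mcoeff_lincomb (B : {fset multinom n}) (a : B -> K) (m : B) :
  mcoeff (val m) (\sum_k a k *: mpolyX K (val k)) = a m.
Proof.
rewrite raddf_sum /= (bigD1 m) //= mcoeffZ mcoeffX eqxx mulr1 big1 ?addr0 // => k km.
rewrite mcoeffZ mcoeffX; case: eqP => [kE|]; last by rewrite mulr0.
by case/eqP: km; apply: val_inj.
Qed.

Lemma msupp_lincomb (B : {fset multinom n}) (a : B -> K) :
  {subset msupp (\sum_k a k *: mpolyX K (val k)) <= B}.
Proof.
move=> m; rewrite mcoeff_msupp raddf_sum /=; apply: contraNT => mB.
rewrite big1 // => k _; rewrite mcoeffZ mcoeffX; case: eqP => [km|]; rewrite ?mulr0 //.
by rewrite -km (valP k) in mB.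
Qed.

Lemma lincombK (B : {fset multinom n}) p : {subset msupp p <= B} ->
  p = \sum_(m : B) mcoeff (val m) p *: mpolyX K (val m).
Proof.
move=> pB; apply/mpolyP => m; have [mB|mB] := boolP (m \in B).
  by rewrite (mcoeff_lincomb (fun k => mcoeff (val k) p) [` mB]%fset).
rewrite (memN_msupp_eq0 (contra (pB m) mB)).
by rewrite (memN_msupp_eq0 (contra (@msupp_lincomb _ _ m) mB)).
Qed.

End Monomials.

(** * Weighted degrees and weighted homogeneous components *)

Section Weights.
Variables (K : numFieldType) (n : nat) (w : 'I_n -> nat).
Implicit Types (p q : mpoly n K) (m : multinom n) (d e : int).

Local Notation "''X' i" := (mpolyX K (mnm1 i)) (at level 8, i at level 2).

Definition wdeg m : nat := (\sum_i w i * m i)%N.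

Lemma wdegD m m' : wdeg (mnm_add m m') = (wdeg m + wdeg m')%N.
Proof. by rewrite /wdeg -big_split /=; apply: eq_bigr => i _; rewrite mnmDE mulnDr. Qed.

Lemma wdeg1 i : wdeg (mnm1 i) = w i.
Proof.
rewrite /wdeg (bigD1 i) //= mnm1E eqxx muln1 big1 ?addn0 // => j ji.
by rewrite mnm1E eq_sym (negPf ji) muln0.
Qed.

Lemma mdeg_le_wdeg m : (forall i, (0 < w i)%N) -> (mdeg m <= wdeg m)%N.
Proof.
by move=> hw; rewrite mdegE /wdeg; apply: leq_sum => i _; rewrite leq_pmull.
Qed.

Lemma mcoeff_euler p m :
  mcoeff m (\sum_(i < n) (w i)%:R *: ('X i * mderiv i p)) = (wdeg m)%:R * mcoeff m p.
Proof.
rewrite raddf_sum /= /wdeg natr_sum mulr_suml; apply: eq_bigr => i _.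
rewrite mcoeffZ mcoeffXM natrM -mulrA; congr (_ * _).
case: eqP => [->|/eqP mi]; first by rewrite mul0r.
rewrite mcoeff_deriv submK ?lep1mP // mnmBE mnm1E eqxx subn1 prednK ?lt0n //.
by rewrite mulr_natl.
Qed.

(** Monomials are eigenvectors of W with eigenvalue [wdeg m]; in characteristic 0 the eigenvalue
    determines the integer. *)
Lemma qhP d p : quasihomogeneous w d p <->
  forall m, mcoeff m p != 0 -> (wdeg m)%:Z = d.
Proof.
split=> [h m mp|h].
  have := congr1 (mcoeff m) h; rewrite mcoeff_euler mcoeffZ => /(mulIf mp) /eqP.
  by rewrite pmulrn eqr_int => /eqP.
apply/mpolyP => m; rewrite mcoeff_euler mcoeffZ.
have [->|/h <-] := eqVneq (mcoeff m p) 0; first by rewrite !mulr0.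
by rewrite -pmulrn.
Qed.

Lemma qh_lin d (a : K) p q : quasihomogeneous w d p -> quasihomogeneous w d q ->
  quasihomogeneous w d (a *: p + q).
Proof.
move=> /qhP hp /qhP hq; apply/qhP => m.
rewrite mcoeffD mcoeffZ; have [/hq //|q0] := boolP (mcoeff m q != 0).
rewrite negbK in q0; rewrite (eqP q0) addr0 mulf_eq0 negb_or => /andP[_].
exact: hp.
Qed.

Lemma qh0 d : quasihomogeneous w d (0 : mpoly n K).
Proof. by apply/qhP => m; rewrite mcoeff0 eqxx. Qed.

Lemma qhZ d (a : K) p : quasihomogeneous w d p -> quasihomogeneous w d (a *: p).
Proof. by move=> h; rewrite -[_ *: _]addr0; apply: qh_lin => //; exact: qh0. Qed.

Lemma qhD d p q : quasihomogeneous w d p -> quasihomogeneous w d q ->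
  quasihomogeneous w d (p + q).
Proof. by rewrite -{2}[p]scale1r; exact: qh_lin. Qed.

Lemma qhB d p q : quasihomogeneous w d p -> quasihomogeneous w d q ->
  quasihomogeneous w d (p - q).
Proof. by move=> hp hq; rewrite -scaleN1r addrC; exact: qh_lin. Qed.

Lemma qh_sum d (I : Type) (r : seq I) (P : pred I) (F : I -> mpoly n K) :
  (forall i, P i -> quasihomogeneous w d (F i)) ->
  quasihomogeneous w d (\sum_(i <- r | P i) F i).
Proof. by move=> h; elim/big_ind: _ => //; [exact: qh0 | exact: qhD]. Qed.

Lemma qhM d e p q : quasihomogeneous w d p -> quasihomogeneous w e q ->
  quasihomogeneous w (d + e) (p * q).
Proof.
move=> /qhP hp /qhP hq; apply/qhP => m; rewrite -mcoeff_msupp => /msuppM_le.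
move=> /allpairsP[[m1 m2] /= [h1 h2 ->]]; rewrite wdegD PoszD.
by rewrite hp ?hq -?mcoeff_msupp.
Qed.

Lemma qhX i : quasihomogeneous w (w i)%:Z 'X i.
Proof.
by apply/qhP => m; rewrite mcoeffX; case: (mnm1 i =P m) => [<-|]; rewrite ?wdeg1 ?eqxx.
Qed.

Lemma qh_deriv d i p : quasihomogeneous w d p ->
  quasihomogeneous w (d - (w i)%:Z) (mderiv i p).
Proof.
move=> /qhP hp; apply/qhP => m; rewrite mcoeff_deriv => h.
have /hp <- : mcoeff (mnm_add m (mnm1 i)) p != 0.
  by apply: contraNneq h => ->; rewrite mul0rn.
by rewrite wdegD wdeg1 PoszD addrK.
Qed.

Lemma qh_neg d p : d < 0 -> quasihomogeneous w d p -> p = 0.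
Proof.
move=> d0 /qhP h; apply/mpolyP => m; rewrite mcoeff0; apply/eqP.
by apply: contraTT d0 => /h dE; rewrite -dE -leNgt.
Qed.

(** The weighted homogeneous component of degree [d]. The degree is an integer since differences
    such as [d - e] in [compM] may be negative; the component is then 0. *)
Definition comp d p : mpoly n K :=
  \sum_(m <- msupp p | (wdeg m)%:Z == d) mcoeff m p *: mpolyX K m.

Lemma mcoeff_comp d p m :
  mcoeff m (comp d p) = if (wdeg m)%:Z == d then mcoeff m p else 0.
Proof.
rewrite /comp raddf_sum /= big_mkcond /=.
transitivity (\sum_(k <- msupp p)
    if k == m then (if (wdeg m)%:Z == d then mcoeff m p else 0) else 0).
  apply: eq_bigr => k _; rewrite mcoeffZ mcoeffX.
  by case: (k =P m) => [->|_]; case: ifP; rewrite ?mulr1 ?mulr0.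
have [mp|mp] := boolP (m \in msupp p).
  by rewrite (bigD1_seq m) ?msupp_uniq //= eqxx big1 ?addr0 // => k /negPf ->.
rewrite big1_seq => [|k /= kp]; first by rewrite (memN_msupp_eq0 mp) if_same.
by case: eqP => // km; rewrite -km kp in mp.
Qed.

Lemma comp_qh d p : quasihomogeneous w d (comp d p).
Proof. by apply/qhP => m; rewrite mcoeff_comp; case: ifP => [/eqP //|_]; rewrite eqxx. Qed.

Lemma comp_id d p : quasihomogeneous w d p -> comp d p = p.
Proof.
move=> /qhP h; apply/mpolyP => m; rewrite mcoeff_comp.
by have [-> |/h ->] := eqVneq (mcoeff m p) 0; rewrite ?if_same ?eqxx.
Qed.

Lemma comp_lin d (a : K) p q : comp d (a *: p + q) = a *: comp d p + comp d q.
Proof.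
apply/mpolyP => m; rewrite mcoeffD mcoeffZ !mcoeff_comp mcoeffD mcoeffZ.
by case: ifP; rewrite ?mulr0 ?addr0.
Qed.

Lemma comp0 d : comp d 0 = 0.
Proof. by rewrite comp_id //; exact: qh0. Qed.
Lemma compD d p q : comp d (p + q) = comp d p + comp d q.
Proof. by have := comp_lin d 1 p q; rewrite !scale1r. Qed.
Lemma compZ d a p : comp d (a *: p) = a *: comp d p.
Proof. by have := comp_lin d a p 0; rewrite comp0 !addr0. Qed.
Lemma compB d p q : comp d (p - q) = comp d p - comp d q.
Proof. by rewrite compD -scaleN1r compZ scaleN1r. Qed.
Lemma comp_sum d (I : Type) (r : seq I) (P : pred I) (F : I -> mpoly n K) :
  comp d (\sum_(i <- r | P i) F i) = \sum_(i <- r | P i) comp d (F i).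
Proof. by apply: (big_morph (comp d)); [exact: compD | exact: comp0]. Qed.

Lemma compM d e p q : quasihomogeneous w e q ->
  comp d (p * q) = comp (d - e) p * q.
Proof.
move=> /qhP hq; rewrite [q]mpolyE !mulr_sumr comp_sum; apply: eq_big_seq => m.
rewrite mcoeff_msupp => /hq me.
rewrite -!scalerAr compZ; congr (_ *: _); apply/mpolyP => k.
rewrite mcoeff_comp !mcoeffMXm; have [mk|mk] := boolP (lem m k); last by rewrite if_same.
rewrite mcoeff_comp; congr (if _ then _ else _).
by rewrite -{1}(submK mk) wdegD PoszD me [RHS]eq_sym subr_eq eq_sym.
Qed.

Lemma comp_deriv d i p : comp d (mderiv i p) = mderiv i (comp (d + (w i)%:Z) p).
Proof.
apply/mpolyP => m; rewrite mcoeff_comp !mcoeff_deriv mcoeff_comp.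
by rewrite wdegD wdeg1 PoszD (inj_eq (addIr _)); case: ifP; rewrite ?mul0rn.
Qed.

(* A degree count: the ideal membership of [syzygy_in_ideal] has cofactors of
   degree [w i + w j - \sum_k w k], which is negative once [3 <= n]. *)
Lemma qh_syzygy_eq0 (N : int) (f : mpoly n K) (Y : 'I_n -> mpoly n K) M :
  (3 <= n)%N -> (forall i, (0 < w i)%N) -> quasihomogeneous w N f ->
  (forall i, exists q : 'I_n -> mpoly n K,
     'X i ^+ M i = \sum_j q j * mderiv j f) ->
  (forall i, quasihomogeneous w (N - \sum_(j < n) (w j)%:Z + (w i)%:Z) (Y i)) ->
  \sum_j Y j * mderiv j f = 0 -> forall i, Y i = 0.
Proof.
move=> n3 hw hf hM hY sY i.
have [q qE] := syzygy_in_ideal hM sY i.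
rewrite -[Y i](comp_id (hY i)) qE comp_sum big1 // => j ji.
rewrite (compM _ _ (qh_deriv j hf)).
suff dneg : N - \sum_(j < n) (w j)%:Z + (w i)%:Z - (N - (w j)%:Z) < 0.
  by rewrite (qh_neg dneg (comp_qh _ _)) mul0r.
have [k ki kj] : exists2 k, k != i & k != j.
  have : (0 < #|[set~ i] :\ j|)%N.
    have := cardsD1 j [set~ i]; rewrite !inE ji cardsC1 card_ord => e.
    by rewrite -(ltn_add2l 1) -[(1 + #|_|)%N]e; case: (n) n3 => [|[|[|]]].
  by rewrite card_gt0 => /set0Pn[k]; rewrite !inE => /andP[kj ki]; exists k.
rewrite (bigD1 i) //= (bigD1 j) //= (bigD1 k) ?ki //=.
set S := \sum_(_ < _ | _) _.
have S0 : 0 <= S by apply: sumr_ge0.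
have wk : 0 < (w k)%:Z :> int by rewrite ltz_nat.
lra.
Qed.

Lemma qh_top_degree_eq0 (N : int) (f h : mpoly n K) (P : 'I_n -> mpoly n K) M :
  (3 <= n)%N -> (forall i, (0 < w i)%N) -> quasihomogeneous w N f -> N != 0 ->
  let d := N - \sum_(j < n) (w j)%:Z in
  (forall i, exists q : 'I_n -> mpoly n K,
     'X i ^+ M i = \sum_j q j * mderiv j f) ->
  quasihomogeneous w d h -> (forall i, quasihomogeneous w (d + (w i)%:Z) (P i)) ->
  f * h = f * (\sum_i mderiv i (P i)) - \sum_i P i * mderiv i f ->
  h = 0.
Proof.
move=> n3 hw hf N0 d hM hh hP e.
have N0' : N%:~R != 0 :> K by rewrite intr_eq0.
pose b := \sum_i mderiv i (P i) - h.
have qb : quasihomogeneous w d b.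
  apply: qhB => //; apply: qh_sum => i _.
  by rewrite -[d](addrK (w i)%:Z); exact: qh_deriv.
pose Y i := P i - ((w i)%:R / N%:~R) *: ('X i * b).
have qY i : quasihomogeneous w (d + (w i)%:Z) (Y i).
  by apply: qhB => //; apply: qhZ; rewrite addrC; exact: qhM (qhX i) qb.
have sP : \sum_i P i * mderiv i f = f * b.
  by rewrite mulrBr e opprB addrC subrK.
have sY : \sum_i Y i * mderiv i f = 0.
  under eq_bigr do rewrite mulrBl.
  rewrite sumrB sP; apply/eqP; rewrite subr_eq0; apply/eqP.
  have := hf; rewrite /quasihomogeneous /= => /(congr1 (fun x => N%:~R^-1 *: x)).
  rewrite scalerA mulVf // scale1r => {1}<-.
  rewrite scaler_sumr mulr_suml; apply: eq_bigr => i _.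
  by rewrite -!scalerAl scalerA [_ / _]mulrC; congr (_ *: _); ring.
have PE i : P i = ((w i)%:R / N%:~R) *: ('X i * b).
  exact: subr0_eq (qh_syzygy_eq0 n3 hw hf hM qY sY i).
(* The field is now [(b / N) W], whose divergence is [(d + \sum w) / N] times [b]; that factor is 1
   by the choice of [d]. As [b] is the divergence minus [h], this leaves [h = 0]. *)
suff : \sum_i mderiv i (P i) = b.
  by rewrite /b => /eqP; rewrite eq_sym subr_eq addrC -subr_eq subrr => /eqP.
have dX (i : 'I_n) : mderiv i 'X i = 1.
  rewrite mderivX mnm1E eqxx scale1r.
  suff -> : mnm_sub (mnm1 i) (mnm1 i) = @mnm0 n by rewrite mpolyX0.
  by apply/mnmP => j; rewrite mnmBE subnn mnm0E.
under eq_bigr do rewrite PE mderivZ mderivM dX mul1r scalerDr.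
rewrite big_split /= -scaler_suml.
under [X in _ + X]eq_bigr do rewrite mulrC -scalerA.
rewrite -scaler_sumr.
move: (qb); rewrite /quasihomogeneous /= => ->.
rewrite scalerA -scalerDl /d rmorphB rmorph_sum /= -mulr_suml -[RHS]scale1r.
by congr (_ *: _); rewrite mulrBr mulVf // [X in _ - X]mulrC addrC subrK.
Qed.

End Weights.

(** * Coboundaries in an abstract category of germs *)

Section Germs.
Variables (K : numFieldType) (n : nat) (G : germ_model K n).

Local Notation "''X' i" := (mpolyX K (mnm1 i)) (at level 8, i at level 2).
Local Notation C := (in_cat G).
Local Notation "p ** a" := (@gmul K n G (@gpoly K n G p) a) (at level 40).
Implicit Types (p q : mpoly n K) (a b : rep G) (c : K).
Local Notation "a ~~ b" := (germ_eq G a b) (at level 70).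

(* What the proof needs of a category of germs: formal calculus, [ev] being
   the value at 0, Hadamard's lemma, and the solvability of the Euler equation
   W g + (k + 1) g = b. *)
Record germ_axioms (ev : rep G -> K) : Prop := GermAxioms {
  ge_refl : forall a, a ~~ a;
  ge_sym : forall a b, a ~~ b -> b ~~ a;
  ge_trans : forall a b d, a ~~ b -> b ~~ d -> a ~~ d;
  ge_lin : forall (c : K) a a' b b', a ~~ a' -> b ~~ b' ->
    c *: a + b ~~ c *: a' + b';
  ge_mul : forall a a' b b', a ~~ a' -> b ~~ b' -> gmul a b ~~ gmul a' b';
  ge_pd : forall i a b, a ~~ b -> pd i a ~~ pd i b;
  gmulC : forall a b : rep G, gmul a b = gmul b a;
  gmul_linr : forall (c : K) (a b d : rep G),
    gmul d (c *: a + b) = c *: gmul d a + gmul d b;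
  gpoly_lin : forall (c : K) p q,
    gpoly (c *: p + q) = c *: gpoly p + gpoly q :> rep G;
  cat0 : C 0;
  cat1 : C (gpoly 1);
  cat_lin : forall (c : K) a b, C a -> C b -> C (c *: a + b);
  cat_pd : forall i a, C a -> C (pd i a);
  cat_mulX : forall i a, C a -> C ('X i ** a);
  gmul1 : forall a : rep G, 1 ** a = a;
  gmulA : forall p q (a : rep G), (p * q) ** a = p ** (q ** a);
  pd_lin : forall i (c : K) a b, C a -> C b -> pd i (c *: a + b) ~~ c *: pd i a + pd i b;
  pd_one : forall i, pd i (gpoly 1) ~~ 0;
  pd_mulX : forall i j a, C a ->
    pd i ('X j ** a) ~~ (i == j)%:R *: a + 'X j ** pd i a;
  ev_ge : forall a b, a ~~ b -> ev a = ev b;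
  ev_lin : forall (c : K) a b, ev (c *: a + b) = c * ev a + ev b;
  ev_one : ev (gpoly 1) = 1;
  ev_mulX : forall i a, ev ('X i ** a) = 0;
  hadamard : forall a, C a -> exists2 b : 'I_n -> rep G, forall i, C (b i)
    & a ~~ ev a *: gpoly 1 + \sum_i 'X i ** b i;
  euler_neg : forall (w : 'I_n -> nat) (k : nat) b, (forall i, 0 < w i)%N -> C b ->
    exists2 g, C g & \sum_(i < n) (w i)%:R *: ('X i ** pd i g) + k.+1%:R *: g ~~ b }.

Variables (ev : rep G -> K) (ax : germ_axioms ev).

#[local] Instance ge_equiv : Equivalence (germ_eq G).
Proof. by split; [exact: ge_refl ax | exact: ge_sym ax | exact: ge_trans ax]. Qed.

#[local] Instance geD : Proper (respectful (germ_eq G)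
  (respectful (germ_eq G) (germ_eq G))) (@GRing.add (rep G)).
Proof.
by move=> a a' ha b b' hb; rewrite -[a]scale1r -[a']scale1r; exact: ge_lin ax _ _ _ _ _ ha hb.
Qed.

#[local] Instance geZ : Proper (respectful eq
  (respectful (germ_eq G) (germ_eq G))) (@GRing.scale K (rep G)).
Proof.
move=> c _ <- a a' ha; rewrite -[c *: a]addr0 -[c *: a']addr0.
exact: ge_lin ax _ _ _ _ _ ha (ge_refl ax 0).
Qed.

#[local] Instance geN : Proper (respectful (germ_eq G) (germ_eq G)) (@GRing.opp (rep G)).
Proof. by move=> a a' ha; rewrite -[- a]scaleN1r -[- a']scaleN1r; apply: geZ. Qed.

#[local] Instance geM : Proper (respectful (germ_eq G)
  (respectful (germ_eq G) (germ_eq G))) (@gmul K n G).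
Proof. by move=> a a' ha b b'; exact: ge_mul ax _ _ _ _ ha. Qed.

#[local] Instance geP i : Proper (respectful (germ_eq G) (germ_eq G)) (@pd K n G i).
Proof. by move=> a a'; exact: ge_pd ax _ _ _. Qed.

Lemma ge_sum (I : Type) (r : seq I) (P : pred I) (F F' : I -> rep G) :
  (forall i, P i -> F i ~~ F' i) ->
  \sum_(i <- r | P i) F i ~~ \sum_(i <- r | P i) F' i.
Proof.
move=> h; elim/big_ind2: _ => // [|a b a1 b1 ha hb]; first reflexivity.
by rewrite ha hb; reflexivity.
Qed.

Lemma catD a b : C a -> C b -> C (a + b).
Proof. by rewrite -{2}[a]scale1r; exact: cat_lin ax _ _ _. Qed.
Lemma catZ c a : C a -> C (c *: a).
Proof. by move=> h; rewrite -[_ *: _]addr0; apply: cat_lin ax _ _ _ h (cat0 ax). Qed.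
Lemma catN a : C a -> C (- a).
Proof. by rewrite -scaleN1r; exact: catZ. Qed.
Lemma catB a b : C a -> C b -> C (a - b).
Proof. by move=> ha hb; apply: catD => //; exact: catN. Qed.
Lemma cat_sum (I : Type) (r : seq I) (P : pred I) (F : I -> rep G) :
  (forall i, P i -> C (F i)) -> C (\sum_(i <- r | P i) F i).
Proof. by move=> h; elim/big_ind: _ => //; [exact: cat0 ax | exact: catD]. Qed.

(** This induction matches the interface, which knows the constant 1, multiplication by a coordinate
    and linear combinations. *)
Lemma mpoly_gen_ind (P : mpoly n K -> Prop) : P 1 ->
  (forall i p, P p -> P ('X i * p)) ->
  (forall c p q, P p -> P q -> P (c *: p + q)) -> forall p, P p.
Proof.
move=> P1 PX PL p.
have P0 : P 0 by rewrite -(addNr 1) -scaleN1r; exact: PL.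
have PM : forall m, P (mpolyX K m).
  move=> m; move: {2}(mdeg m) (erefl (mdeg m)) => k; elim: k m => [|k IH] m mk.
    by have /eqP -> : m == @mnm0 n; rewrite ?mpolyX0 // -mdeg_eq0 mk.
  have [i mi] : exists i, m i != 0%N.
    apply/existsP; apply: contra_eqT mk => /existsPn h.
    by rewrite mdegE big1 // => i _; move: (h i); rewrite negbK => /eqP.
  have mE : mnm_add (mnm1 i) (mnm_sub m (mnm1 i)) = m by rewrite addmC submK // lep1mP.
  rewrite -mE mpolyXD; apply/PX/IH.
  by apply/eqP; rewrite -eqSS -mk -[in X in _ == X]mE mdegD mdeg1.
by elim/mpolyind: p => // c m p _ _; exact: PL.
Qed.

Lemma mulL p c a b : p ** (c *: a + b) = c *: (p ** a) + p ** b.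
Proof. exact: gmul_linr ax _ _ _ _. Qed.
Lemma mul0 p : p ** 0 = 0.
Proof. by have := mulL p (-1) 0 0; rewrite scaler0 addr0 scaleN1r addNr. Qed.
Lemma mulD p a b : p ** (a + b) = p ** a + p ** b.
Proof. by have := mulL p 1 a b; rewrite !scale1r. Qed.
Lemma mulZ p c a : p ** (c *: a) = c *: (p ** a).
Proof. by have := mulL p c a 0; rewrite mul0 !addr0. Qed.
Lemma mulN p a : p ** (- a) = - (p ** a).
Proof. by rewrite -[- a]scaleN1r mulZ scaleN1r. Qed.
Lemma mulS (I : Type) p (r : seq I) (P : pred I) (F : I -> rep G) :
  p ** (\sum_(i <- r | P i) F i) = \sum_(i <- r | P i) p ** F i.
Proof. by apply: (big_morph (gmul (gpoly p))); [exact: mulD | exact: mul0]. Qed.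

Lemma gpD p q : gpoly (p + q) = gpoly p + gpoly q :> rep G.
Proof. by have := gpoly_lin ax 1 p q; rewrite !scale1r. Qed.
Lemma gp0 : gpoly 0 = 0 :> rep G.
Proof. by have := gpD 0 0; rewrite addr0 => /esym /eqP; rewrite -subr_eq0 addrK => /eqP. Qed.
Lemma gpZ c p : gpoly (c *: p) = c *: gpoly p :> rep G.
Proof. by have := gpoly_lin ax c p 0; rewrite gp0 !addr0. Qed.
Lemma gpB p q : gpoly (p - q) = gpoly p - gpoly q :> rep G.
Proof. by rewrite gpD -[- q]scaleN1r gpZ scaleN1r. Qed.
Lemma gpS (I : Type) (r : seq I) (P : pred I) (F : I -> mpoly n K) :
  gpoly (\sum_(i <- r | P i) F i) = \sum_(i <- r | P i) gpoly (F i) :> rep G.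
Proof. by apply: (big_morph (@gpoly K n G)); [exact: gpD | exact: gp0]. Qed.

Lemma pmulL c p q a : (c *: p + q) ** a = c *: (p ** a) + q ** a.
Proof.
by rewrite (gpoly_lin ax) (gmulC ax) (gmul_linr ax) !(gmulC ax a).
Qed.
Lemma pmulD p q a : (p + q) ** a = p ** a + q ** a.
Proof. by have := pmulL 1 p q a; rewrite !scale1r. Qed.
Lemma pmul0 a : 0 ** a = 0.
Proof. by have := pmulL (-1) 0 0 a; rewrite scaler0 addr0 scaleN1r addNr. Qed.
Lemma pmulS (I : Type) (r : seq I) (P : pred I) (F : I -> mpoly n K) a :
  (\sum_(i <- r | P i) F i) ** a = \sum_(i <- r | P i) F i ** a.
Proof.
apply: (big_morph (fun p => p ** a)); last exact: pmul0.
by move=> p q; have := pmulL 1 p q a; rewrite !scale1r.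
Qed.
Lemma pmulZ c p a : (c *: p) ** a = c *: (p ** a).
Proof. by have := pmulL c p 0 a; rewrite pmul0 !addr0. Qed.

Lemma cat_mul p a : C a -> C (p ** a).
Proof.
move=> ha; elim/mpoly_gen_ind: p => [|i p IH|c p q hp hq].
- by rewrite (gmul1 ax).
- by rewrite (gmulA ax); exact: cat_mulX ax _ _ IH.
- by rewrite pmulL; exact: cat_lin ax _ _ _ hp hq.
Qed.

Lemma cat_poly p : C (gpoly p).
Proof.
have -> : gpoly p = p ** gpoly 1 :> rep G by rewrite (gmulC ax) (gmul1 ax).
exact/cat_mul/(cat1 ax).
Qed.

Lemma gpM p q : gpoly (p * q) = p ** gpoly q :> rep G.
Proof.
have E r : gpoly r = r ** gpoly 1 :> rep G by rewrite (gmulC ax) (gmul1 ax).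
by rewrite E (gmulA ax) -E.
Qed.

Lemma pd0 i : pd i 0 ~~ (0 : rep G).
Proof.
have := pd_lin ax i (-1) (cat0 ax) (cat0 ax).
by rewrite scaler0 addr0 scaleN1r addNr.
Qed.
Lemma pdD i a b : C a -> C b -> pd i (a + b) ~~ pd i a + pd i b.
Proof. by move=> ha hb; have := pd_lin ax i 1 ha hb; rewrite !scale1r. Qed.
Lemma pdZ i c a : C a -> pd i (c *: a) ~~ c *: pd i a.
Proof.
by move=> ha; have := pd_lin ax i c ha (cat0 ax); rewrite pd0 !addr0.
Qed.
Lemma pdS i (I : Type) (r : seq I) (F : I -> rep G) :
  (forall j, C (F j)) -> pd i (\sum_(j <- r) F j) ~~ \sum_(j <- r) pd i (F j).
Proof.
move=> h; elim: r => [|j r IH]; first by rewrite !big_nil; exact: pd0.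
rewrite !big_cons pdD; [by rewrite IH; reflexivity | exact: h | exact: cat_sum].
Qed.

Lemma leibniz i p a : C a -> pd i (p ** a) ~~ mderiv i p ** a + p ** pd i a.
Proof.
move=> ha; elim/mpoly_gen_ind: p => [|j p IH|c p q hp hq].
- rewrite !(gmul1 ax); suff -> : mderiv i 1 = 0 by rewrite pmul0 add0r; reflexivity.
  by move=> R; exact: mderivC.
- rewrite (gmulA ax) (pd_mulX ax); last exact: cat_mul.
  rewrite IH mderivM pmulD mulD !(gmulA ax) addrA.
  suff -> : mderiv i 'X j = (i == j)%:R *: 1 :> mpoly n K.
    by rewrite pmulZ (gmul1 ax); reflexivity.
  rewrite mderivX mnm1E eq_sym; case: eqP => [->|_]; last by rewrite !scale0r.
  suff -> : mnm_sub (mnm1 j) (mnm1 j) = @mnm0 n by rewrite mpolyX0.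
  by apply/mnmP => k; rewrite mnmBE subnn mnm0E.
- rewrite pmulL (pd_lin ax); [|exact: cat_mul..].
  rewrite hp hq mderivD mderivZ !pmulL scalerDr addrACA; reflexivity.
Qed.

Lemma pd_poly i p : pd i (gpoly p) ~~ gpoly (mderiv i p).
Proof.
have E r : gpoly r = r ** gpoly 1 :> rep G by rewrite (gmulC ax) (gmul1 ax).
by rewrite E leibniz ?(pd_one ax) ?mul0 ?addr0 -?E; [reflexivity | exact: cat1 ax].
Qed.

(* Germs lying in the [k]-th power of the ideal of germs vanishing at 0. *)
Fixpoint flat k a : Prop :=
  if k is k'.+1 then C a /\ exists2 b : 'I_n -> rep G, forall i, flat k' (b i)
    & a ~~ \sum_i 'X i ** b i
  else C a.

Lemma flat_cat k a : flat k a -> C a.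
Proof. by case: k => [|k] // []. Qed.

Lemma flat_ge k a a' : C a' -> a ~~ a' -> flat k a -> flat k a'.
Proof.
by case: k => [//|k] h e [_ [b hb eb]]; split=> //; exists b => //; rewrite -e.
Qed.

Lemma flat_lin k c a b : flat k a -> flat k b -> flat k (c *: a + b).
Proof.
elim: k a b => [|k IH] a b; first exact: cat_lin ax c a b.
move=> [Ca [a' ha ea]] [Cb [b' hb eb]]; split; first exact: cat_lin ax _ _ _ Ca Cb.
exists (fun i => c *: a' i + b' i) => [i|].
  by apply: IH; [exact: ha | exact: hb].
rewrite ea eb scaler_sumr -big_split /=.
by apply: ge_sum => i _; rewrite mulL; reflexivity.
Qed.

Lemma flat0 k : flat k 0.
Proof.
elim: k => [|k IH]; first exact: cat0 ax.
split; [exact: cat0 ax | exists (fun=> 0) => //].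
by rewrite big1 => [|i _]; [reflexivity | rewrite mul0].
Qed.
Lemma flatD k a b : flat k a -> flat k b -> flat k (a + b).
Proof. by rewrite -{2}[a]scale1r; exact: flat_lin. Qed.
Lemma flatZ k c a : flat k a -> flat k (c *: a).
Proof. by move=> h; rewrite -[_ *: _]addr0; apply: flat_lin => //; exact: flat0. Qed.
Lemma flatN k a : flat k a -> flat k (- a).
Proof. by rewrite -scaleN1r; exact: flatZ. Qed.
Lemma flat_sum k (I : Type) (r : seq I) (F : I -> rep G) :
  (forall i, flat k (F i)) -> flat k (\sum_(i <- r) F i).
Proof. by move=> h; elim/big_ind: _ => //; [exact: flat0 | exact: flatD]. Qed.

Lemma flat_mul k p a : flat k a -> flat k (p ** a).
Proof.
elim: k a => [|k IH] a; first exact: cat_mul.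
move=> [Ca [b hb e]]; split; first exact: cat_mul.
exists (fun i => p ** b i) => [i|]; first exact/IH/hb.
rewrite e mulS; apply: ge_sum => i _.
by rewrite -!(gmulA ax) mulrC; reflexivity.
Qed.

Lemma flatW k a : flat k.+1 a -> flat k a.
Proof.
elim: k a => [|k IH] a; first by case.
by move=> [Ca [b hb e]]; split=> //; exists b => // i; exact/IH/hb.
Qed.

Lemma flat_mulX k i a : flat k a -> flat k.+1 ('X i ** a).
Proof.
move=> h; split; first exact/cat_mul/flat_cat/h.
exists (fun j => if j == i then a else 0) => [j|]; first by case: ifP => // _; exact: flat0.
rewrite (bigD1 i) //= eqxx big1 ?addr0; first reflexivity.
by move=> j /negPf ->; rewrite mul0.
Qed.

Lemma flat_pd k i a : flat k.+1 a -> flat k (pd i a).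
Proof.
elim: k a => [|k IH] a; first by move=> [h _]; exact: cat_pd ax _ _ h.
move=> [Ca [b hb e]].
have Cb j : C (b j) by apply: (@flat_cat k.+1); exact: hb.
apply: (@flat_ge _ (\sum_j ((i == j)%:R *: b j + 'X j ** pd i (b j)))).
- exact: cat_pd ax _ _ Ca.
- rewrite e pdS; last by move=> j; exact: cat_mul.
  by apply: ge_sum => j _; rewrite (pd_mulX ax) //; reflexivity.
- apply: flat_sum => j; apply: flatD; first by apply: flatZ; exact: hb.
  by apply: flat_mulX; apply: IH; exact: hb.
Qed.

Lemma ev_poly p : ev (gpoly p) = mcoeff mnm0 p.
Proof.
elim/mpoly_gen_ind: p => [|i p _|c p q hp hq].
- by rewrite (ev_one ax) mcoeff1 eqxx.
- by rewrite gpM (ev_mulX ax) mcoeffXM mnm0E.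
- by rewrite (gpoly_lin ax) (ev_lin ax) hp hq mcoeffD mcoeffZ.
Qed.

Lemma ev0 : ev 0 = 0.
Proof. by rewrite -gp0 ev_poly mcoeff0. Qed.

Lemma ev_flat a : flat 1 a -> ev a = 0.
Proof.
move=> [_ [b _ e]]; rewrite (ev_ge ax e).
elim/big_ind: _ => [|x y hx hy|i _]; first exact: ev0.
  by rewrite -[x]scale1r (ev_lin ax) hx hy mulr0 addr0.
exact: ev_mulX ax _ _.
Qed.

(** Differentiating in the variables of [m] brings its coefficient to the constant term, which [ev]
    reads. The integer factors that appear are nonzero in characteristic 0. *)
Lemma flat_poly k p m : flat k (gpoly p) -> (mdeg m < k)%N -> mcoeff m p = 0.
Proof.
elim: k p m => [//|k IH] p m h mk.
have [m0|] := eqVneq m mnm0.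
  rewrite m0 -ev_poly; apply: ev_flat.
  by elim: (k) h {IH mk} => [//|k' IH' h]; apply/IH'/flatW.
rewrite -mdeg_eq0 mdegE sum_nat_eq0 negb_forall => /existsP[i /= mi].
have mE : mnm_add (mnm_sub m (mnm1 i)) (mnm1 i) = m by rewrite submK // lep1mP.
have : mcoeff (mnm_sub m (mnm1 i)) (mderiv i p) = 0.
  apply: IH; first exact: flat_ge (cat_poly _) (pd_poly _ _) (flat_pd i h).
  by move: mk; rewrite -{1}mE mdegD mdeg1 addn1.
rewrite mcoeff_deriv mE => /eqP; rewrite mulrn_eq0 /= => /eqP; exact.
Qed.

(** Hadamard's lemma, iterated on the cofactors. *)
Lemma taylor k a : C a -> exists p, flat k (a - gpoly p).
Proof.
elim: k a => [|k IH] a Ca; first by exists 0; rewrite gp0 subr0.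
have [b Cb] := hadamard ax Ca; move: (ev a) => x e.
have [q hq] := choice (fun i => IH (b i) (Cb i)).
exists (x *: 1 + \sum_i 'X i * q i).
apply: (@flat_ge _ (\sum_i 'X i ** (b i - gpoly (q i)))).
- by apply: catB => //; exact: cat_poly.
- rewrite e gpD gpZ gpS opprD addrACA subrr add0r -sumrB.
  by apply: ge_sum => i _; rewrite gpM mulD mulN; reflexivity.
- by apply: flat_sum => i; apply: flat_mulX.
Qed.

(** * The Euler equation in weighted degrees *)

Section Weighted.
Variables (w : 'I_n -> nat) (hw : forall i, (0 < w i)%N).

(** The link between order of vanishing and weighted degree: weights are at least 1, so a monomial
    of weighted degree below [k] has ordinary degree below [k]. *)
Lemma comp_flat k (e : int) p : flat k (gpoly p) -> e < k%:Z -> comp w e p = 0.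
Proof.
move=> h ek; apply/mpolyP => m; rewrite mcoeff_comp mcoeff0; case: eqP => // me.
apply: (flat_poly h); apply: leq_ltn_trans (mdeg_le_wdeg m hw) _.
by rewrite -ltz_nat me.
Qed.

Definition eul a : rep G := \sum_(i < n) (w i)%:R *: ('X i ** pd i a).

Lemma eul_lin c a b : C a -> C b -> eul (c *: a + b) ~~ c *: eul a + eul b.
Proof.
move=> ha hb; rewrite /eul scaler_sumr -big_split /=; apply: ge_sum => i _.
rewrite (pd_lin ax) // mulL scalerDr !scalerA [c * _]mulrC; reflexivity.
Qed.

Lemma eul_one : eul (gpoly 1) ~~ 0.
Proof.
transitivity (\sum_(i < n) (0 : rep G)); last by rewrite big1 //; reflexivity.
by apply: ge_sum => i _; rewrite (pd_one ax) mul0 scaler0; reflexivity.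
Qed.

Lemma eul_sum (I : Type) (r : seq I) (F : I -> rep G) :
  (forall j, C (F j)) -> eul (\sum_(j <- r) F j) ~~ \sum_(j <- r) eul (F j).
Proof.
move=> h; elim: r => [|j r IH].
  rewrite !big_nil -(scaler0 _ (-1 : K)) -[X in eul X]addr0.
  rewrite (eul_lin _ (cat0 ax) (cat0 ax)) scaleN1r addNr scaler0; reflexivity.
rewrite !big_cons -[F j]scale1r eul_lin //; last exact: cat_sum.
by rewrite !scale1r IH; reflexivity.
Qed.

Lemma eul_mulX j a : C a -> eul ('X j ** a) ~~ (w j)%:R *: ('X j ** a) + 'X j ** eul a.
Proof.
move=> ha; rewrite /eul.
transitivity (\sum_(i < n) ((w i)%:R *: ((i == j)%:R *: ('X i ** a))
   + (w i)%:R *: ('X j ** ('X i ** pd i a)))).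
  apply: ge_sum => i _; rewrite (pd_mulX ax) // mulD mulZ scalerDr.
  by rewrite -!(gmulA ax) [in X in _ + X]mulrC; reflexivity.
rewrite big_split /= (bigD1 j) //= eqxx scale1r big1 ?addr0; last first.
  by move=> i /negPf ->; rewrite scale0r scaler0.
rewrite mulS; under [in X in germ_eq _ _ X]eq_bigr do rewrite mulZ.
reflexivity.
Qed.

(** Hadamard's lemma writes [b] as a constant plus terms [x_i b_i], and
    [W (x_i g) = x_i (W g + w_i g)] turns the equation for [x_i b_i] into the one for [b_i] with
    [d - w_i] in place of [d]. The degree drops at each round until it is negative, where
    [euler_neg] applies. *)
Lemma euler_solve (d : int) b : C b -> exists gq : rep G * mpoly n K,
  [/\ C gq.1, quasihomogeneous w d gq.2
    & eul gq.1 - d%:~R *: gq.1 ~~ b - gpoly gq.2].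
Proof.
have neg e a : e < 0 -> C a -> exists gq : rep G * mpoly n K,
    [/\ C gq.1, quasihomogeneous w e gq.2
      & eul gq.1 - e%:~R *: gq.1 ~~ a - gpoly gq.2].
  move=> e0 Ca; have [k ek] : exists k : nat, e = - k.+1%:Z.
    by case: e e0 => // k _; exists k; rewrite NegzE.
  have [g Cg eg] := euler_neg ax k hw Ca.
  exists (g, 0); split=> //=; first exact: qh0.
  by rewrite gp0 subr0 -eg ek rmorphN /= scaleNr opprK; reflexivity.
have [N dN] : exists N : nat, d < N%:Z by exists `|d|.+1; lia.
elim: N d b dN => [|N IH] d b dN Cb; first exact: neg.
have [d0|d0] := ltP d 0; first exact: neg.
have [b' Cb'] := hadamard ax Cb; move: (ev b) => x e.
have dw i : d - (w i)%:Z < N%:Z by have := hw i; lia.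
have [gq /all_and3[Cg qq eg]] := choice (fun i => IH _ _ (dw i) (Cb' i)).
(* The constant term is solved by a constant, except when [d = 0]: it then has weighted degree [d]
   itself and joins the polynomial. *)
pose c0 := if d == 0 then 0 else - (x / d%:~R).
pose q0 := if d == 0 then x else 0.
have ed : - d%:~R * c0 = x - q0.
  rewrite /c0 /q0; case: eqP => [->|/eqP dn]; first by rewrite mulr0 subrr.
  by rewrite mulrNN mulrC divfK ?subr0 // intr_eq0.
pose g := \sum_i 'X i ** (gq i).1.
have CX i : C ('X i ** (gq i).1) by apply: cat_mul.
exists (c0 *: gpoly 1 + g, q0 *: 1 + \sum_i 'X i * (gq i).2); split => /=.
- by apply: (cat_lin ax) (cat1 ax) _; exact: cat_sum.
- apply: qhD; last first.
    apply: qh_sum => i _; rewrite -(subrK (w i)%:Z d) addrC.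
    exact: qhM (qhX _ _ _) (qq i).
  rewrite /q0; case: ifP => [/eqP d00|_]; last by rewrite scale0r; exact: qh0.
  apply/qhP => m; rewrite mcoeffZ mcoeff1.
  have [->|_] := eqVneq m mnm0; last by rewrite mulr0 eqxx.
  by rewrite d00 /wdeg big1 // => i _; rewrite mnm0E muln0.
have eg' : eul g - d%:~R *: g ~~ \sum_i 'X i ** (b' i - gpoly (gq i).2).
  rewrite eul_sum // /g scaler_sumr -sumrB; apply: ge_sum => i _.
  rewrite eul_mulX // -(eg i) rmorphB /= mulD mulN mulZ scalerBl opprB.
  by rewrite [X in X - _]addrC -addrA; reflexivity.
rewrite (eul_lin _ (cat1 ax)); last exact: cat_sum.
rewrite eul_one scaler0 add0r scalerDr opprD addrCA eg' scalerA -scaleNr -mulNr ed.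
rewrite e gpD gpZ gpS opprD addrACA -scalerBl -sumrB.
apply: geD; first reflexivity.
by apply: ge_sum => i _; rewrite mulD mulN gpM; reflexivity.
Qed.

(** * Normal forms modulo coboundaries *)

Section Cohomology.
Variables (N : int) (f : mpoly n K) (B : {fset multinom n}).
Hypotheses (hf : quasihomogeneous w N f) (N0 : N != 0).
Hypothesis hB : monomial_basis (gpoly f : rep G) B.

Let d : int := N - \sum_(i < n) (w i)%:Z.

Definition div (X : 'I_n -> rep G) : rep G := \sum_i pd i (X i).
Definition der (X : 'I_n -> rep G) : rep G := \sum_i mderiv i f ** X i.

(* With X the vector field of components [X i], this is the set of all
   f div X - X f; both coboundary spaces of the theorem reduce to it. *)
Definition cobound a : Prop :=
  exists2 X : 'I_n -> rep G, forall i, C (X i) & a ~~ f ** div X - der X.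

Lemma div_lin c (X Y : 'I_n -> rep G) : (forall i, C (X i)) -> (forall i, C (Y i)) ->
  div (fun i => c *: X i + Y i) ~~ c *: div X + div Y.
Proof.
move=> hX hY; rewrite /div scaler_sumr -big_split /=; apply: ge_sum => i _.
exact: (pd_lin ax).
Qed.

Lemma der_lin c (X Y : 'I_n -> rep G) :
  der (fun i => c *: X i + Y i) = c *: der X + der Y.
Proof.
by rewrite /der scaler_sumr -big_split /=; apply: eq_bigr => i _; rewrite mulL.
Qed.

Lemma cobound_lin c a b : cobound a -> cobound b -> cobound (c *: a + b).
Proof.
move=> [X hX ea] [Y hY eb]; exists (fun i => c *: X i + Y i).
  by move=> i; apply: (cat_lin ax).
rewrite ea eb der_lin div_lin // mulL scalerBr opprD addrACA; reflexivity.
Qed.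

Lemma cobound_ge a b : a ~~ b -> cobound a -> cobound b.
Proof. by move=> e [X hX ea]; exists X => //; rewrite -e. Qed.

Lemma jacobianP a : jacobian_ideal (gpoly f : rep G) a <->
  exists2 X : 'I_n -> rep G, forall i, C (X i) & a ~~ der X.
Proof.
have E (X : 'I_n -> rep G) :
    \sum_i gmul (X i) (pd i (gpoly f : rep G)) ~~ der X.
  apply: ge_sum => i _; rewrite (gmulC ax) pd_poly; reflexivity.
by split=> -[X hX e]; exists X => //; rewrite e E; reflexivity.
Qed.

Lemma jacobian_lin c a b : jacobian_ideal (gpoly f : rep G) a ->
  jacobian_ideal (gpoly f : rep G) b -> jacobian_ideal (gpoly f : rep G) (c *: a + b).
Proof.
move=> /jacobianP[X hX ea] /jacobianP[Y hY eb]; apply/jacobianP.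
exists (fun i => c *: X i + Y i); first by move=> i; apply: (cat_lin ax).
by rewrite ea eb der_lin; reflexivity.
Qed.

Lemma jacobian_sum (I : Type) (r : seq I) (u : I -> K) (F : I -> rep G) :
  (forall i, jacobian_ideal (gpoly f : rep G) (F i)) ->
  jacobian_ideal (gpoly f : rep G) (\sum_(i <- r) u i *: F i).
Proof.
move=> h; elim: r => [|i r IH]; last by rewrite big_cons; exact: jacobian_lin.
rewrite big_nil; apply/jacobianP; exists (fun=> 0); first by move=> _; exact: cat0 ax.
by rewrite /der big1 => [|i _]; [reflexivity | exact: mul0].
Qed.

Definition euler_field g : 'I_n -> rep G := fun i => (w i)%:R *: ('X i ** g).

Lemma cat_euler_field g i : C g -> C (euler_field g i).
Proof. by move=> hg; apply/catZ/cat_mul. Qed.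

Lemma div_euler g : C g ->
  div (euler_field g) ~~ eul g + (\sum_(i < n) (w i)%:R) *: g.
Proof.
move=> hg; rewrite /div /eul scaler_suml -big_split /=; apply: ge_sum => i _.
rewrite pdZ; last exact: cat_mul.
by rewrite (pd_mulX ax) // eqxx scale1r scalerDr addrC; reflexivity.
Qed.

Lemma der_euler g : der (euler_field g) = N%:~R *: (f ** g).
Proof.
have := hf; rewrite /quasihomogeneous /= => fE.
rewrite -pmulZ -fE pmulS; apply: eq_bigr => i _.
by rewrite mulZ pmulZ mulrC (gmulA ax).
Qed.

(** Euler's identity [W f = N f] puts [f] into its own Jacobian ideal. *)
Lemma euler_ideal b : C b ->
  exists2 X : 'I_n -> rep G, forall i, C (X i) & f ** b = der X.
Proof.
move=> hb; exists (euler_field (N%:~R^-1 *: b)) => [i|].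
  by apply/cat_euler_field/catZ.
by rewrite der_euler mulZ scalerA mulfV ?scale1r // intr_eq0.
Qed.

(** Among [c + 1] powers of ['X i], with [c] the cardinality of [B], a nontrivial combination lies
    in the Jacobian ideal. Its cofactors are germs; replacing them by Taylor polynomials and
    extracting one weighted degree isolates a single power, with polynomial cofactors, since
    distinct powers of ['X i] have distinct weighted degrees. *)
Lemma power_in_ideal i : exists M, exists q : 'I_n -> mpoly n K,
  'X i ^+ M = \sum_j q j * mderiv j f.
Proof.
have [_ _ gen] := hB.
have [A hA] := choice (fun j : nat => gen (gpoly ('X i ^+ j)) (cat_poly _)).
pose c := #|{: B}|.
pose Amx : 'M[K]_(c.+1, c) := \matrix_(j, k) A j (enum_val k).
have : kermx Amx != 0.
  rewrite kermx_eq0 /row_free; apply/eqP => r.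
  by have := rank_leq_col Amx; rewrite r ltnn.
move=> /rowV0Pn[u /sub_kermxP uA u0].
have [j0 uj0] : exists j, u 0 j != 0.
  by apply/existsP; apply: contraNT u0 => /existsPn h; apply/eqP/rowP => j;
    rewrite mxE; apply/eqP; move: (h j); rewrite negbK.
pose P : mpoly n K := \sum_j u 0 j *: 'X i ^+ j.
have /jacobianP[Y hY eP] : jacobian_ideal (gpoly f : rep G) (gpoly P).
  have := jacobian_sum (index_enum 'I_c.+1) (u 0) (fun j : 'I_c.+1 => hA j).
  rewrite /P gpS; congr jacobian_ideal.
  under eq_bigr do rewrite scalerBr scaler_sumr.
  rewrite sumrB exchange_big /= [X in _ - X]big1 ?subr0 => [|m _].
    by apply: eq_bigr => j _; rewrite gpZ.
  under eq_bigr do rewrite scalerA; rewrite -scaler_suml.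
  have := congr1 (fun v : 'rV_c => v 0 (enum_rank m)) uA; rewrite !mxE => e.
  suff -> : \sum_j u 0 j * A j m = 0 by rewrite scale0r.
  by rewrite -[RHS]e; apply: eq_bigr => j _; rewrite mxE enum_rankK.
(* The weighted degree of the selected power; Taylor order [e + 1] makes the error invisible in
   degree [e]. *)
exists j0; pose e := (w i * j0)%N.
have [q hq] := choice (fun j => taylor e.+1 (hY j)).
exists (fun j => (u 0 j0)^-1 *: comp w (e%:Z - (N - (w j)%:Z)) (q j)).
have : comp w e (P - \sum_j q j * mderiv j f) = 0.
  apply: (@comp_flat e.+1); last by rewrite ltz_nat.
  apply: (@flat_ge _ (\sum_j mderiv j f ** (Y j - gpoly (q j)))).
  - exact: cat_poly.
  - rewrite gpB eP gpS /der -sumrB; apply: ge_sum => j _.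
    by rewrite mulD mulN -gpM mulrC; reflexivity.
  - by apply: flat_sum => j; exact: flat_mul.
rewrite compB !comp_sum => /subr0_eq.
under [RHS]eq_bigr do rewrite (compM _ _ (qh_deriv _ hf)).
have qhXn j : quasihomogeneous w (w i * j)%N ('X i ^+ j : mpoly n K).
  elim: j => [|j IH]; last by rewrite mulnS exprS PoszD; exact: qhM (qhX _ _ _) IH.
  apply/qhP => m; rewrite mcoeff1; have [->|] := eqVneq m mnm0; last by rewrite eqxx.
  by rewrite /wdeg big1 ?muln0 // => k _; rewrite mnm0E muln0.
rewrite (bigD1 j0) //= big1 ?addr0 => [|j jj]; last first.
  rewrite compZ; apply/mpolyP => m; rewrite mcoeffZ mcoeff_comp mcoeff0.
  case: eqP => [me|_]; last by rewrite mulr0.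
  have /qhP qj := qhXn j.
  apply/eqP; rewrite mulf_eq0; apply/orP; right; apply: contraNT jj.
  move=> /qj /eqP; rewrite me eqz_nat eqn_pmul2l //.
  by rewrite eq_sym.
rewrite compZ (comp_id (qhXn j0)) => /(congr1 (fun x => (u 0 j0)^-1 *: x)).
rewrite scalerA mulVf // scale1r => ->; rewrite scaler_sumr.
by apply: eq_bigr => j _; rewrite -scalerAl.
Qed.

Lemma cobound_exists a : C a -> exists h : mpoly n K * mpoly n K,
  [/\ quasihomogeneous w d h.1, {subset msupp h.2 <= B}
    & cobound (a - gpoly (h.2 + f * h.1))].
Proof.
move=> Ca; have [_ _ gen] := hB; have [u] := gen a Ca.
move=> /jacobianP[Y hY eY].
have Cdiv : C (div Y) by apply: cat_sum => i _; exact: (cat_pd ax).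
have [[g q] [/= Cg qq eg]] := euler_solve d Cdiv.
exists (q, \sum_(m : B) u m *: mpolyX K (val m)); split=> //=.
  exact: msupp_lincomb.
(* For [X = g W - Y] the coboundary is [Y f - f (div Y - (W g - d g))], because [N - \sum w = d];
   the last parenthesis is [q]. *)
exists (fun i => -1 *: Y i + euler_field g i).
  by move=> i; apply: (cat_lin ax) => //; exact: cat_euler_field.
have -> : a - gpoly (\sum_(m : B) u m *: mpolyX K (val m) + f * q) ~~ der Y - f ** gpoly q.
  rewrite gpD gpS -eY opprD addrA -gpM.
  by under eq_bigr do rewrite gpZ; reflexivity.
rewrite der_lin div_lin //; last by move=> i; exact: cat_euler_field.
rewrite div_euler // der_euler !scaleN1r opprD opprK addrCA.
apply: geD; first reflexivity.
have e2 : gpoly q ~~ div Y - (eul g - d%:~R *: g) by rewrite eg opprB addrC subrK; reflexivity.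
rewrite e2 -mulZ -mulN -mulN -mulD.
apply: geM; first reflexivity.
have zid (V : zmodType) (D E S T : V) : - (D - (E - (S - T))) = - D + (E + T) - S.
  by rewrite !opprB addrC !addrA.
by rewrite /d rmorphB rmorph_sum /= scalerBl zid; reflexivity.
Qed.

Lemma cobound_unique (h : mpoly n K * mpoly n K) : (3 <= n)%N ->
  quasihomogeneous w d h.1 -> {subset msupp h.2 <= B} ->
  cobound (gpoly (h.2 + f * h.1)) -> h = (0, 0).
Proof.
case: h => h1 h2 /= n3 q1 sB [X hX e].
have Cdiv : C (div X) by apply: cat_sum => i _; exact: (cat_pd ax).
have h20 : h2 = 0.
  have h2E : h2 = \sum_(m : B) mcoeff (val m) h2 *: mpolyX K (val m).
    exact: lincombK.
  have [_ free _] := hB.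
  have : jacobian_ideal (gpoly f : rep G)
      (\sum_(m : B) mcoeff (val m) h2 *: gpoly (mpolyX K (val m))).
    (* Here [h2] equals [f (div X - h1) - X f], and [euler_ideal] takes care of the first term. *)
    have [Y hY eY] := euler_ideal (catB Cdiv (cat_poly h1)).
    apply/jacobianP; exists (fun i => -1 *: X i + Y i) => [i|]; first exact: (cat_lin ax).
    rewrite der_lin -eY mulD mulN -gpM scaleN1r addrA [- _ + _]addrC -e gpD addrK.
    by rewrite {2}h2E gpS; under [in X in germ_eq _ _ X]eq_bigr do rewrite gpZ; reflexivity.
  move=> /free h0; rewrite h2E big1 // => m _; rewrite h0 scale0r //.
rewrite h20; congr pair.
move: e; rewrite h20 add0r => e.
have [M hM] := choice power_in_ideal.
(* The identity will be read in weighted degree [N + d], which is below [k]; the Taylor order is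
   [k + 1] because the divergence loses one. *)
pose k := (`|N| + `|d|).+1%N.
have [p hp] := choice (fun i => taylor k.+1 (hX i)).
have fl : flat k (gpoly (f * (\sum_i mderiv i (p i) - h1) - \sum_i p i * mderiv i f)).
  apply: (@flat_ge _ (\sum_i (mderiv i f ** (X i - gpoly (p i)))
                      - f ** \sum_i pd i (X i - gpoly (p i)))).
  - exact: cat_poly.
  - have -> : \sum_i pd i (X i - gpoly (p i)) ~~ div X - gpoly (\sum_i mderiv i (p i)).
      rewrite gpS -sumrB; apply: ge_sum => i _; rewrite -scaleN1r addrC.
      rewrite (pd_lin ax) ?pd_poly //; last exact: cat_poly.
      by rewrite scaleN1r addrC; reflexivity.
    have -> : \sum_i mderiv i f ** (X i - gpoly (p i)) =
              der X - gpoly (\sum_i p i * mderiv i f).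
      rewrite gpS -sumrB; apply: eq_bigr => i _.
      by rewrite mulD mulN [p i * _]mulrC gpM.
    rewrite mulrBr !gpB e mulD mulN gpM.
    have zid (V : zmodType) (D Q S T : V) : D - Q + (S - T) = S + (D - T) - Q.
      by rewrite addrACA addrA addrAC [D + S]addrC -!addrA [- T - Q]addrC.
    by rewrite !opprB zid; reflexivity.
  - apply: flatD; first by apply: flat_sum => i; exact/flat_mul/flatW.
    by apply/flatN/flat_mul/flat_sum => i; exact: flat_pd.
(* As [mderiv i f] has degree [N - w i], only the component of degree [d + w i] of [p i] contributes
   in degree [N + d]. *)
apply: (@qh_top_degree_eq0 _ _ w N f h1 (fun i => comp w (d + (w i)%:Z) (p i)) M) => //.
- by move=> i; exact: comp_qh.
have : comp w (N + d) (f * (\sum_i mderiv i (p i) - h1) - \sum_i p i * mderiv i f) = 0.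
  by apply: (comp_flat fl); rewrite /k; lia.
rewrite compB comp_sum mulrC (compM _ _ hf) compB comp_sum.
rewrite addrAC subrr add0r (comp_id q1) [_ * f]mulrC => /subr0_eq.
under eq_bigr do rewrite comp_deriv.
under [RHS]eq_bigr do rewrite (compM _ _ (qh_deriv _ hf)).
have dE i : N + d - (N - (w i)%:Z) = d + (w i)%:Z.
  by rewrite opprB addrC addrA subrK addrC.
under [RHS]eq_bigr do rewrite dE.
by rewrite mulrBr => <-; rewrite opprB addrC subrK.
Qed.

End Cohomology.
End Weighted.

End Germs.

(** * Forms and multivectors of maximal degree *)

Section QuotientDimension.
Variables (K : fieldType) (E : lmodType K).
Implicit Types (V U : set E).

Definition lin_closed U := U 0 /\ forall (a : K) x y, U x -> U y -> U (a *: x + y).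

Lemma lin_closed_sum U (I : Type) (r : seq I) (a : I -> K) (F : I -> E) :
  lin_closed U -> (forall i, U (F i)) -> U (\sum_(i <- r) a i *: F i).
Proof.
move=> [U0 UL] h; elim: r => [|i r IH]; first by rewrite big_nil.
by rewrite big_cons; exact: UL.
Qed.

(** If [I] were larger than [J], the matrix expressing [e] in [e'] modulo [U] would have a nonzero
    vector in its left kernel, that is, a dependence between the [e i] modulo [U]. *)
Lemma basis_mod_card_le V U (I J : finType) (e : I -> E) (e' : J -> E) :
  lin_closed U -> basis_mod V U e -> basis_mod V U e' -> (#|I| <= #|J|)%N.
Proof.
move=> UL [eV efree _] [e'V _ e'gen].
have [A hA] := choice (fun i => e'gen (e i) (eV i)).
rewrite leqNgt; apply/negP => JI.
pose Mx : 'M[K]_(#|I|, #|J|) := \matrix_(i, j) A (enum_val i) (enum_val j).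
have : kermx Mx != 0.
  rewrite kermx_eq0 /row_free; apply/eqP => r.
  by have := rank_leq_col Mx; rewrite r leqNgt JI.
move=> /rowV0Pn[u /sub_kermxP uM u0]; move/negP: u0; apply.
have : U (\sum_i u 0 (enum_rank i) *: e i).
  have := lin_closed_sum (index_enum I) (fun i => u 0 (enum_rank i)) UL hA.
  congr U; under eq_bigr do rewrite scalerBr scaler_sumr.
  rewrite sumrB exchange_big /= [X in _ - X]big1 ?subr0 // => j _.
  under eq_bigr do rewrite scalerA; rewrite -scaler_suml.
  have := congr1 (fun v : 'rV_#|J| => v 0 (enum_rank j)) uM; rewrite !mxE => uj.
  suff -> : \sum_i u 0 (enum_rank i) * A i j = 0 by rewrite scale0r.
  rewrite -[RHS]uj (reindex (@enum_val I predT)) /=; last first.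
    by apply: onW_bij; exact: enum_val_bij.
  by apply: eq_bigr => i _; rewrite mxE enum_rankK enum_valK.
move=> /efree h; apply/eqP/rowP => i; by rewrite -(enum_valK i) h mxE.
Qed.

Lemma basis_mod_quotient_dim V U (I : finType) (e : I -> E) (d : nat) :
  #|I| = d -> basis_mod V U e -> quotient_dim V U d.
Proof.
move=> <- [eV efree egen]; exists (fun k => e (enum_val k)).
have sumE (a : 'I_#|I| -> K) :
    \sum_k a k *: e (enum_val k) = \sum_i a (enum_rank i) *: e i.
  rewrite [RHS](reindex (@enum_val I predT)) /=; last first.
    by apply: onW_bij; exact: enum_val_bij.
  by apply: eq_bigr => k _; rewrite enum_valK.
split=> [k|a|v /egen[a ha]]; first exact: eV.
  rewrite sumE => /efree h k; rewrite -(enum_valK k); exact: h.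
exists (fun k => a (enum_val k)); rewrite sumE.
by under eq_bigr do rewrite enum_rankK.
Qed.

End QuotientDimension.

(** * Top coefficients of [df_op] and of the Schouten bracket *)

Section Tensors.
Variables (K : numFieldType) (n : nat) (G : germ_model K n) (ev : rep G -> K).
Hypothesis ax : germ_axioms ev.
Local Notation C := (in_cat G).
Local Notation "a ~~ b" := (germ_eq G a b) (at level 70).
Local Notation T := [set: 'I_n]%SET.
Implicit Types (a b f g : rep G) (S A : {set 'I_n}) (t u X : tensor G) (i j : 'I_n).

#[local] Instance ge_equiv_tensor : Equivalence (germ_eq G) := ge_equiv ax.

Lemma gmul0r a : gmul a 0 = 0.
Proof. by have := gmul_linr ax (-1) 0 0 a; rewrite scaler0 addr0 scaleN1r addNr. Qed.
Lemma gmul0l a : gmul 0 a = 0.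
Proof. by rewrite (gmulC ax) gmul0r. Qed.

Lemma tensorB t u S : (t - u) S = t S - u S.
Proof. by rewrite !ffunE. Qed.

Lemma tensorZ (c : K) t S : (c *: t) S = c *: t S.
Proof. by rewrite ffunE. Qed.

Lemma sign_set0l A : shuffle_sign K finset.set0 A = 1.
Proof.
rewrite /shuffle_sign (_ : #|_| = 0%N) ?expr0 //; apply/eqP; rewrite cards_eq0.
by apply/eqP/finset.setP => u; rewrite !inE.
Qed.

Lemma sign_set0r A : shuffle_sign K A finset.set0 = 1.
Proof.
rewrite /shuffle_sign (_ : #|_| = 0%N) ?expr0 //; apply/eqP; rewrite cards_eq0.
by apply/eqP/finset.setP => u; rewrite !inE andbF.
Qed.

Lemma sign_sqr A S : shuffle_sign K A S * shuffle_sign K A S = 1.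
Proof. by rewrite -expr2 /shuffle_sign exprAC sqrrN !expr1n. Qed.

Lemma card_setT_eq S : (#|S| == n) = (S == T).
Proof.
have le_n : (#|S| <= n)%N by have := max_card (mem S); rewrite card_ord.
by rewrite eqEcard finset.subsetT /= cardsT card_ord eqn_leq le_n.
Qed.

Lemma wedge_single t u S A0 : A0 \subset S ->
  (forall A, A \subset S -> A != A0 -> t A = 0 \/ u (S :\: A) = 0) ->
  wedge t u S = shuffle_sign K A0 (S :\: A0) *: gmul (t A0) (u (S :\: A0)).
Proof.
move=> A0S h; rewrite ffunE (bigD1 A0) //= big1 ?addr0 // => A /andP[AS AA0].
by case: (h A AS AA0) => ->; rewrite ?gmul0l ?gmul0r scaler0.
Qed.

Lemma ge_wedge t t' u u' S : (forall A, t A ~~ t' A) -> (forall A, u A ~~ u' A) ->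
  wedge t u S ~~ wedge t' u' S.
Proof.
move=> ht hu; rewrite !ffunE; apply: (ge_sum ax) => A _.
by apply: (geZ ax) => //; apply: (geM ax).
Qed.

Lemma setT_D1_inj i j : (T :\ i == T :\ j) = (i == j).
Proof.
apply/eqP/eqP => [h|-> //]; apply/eqP; rewrite -[i == j]negbK; apply/negP => ij.
have : i \in T :\ j by rewrite !inE ij.
by rewrite -h !inE eqxx.
Qed.

Lemma setTD_set1 i : T :\: (T :\ i) = [set i].
Proof. by apply/finset.setP => j; rewrite !inE andbT; case: eqP. Qed.

(* The vector field X with i_X (dx_1 /\ ... /\ dx_n) = t. *)
Definition dual_field t : 'I_n -> rep G :=
  fun i => shuffle_sign K [set i] (T :\ i) *: t (T :\ i).

Definition dual_form (Y : 'I_n -> rep G) : tensor G :=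
  [ffun S => \sum_i if S == T :\ i then shuffle_sign K [set i] (T :\ i) *: Y i else 0].

Lemma dual_formE Y i : dual_form Y (T :\ i) = shuffle_sign K [set i] (T :\ i) *: Y i.
Proof.
rewrite ffunE (bigD1 i) //= eqxx big1 ?addr0 // => j ji.
by rewrite setT_D1_inj eq_sym (negPf ji).
Qed.

Lemma dual_formK Y i : dual_field (dual_form Y) i = Y i.
Proof. by rewrite /dual_field dual_formE scalerA sign_sqr scale1r. Qed.

Lemma card_setT_D1 i : #|T :\ i| = n.-1.
Proof.
have := cardsD1 i T; rewrite inE cardsT card_ord add1n => e.
exact: (esym (congr1 predn e)).
Qed.

Lemma dual_form_homogeneous Y : (forall i, C (Y i)) -> homogeneous n.-1 (dual_form Y).
Proof.
move=> hY S; split.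
  rewrite ffunE; apply: (cat_sum ax) => i _; case: ifP => _; last exact: cat0 ax.
  exact: (catZ ax).
move=> Sn; rewrite ffunE big1 // => i _; case: eqP => // SE.
by rewrite SE card_setT_D1 eqxx in Sn.
Qed.

Definition gder f (Y : 'I_n -> rep G) : rep G := \sum_i gmul (pd i f) (Y i).

(** The form df with exact zeros off the singletons. There the coefficients of [extd] are sums of
    terms [pd i 0], which the interface makes zero only up to [~~]. *)
Definition dscalar f : tensor G := [ffun A => \sum_i if A == [set i] then pd i f else 0].

Lemma extd_scalar f A : extd (Defs.scalar f) A ~~ dscalar f A.
Proof.
rewrite !ffunE.
have [/cards1P[j ->]|A1] := boolP (#|A| == 1%N).
  rewrite big_set1 (bigD1 j) //= eqxx big1 ?addr0 => [|i ij]; last first.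
    by rewrite (inj_eq finset.set1_inj) eq_sym (negPf ij).
  rewrite (_ : [set j] :\ j = finset.set0) ?sign_set0r ?scale1r ?ffunE ?eqxx; first reflexivity.
  by apply/finset.setP => k; rewrite !inE andNb.
rewrite [X in _ ~~ X]big1 => [|i _]; last first.
  by case: eqP => // AE; rewrite AE cards1 eqxx in A1.
transitivity (\sum_(i in A) (0 : rep G)); last by rewrite big1 //; reflexivity.
apply: (ge_sum ax) => i iA; rewrite ffunE; case: eqP => [Ai|_].
  have := cardsD1 i A; rewrite iA Ai cards0 => h; by rewrite h in A1.
rewrite -[X in _ ~~ X](scaler0 _ (shuffle_sign K [set i] (A :\ i))).
by apply: (geZ ax) => //; exact: pd0 ax i.
Qed.

Lemma wedge_dscalar f t S :
  wedge (dscalar f) t S = \sum_(i in S) shuffle_sign K [set i] (S :\ i) *: gmul (pd i f) (t (S :\ i)).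
Proof.
rewrite ffunE; transitivity (\sum_(A : {set 'I_n} | A \subset S) \sum_i
   if A == [set i] then shuffle_sign K [set i] (S :\ i) *: gmul (pd i f) (t (S :\ i)) else 0).
  apply: eq_bigr => A _; rewrite ffunE (gmulC ax).
  have E (F : 'I_n -> rep G) : gmul (t (S :\: A)) (\sum_i F i) = \sum_i gmul (t (S :\: A)) (F i).
    apply: (big_morph (gmul (t (S :\: A)))); last exact: gmul0r.
    by move=> x y; have := gmul_linr ax 1 x y (t (S :\: A)); rewrite !scale1r.
  rewrite E scaler_sumr; apply: eq_bigr => i _.
  by case: eqP => [->|_]; [rewrite (gmulC ax) | rewrite gmul0r scaler0].
rewrite exchange_big /= [RHS]big_mkcond; apply: eq_bigr => i _.
rewrite -big_mkcondr /=; case: ifP => iS.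
  rewrite (big_pred1 [set i]) // => A /=; apply: andb_idl => /eqP ->.
  by rewrite finset.sub1set.
by rewrite big1 // => A /andP[AS /eqP AE]; rewrite AE finset.sub1set iS in AS.
Qed.

Lemma wedge_scalar f t S : wedge (Defs.scalar f) t S = gmul f (t S).
Proof.
rewrite (@wedge_single _ _ _ finset.set0) ?finset.sub0set //.
  by rewrite sign_set0l scale1r finset.setD0 ffunE eqxx.
by move=> A _ A0; left; rewrite ffunE (negPf A0).
Qed.

(** If t is the contraction of omega with X, then dt is [(div X) omega] and df /\ t is
    [(X f) omega]; the signs of the contraction are those built into [dual_field]. *)
Lemma df_op_setT f (p : nat) t : (forall S, C (t S)) ->
  df_op f p n.-1 t T ~~
    gmul f (div (dual_field t)) - ((n.-1)%:R - p%:R) *: gder f (dual_field t).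
Proof.
move=> hC; rewrite /df_op tensorB tensorZ.
rewrite wedge_scalar; apply: (geD ax).
  apply: (geM ax); first reflexivity.
  rewrite ffunE /div; transitivity (\sum_(i in T) pd i (dual_field t i)).
    by apply: (ge_sum ax) => i _; symmetry; exact: (pdZ ax).
  by rewrite (eq_bigl predT) => [|i]; [reflexivity | rewrite inE].
apply: (geN ax); apply: (geZ ax); first by [].
transitivity (wedge (dscalar f) t T).
  by apply: ge_wedge => A; [exact: extd_scalar | reflexivity].
rewrite wedge_dscalar /gder (eq_bigl predT) => [|i]; last by rewrite inE.
apply: (ge_sum ax) => i _; rewrite /dual_field.
have := gmul_linr ax (shuffle_sign K [set i] (T :\ i)) (t (T :\ i)) 0 (pd i f).
by rewrite gmul0r !addr0 => ->; reflexivity.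
Qed.

Lemma df_op_other f (p : nat) t S : (0 < n)%N -> homogeneous n.-1 t -> S != T ->
  df_op f p n.-1 t S ~~ 0.
Proof.
move=> n0 ht ST.
have t0 i : i \in S -> t (S :\ i) = 0.
  move=> iS; apply: (ht _).2; apply: contra ST => /eqP h.
  have := cardsD1 i S; rewrite iS h add1n prednK // -card_setT_eq => ->.
  exact: eqxx.
rewrite /df_op tensorB tensorZ wedge_scalar.
rewrite -[X in _ ~~ X]addr0; apply: (geD ax).
  rewrite -[X in _ ~~ X](gmul0r f); apply: (geM ax); first reflexivity.
  rewrite ffunE; transitivity (\sum_(i in S) (0 : rep G)); last by rewrite big1 //; reflexivity.
  apply: (ge_sum ax) => i iS; rewrite t0 //.
  rewrite -[X in _ ~~ X](scaler0 _ (shuffle_sign K [set i] (S :\ i))).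
  by apply: (geZ ax) => //; exact: pd0 ax i.
rewrite -[X in _ ~~ X]oppr0; apply: (geN ax).
rewrite -[X in _ ~~ X](scaler0 _ ((n.-1)%:R - p%:R : K)); apply: (geZ ax); first by [].
transitivity (wedge (dscalar f) t S).
  by apply: ge_wedge => A; [exact: extd_scalar | reflexivity].
rewrite wedge_dscalar big1; first reflexivity.
by move=> i iS; rewrite t0 // gmul0r scaler0.
Qed.

Lemma wedge_rderiv1 X u i S : homogeneous 1 X ->
  wedge (rderiv i X) u S = gmul (X [set i]) (u S).
Proof.
move=> hX; rewrite (@wedge_single _ _ _ finset.set0) ?finset.sub0set //.
  by rewrite sign_set0l scale1r finset.setD0 ffunE inE sign_set0l scale1r finset.setU0.
move=> A _ A0; left; rewrite ffunE; case: ifP => // iA.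
rewrite (hX _).2 ?scaler0 // cardsU1 iA add1n eqSS cards_eq0; exact: A0.
Qed.

Lemma rderiv_top f i A : A != T :\ i -> rderiv i (top f) A = 0.
Proof.
move=> AT; rewrite ffunE; case: ifP => // iA; rewrite ffunE; case: eqP => [e|_]; last exact: scaler0.
case/eqP: AT; apply/finset.setP => j; have /finset.setP/(_ j) := e; rewrite !inE.
by have [->|_] := eqVneq j i; rewrite ?iA.
Qed.

Lemma schouten_sum X f S : homogeneous 1 X -> schouten 1 n X (top f) S =
  \sum_i (gmul (X [set i]) (pd i (top f S)) - wedge (rderiv i (top f)) (tensor_pd i X) S).
Proof.
move=> hX; rewrite /schouten sum_ffunE; apply: eq_bigr => i _.
(* The exponent is [2 * n.+1], so the sign factor of the second term is 1. *)
by rewrite tensorB tensorZ exprM sqrrN !expr1n scale1r wedge_rderiv1 // ffunE.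
Qed.

(** The only coefficient of [rderiv i (top f)] that counts is at [T :\ i], where [rderiv] and
    [wedge] carry the same shuffle sign, which squares to 1. *)
Lemma schouten_setT X f : homogeneous 1 X ->
  schouten 1 n X (top f) T ~~ gder f (fun i => X [set i]) - gmul f (div (fun i => X [set i])).
Proof.
move=> hX; rewrite schouten_sum // sumrB; apply: (geD ax).
  apply: (ge_sum ax) => i _; rewrite (gmulC ax) ffunE eqxx; reflexivity.
apply: (geN ax); rewrite /div.
have -> : gmul f (\sum_i pd i (X [set i])) = \sum_i gmul f (pd i (X [set i])).
  apply: (big_morph (gmul f)); last exact: gmul0r.
  by move=> x y; have := gmul_linr ax 1 x y f; rewrite !scale1r.
apply: (ge_sum ax) => i _; rewrite (@wedge_single _ _ _ (T :\ i)); last 2 first.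
- exact: finset.subsetT.
- by move=> A _ AT; left; exact: rderiv_top.
rewrite setTD_set1 !ffunE !inE eqxx /= finset.setD1K ?inE // eqxx.
rewrite (gmulC ax).
have := gmul_linr ax (shuffle_sign K (T :\ i) [set i]) f 0 (pd i (X [set i])).
rewrite gmul0r !addr0 => ->; rewrite scalerA sign_sqr scale1r (gmulC ax).
reflexivity.
Qed.

(** In the second half of the bracket a term can survive only if [T :\ i] is contained in [S], hence
    equal to it; the other factor is then the derivative of the coefficient of [X] at the empty set,
    which is 0. *)
Lemma schouten_other X f S : homogeneous 1 X -> S != T -> schouten 1 n X (top f) S ~~ 0.
Proof.
move=> hX ST; rewrite schouten_sum //.
transitivity (\sum_(i < n) (0 : rep G)); last by rewrite big1 //; reflexivity.
apply: (ge_sum ax) => i _; rewrite -[X in _ ~~ X]subr0; apply: (geD ax).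
  rewrite ffunE (negPf ST) -[X in _ ~~ X](gmul0r (X [set i])).
  by apply: (geM ax); [reflexivity | exact: pd0 ax i].
apply: (geN ax); rewrite ffunE.
transitivity (\sum_(A : {set 'I_n} | A \subset S) (0 : rep G)); last by rewrite big1 //; reflexivity.
apply: (ge_sum ax) => A AS.
have [AE|AT] := eqVneq A (T :\ i); last first.
  by rewrite rderiv_top // gmul0l scaler0; reflexivity.
have -> : S :\: A = finset.set0.
  apply/eqP; rewrite finset.setD_eq0; apply: contraNT ST => SA; rewrite finset.eqEsubset finset.subsetT /=.
  have [iS|iS] := boolP (i \in S).
    apply/fintype.subsetP => j _; have [-> //|ji] := eqVneq j i.
    by apply: (fintype.subsetP AS); rewrite AE !inE ji.
  by case/negP: SA; rewrite AE finset.subsetD1 finset.subsetT.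
have -> : tensor_pd i X finset.set0 = pd i 0 by rewrite ffunE (hX finset.set0).2 ?cards0.
rewrite -[X in _ ~~ X](scaler0 _ (shuffle_sign K A finset.set0)); apply: (geZ ax) => //.
by rewrite -[X in _ ~~ X](gmul0r (rderiv i (top f) A)); apply: (geM ax); [reflexivity | exact: pd0 ax i].
Qed.

End Tensors.

(** * The two quotient spaces *)

Section Main.
Variables (K : numFieldType) (n : nat) (G : germ_model K n) (ev : rep G -> K).
Hypothesis ax : germ_axioms ev.
Local Notation C := (in_cat G).
Local Notation "a ~~ b" := (germ_eq G a b) (at level 70).
Local Notation T := [set: 'I_n]%SET.

#[local] Instance ge_equiv_main : Equivalence (germ_eq G) := ge_equiv ax.

Lemma gder_poly (f : mpoly n K) (Y : 'I_n -> rep G) : gder (gpoly f) Y ~~ der f Y.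
Proof.
by apply: (ge_sum ax) => i _; apply: (geM ax); [exact: pd_poly ax i f | reflexivity].
Qed.

Lemma pdN i (a : rep G) : C a -> pd i (- a) ~~ - pd i a.
Proof.
by move=> Ca; have := pdZ ax i (-1) Ca; rewrite scaleN1r (scaleN1r (pd i a)).
Qed.

Lemma homogeneous_top (g : rep G) : C g -> homogeneous n (top g).
Proof.
move=> Cg S; rewrite ffunE; split; first by case: ifP => // _; exact: cat0 ax.
by rewrite card_setT_eq => /negPf ->.
Qed.

Lemma homogeneousB k (t u : tensor G) :
  homogeneous k t -> homogeneous k u -> homogeneous k (t - u).
Proof.
move=> ht hu S; rewrite tensorB; split.
  by apply: (catB ax); [exact: (ht S).1 | exact: (hu S).1].
by move=> hS; rewrite (ht S).2 // (hu S).2 // subrr.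
Qed.

Lemma Bf_cobound (f : mpoly n K) (t : tensor G) : (3 <= n)%N -> homogeneous n t ->
  Bf (gpoly f) (n - 2) n t <-> cobound f (t T).
Proof.
move=> n3 ht.
(* The coefficient [k - p] of [df_op], with [k = n - 1] and [p = n - 2]. *)
have c1 : (n.-1)%:R - (n - 2)%:R = 1 :> K.
  by case: n n3 => [|[|[|m]]] // _; rewrite subn2 /= -addn1 natrD addrC addKr.
split=> [[u hu e]|[Y hY e]].
  exists (dual_field u) => [i|]; first by apply: (catZ ax); exact: (hu _).1.
  rewrite e (df_op_setT ax); last by move=> S; exact: (hu S).1.
  rewrite c1 scale1r; apply: (geD ax); first reflexivity.
  by apply: (geN ax); exact: gder_poly.
have hD : homogeneous n.-1 (dual_form Y) by exact: (dual_form_homogeneous ax hY).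
exists (dual_form Y); [exact: hD | move=> S].
have [->|ST] := eqVneq S T; last first.
  rewrite (ht S).2 ?card_setT_eq //; symmetry; apply: (df_op_other ax) => //.
  exact: ltn_trans n3.
rewrite e (df_op_setT ax); last by move=> S'; exact: (hD S').1.
rewrite c1 scale1r; symmetry; apply: (geD ax).
  apply: (geM ax); first reflexivity.
  by apply: (ge_sum ax) => i _; rewrite dual_formK; reflexivity.
apply: (geN ax); transitivity (gder (gpoly f) Y); last exact: gder_poly.
by apply: (ge_sum ax) => i _; rewrite dual_formK; reflexivity.
Qed.

Lemma schouten_cobound (f : mpoly n K) (t : tensor G) : homogeneous n t ->
  (exists2 X, homogeneous 1 X & tensor_eq t (schouten 1 n X (top (gpoly f)))) <->
  cobound f (t T).
Proof.
move=> ht; split=> [[X hX e]|[Y hY e]].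
  (* The top coefficient of the bracket is [X f - f div X], the opposite of the coboundary of
     [X]. *)
  exists (fun i => - X [set i]) => [i|]; first by apply: (catN ax); exact: (hX _).1.
  rewrite e (schouten_setT ax) // addrC; apply: (geD ax).
    rewrite -(mulN ax); apply: (geM ax); first reflexivity.
    rewrite /div -sumrN; apply: (ge_sum ax) => i _.
    by symmetry; apply: pdN; exact: (hX _).1.
  rewrite gder_poly /der -sumrN; apply: (ge_sum ax) => i _.
  by rewrite (mulN ax) opprK; reflexivity.
pose X : tensor G := [ffun S => \sum_i if S == [set i] then - Y i else 0].
have XE i : X [set i] = - Y i.
  rewrite ffunE (bigD1 i) //= eqxx big1 ?addr0 // => j ji.
  by rewrite (inj_eq finset.set1_inj) eq_sym (negPf ji).
have hX : homogeneous 1 X.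
  move=> S; rewrite ffunE; split.
    apply: (cat_sum ax) => i _; case: ifP => _; last exact: cat0 ax.
    exact: (catN ax).
  by move=> S1; rewrite big1 // => i _; case: eqP => // SE; rewrite SE cards1 in S1.
exists X => // S; have [->|ST] := eqVneq S T; last first.
  by rewrite (ht S).2 ?card_setT_eq //; symmetry; exact: (schouten_other ax).
rewrite e (schouten_setT ax) //; symmetry; rewrite addrC.
apply: (geD ax); last first.
  rewrite gder_poly /der -sumrN; apply: (ge_sum ax) => i _.
  by rewrite XE (mulN ax); reflexivity.
rewrite -(mulN ax); apply: (geM ax); first reflexivity.
rewrite /div -sumrN; apply: (ge_sum ax) => i _.
by rewrite XE -[X in _ ~~ X]opprK; apply: (geN ax); exact: pdN.
Qed.

Variables (w : 'I_n -> nat) (N : int) (f : mpoly n K) (B : {fset multinom n}).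
Hypotheses (n3 : (3 <= n)%N) (hw : forall i, (0 < w i)%N).
Hypotheses (hf : quasihomogeneous w N f) (hf0 : meval (fun=> 0) f = 0).
Hypothesis hB : monomial_basis (gpoly f : rep G) B.
Let d : int := N - \sum_(i < n) (w i)%:Z.

Lemma meval0 (p : mpoly n K) : meval (fun=> 0) p = mcoeff mnm0 p.
Proof.
elim/mpoly_gen_ind: p => [|i p _|c p q hp hq].
- by rewrite meval1 mcoeff1 eqxx.
- by rewrite mevalM mevalXU mul0r mcoeffXM mnm0E.
- by rewrite mevalD mevalZ hp hq mcoeffD mcoeffZ.
Qed.

(** Finite codimension forbids [f = 0], since a power of a variable would vanish; and [f(0) = 0]
    leaves only nonconstant monomials, whose weighted degree is positive. *)
Lemma degree_neq0 : N != 0.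
Proof.
have f0 : f != 0.
  apply/eqP => fE; have i : 'I_n by exists 0%N; apply: leq_trans n3.
  have [M [q]] := power_in_ideal ax hw hf hB i.
  rewrite big1 => [|j _]; last by rewrite fE mderiv0 mulr0.
  move/eqP; rewrite expf_eq0 => /andP[_ /eqP/(congr1 (mcoeff (mnm1 i)))/eqP].
  by rewrite mcoeffX eqxx mcoeff0 oner_eq0.
have [m mf] : exists m, m \in msupp f.
  by exists (mlead f); exact: mlead_supp.
have mN : (wdeg w m)%:Z = N.
  by move/qhP: hf => /(_ m); rewrite mcoeff_msupp in mf; move/(_ mf).
rewrite -mN eqz_nat -lt0n; apply: leq_trans (mdeg_le_wdeg m hw).
rewrite lt0n mdeg_eq0; apply/eqP => m0.
by move: mf; rewrite mcoeff_msupp m0 -meval0 hf0 eqxx.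
Qed.

Lemma card_monomial_basis c : codim (gpoly f : rep G) c -> #|{: B}| = c.
Proof.
move=> [e he].
have JL : lin_closed (jacobian_ideal (gpoly f : rep G)).
  split; last by move=> a x y; exact: (jacobian_lin ax).
  apply/(jacobianP ax); exists (fun=> 0); first by move=> _; exact: cat0 ax.
  by rewrite /der big1 => [|i _]; [reflexivity | exact: mul0 ax _].
rewrite -[RHS]card_ord; apply/eqP; rewrite eqn_leq.
by rewrite (basis_mod_card_le JL hB he) (basis_mod_card_le JL he hB).
Qed.

Lemma normal_form (t : tensor G) : homogeneous n t ->
  exists! h : mpoly n K * mpoly n K,
    [/\ quasihomogeneous w d h.1, {subset msupp h.2 <= B}
      & Bf (gpoly f) (n - 2) n (t - top (gpoly (h.2 + f * h.1)))].
Proof.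
move=> ht; have [h [q1 sB cob]] := cobound_exists ax hw hf hB (ht T).1.
have bridge (h' : mpoly n K * mpoly n K) :
    Bf (gpoly f) (n - 2) n (t - top (gpoly (h'.2 + f * h'.1))) <->
    cobound f (t T - gpoly (h'.2 + f * h'.1)).
  rewrite Bf_cobound // ?tensorB ?ffunE ?eqxx //.
  by apply: homogeneousB ht _; apply: homogeneous_top; exact: cat_poly ax _.
exists h; split; first by split=> //; exact/bridge.
move=> h' [q1' sB' /bridge cob'].
have sBB : {subset msupp (h.2 - h'.2) <= B}.
  by move=> m /msuppB_le; rewrite mem_cat => /orP[]; [exact: sB | exact: sB'].
have cobB : cobound f (gpoly (h.2 - h'.2 + f * (h.1 - h'.1)) : rep G).
  have := cobound_lin ax (-1) cob cob'; apply: (cobound_ge ax).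
  rewrite scaleN1r opprB addrA subrK -(gpB ax).
  suff -> : h.2 + f * h.1 - (h'.2 + f * h'.1) = h.2 - h'.2 + f * (h.1 - h'.1).
    reflexivity.
  by rewrite mulrBr opprD addrACA.
have h0 := @cobound_unique _ _ _ _ ax w hw N f B hf degree_neq0 hB
    (h.1 - h'.1, h.2 - h'.2) n3 (qhB q1 q1') sBB cobB.
have /subr0_eq e1 := congr1 fst h0; have /subr0_eq e2 := congr1 snd h0.
by rewrite [h]surjective_pairing [h']surjective_pairing e1 e2.
Qed.

(** A basis is given by the monomials of [B] together with the products of [f] with a basis of the
    quasihomogeneous polynomials of degree [d]: freeness is the uniqueness of the normal form,
    generation its existence. *)
Lemma H2_dimension c s : codim (gpoly f : rep G) c ->
  quotient_dim (quasihomogeneous w d) [set 0 : mpoly n K]%classic s ->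
  H2_dim (top (gpoly f : rep G)) (c + s).
Proof.
move=> hc [u [uq ufree ugen]].
pose e (k : B + 'I_s) : tensor G := top (gpoly
  match k with inl m => mpolyX K (val m) | inr j => f * u j end).
pose sum1 (a : B + 'I_s -> K) := \sum_j a (inr j) *: u j.
pose sum2 (a : B + 'I_s -> K) := \sum_(m : B) a (inl m) *: mpolyX K (val m).
have topL (F : B + 'I_s -> mpoly n K) (a : B + 'I_s -> K) :
    \sum_k a k *: top (gpoly (F k) : rep G) = top (gpoly (\sum_k a k *: F k)).
  apply/ffunP => S; rewrite sum_ffunE !ffunE (gpS ax); case: eqP => ST.
    by apply: eq_bigr => k _; rewrite tensorZ ffunE ST eqxx (gpZ ax).
  by apply: big1 => k _; rewrite tensorZ ffunE; case: eqP => // _; rewrite scaler0.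
have sumE a : \sum_k a k *: e k = top (gpoly (sum2 a + f * sum1 a)).
  rewrite /e topL big_sumType /=; congr (top (gpoly (_ + _))).
  by rewrite mulr_sumr; apply: eq_bigr => j _; rewrite scalerAr.
have qs a : quasihomogeneous w d (sum1 a).
  by apply: qh_sum => j _; exact: qhZ.
have hom (h : mpoly n K) : homogeneous n (top (gpoly h : rep G)).
  by apply: homogeneous_top; exact: cat_poly ax _.
apply: (@basis_mod_quotient_dim _ _ _ _ (B + 'I_s)%type e).
  by rewrite card_sum card_ord (card_monomial_basis hc).
split=> [k|a|t ht].
- exact: hom.
- rewrite sumE => /(schouten_cobound f (hom _)); rewrite ffunE eqxx => cob.
  have h0 := @cobound_unique _ _ _ _ ax w hw N f B hf degree_neq0 hB
    (sum1 a, sum2 a) n3 (qs a) (@msupp_lincomb _ _ _ (fun m => a (inl m))) cob.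
  have s10 : sum1 a = 0 := congr1 fst h0; have s20 : sum2 a = 0 := congr1 snd h0.
  case=> [m|j]; first by rewrite -(mcoeff_lincomb (fun m => a (inl m))) [X in mcoeff _ X]s20 mcoeff0.
  exact: (ufree (fun j => a (inr j)) s10).
- have [[h1 h2] [/= q1 sB cob]] := cobound_exists ax hw hf hB (ht T).1.
  have [b hb] := ugen h1 q1.
  exists (fun k => match k with inl m => mcoeff (val m) h2 | inr j => b j end).
  apply/schouten_cobound; rewrite sumE; first exact: homogeneousB ht (hom _).
  rewrite tensorB ffunE eqxx; move: cob; congr (cobound f (_ - gpoly (_ + f * _))).
    by rewrite [LHS](lincombK sB).
  exact: subr0_eq hb.
Qed.

End Main.

(** * Formal series *)

Section FormalGerms.
Variables (K : numFieldType) (n : nat).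
Implicit Types (a b c : formal_rep K n) (m : multinom n) (i j : 'I_n) (p q : mpoly n K).

Local Notation "''X' i" := (mpolyX K (mnm1 i)) (at level 8, i at level 2).
Local Notation fpoly p := (@gpoly K n (formal_germs K n) p : formal_rep K n).

Definition fX i a : formal_rep K n :=
  fun m => if m i == 0%N then 0 else a (mnm_sub m (mnm1 i)).

Definition fD i a : formal_rep K n :=
  fun m => ((m i).+1%:R : K) * a (mnm_add m (mnm1 i)).

(** Each nonconstant monomial is assigned to one of its variables. Every coefficient of [fquo i a]
    is then a coefficient of [a] or 0, so that convergence is inherited. *)
Definition lead_var m : option 'I_n := [pick i | m i != 0%N].

(* The cofactors of a splitting [a = a 0 + \sum_i x_i b_i]. *)
Definition fquo i a : formal_rep K n := fun m =>
  let m' := mnm_add m (mnm1 i) in if lead_var m' == Some i then a m' else 0.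

(** The inverse of [W + (k + 1)], an operator that is diagonal on monomials with positive
    eigenvalues. *)
Definition feuler_inv (w : 'I_n -> nat) (k : nat) a : formal_rep K n :=
  fun m => a m / (wdeg w m + k.+1)%:R.

Lemma fX_fD i a m : fX i (fD i a) m = (m i)%:R * a m.
Proof.
rewrite /fX /fD; case: eqP => [->|/eqP mi]; first by rewrite mul0r.
by rewrite submK ?lep1mP // mnmBE mnm1E eqxx subn1 prednK ?lt0n.
Qed.

Lemma fD_fX i j a m : fD i (fX j a) m = (i == j)%:R * a m + fX j (fD i a) m.
Proof.
rewrite /fX /fD mnmDE mnm1E.
have [->|ij] := eqVneq i j.
  rewrite addn1 /= addmK mul1r; case: eqP => [->|/eqP mj]; first by rewrite mul1r addr0.
  rewrite submK ?lep1mP // mnmBE mnm1E eqxx subn1 prednK ?lt0n //.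
  by rewrite -addn1 natrD mulrDl mul1r addrC.
rewrite mul0r add0r addn0; case: eqP => [|/eqP mj]; first by rewrite mulr0.
rewrite mnmBE mnm1E eq_sym (negPf ij) subn0; congr (_ * a _).
by rewrite addmC -addmBA ?lep1mP // addmC.
Qed.

Lemma fhadamard a m : a m = (if m == mnm0 then a mnm0 else 0) + \sum_i fX i (fquo i a) m.
Proof.
have fXE i : fX i (fquo i a) m = if lead_var m == Some i then a m else 0.
  rewrite /fX /fquo; case: eqP => [mi|/eqP mi]; last by rewrite submK // lep1mP.
  by rewrite /lead_var; case: pickP => // j mj; case: eqP => // -[ji]; rewrite ji mi in mj.
under eq_bigr do rewrite fXE.
rewrite /lead_var; case: pickP => [j mj|m0].
  rewrite (bigD1 j) //= eqxx big1 ?addr0 => [|i ij]; last first.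
    by case: eqP => // -[ji]; rewrite ji eqxx in ij.
  by case: eqP => [me|_]; [rewrite me mnm0E in mj | rewrite add0r].
have -> : m = mnm0 by apply/mnmP => i; rewrite mnm0E; apply/eqP; move: (m0 i) => /negbFE.
by rewrite eqxx big1 // addr0.
Qed.

Lemma feulerK (w : 'I_n -> nat) (k : nat) a m :
  \sum_(i < n) (w i)%:R * fX i (fD i (feuler_inv w k a)) m
    + k.+1%:R * feuler_inv w k a m = a m.
Proof.
under eq_bigr do rewrite fX_fD mulrA -natrM.
rewrite -mulr_suml -natr_sum -/(wdeg w m) -mulrDl -natrD /feuler_inv.
by rewrite mulrC divfK // pnatr_eq0 addnS.
Qed.

(** A coefficient of a product sees only coefficients of no larger degree, so the ring laws of
    series are inherited from polynomials through truncations. *)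
Lemma formal_mulE a b p q m :
  (forall k, (mdeg k <= mdeg m)%N -> mcoeff k p = a k) ->
  (forall k, (mdeg k <= mdeg m)%N -> mcoeff k q = b k) ->
  formal_mul a b m = mcoeff m (p * q).
Proof.
move=> hp hq; rewrite (mcoeff_poly_mul p q (ltnSn (mdeg m))) /formal_mul.
by apply: eq_bigr => k _; rewrite hp ?hq // -ltnS bmdeg.
Qed.

Definition trunc m a : mpoly n K :=
  \sum_(k : bmultinom n (mdeg m).+1) a k *: mpolyX K k.

Lemma mcoeff_trunc m a k : (mdeg k <= mdeg m)%N -> mcoeff k (trunc m a) = a k.
Proof. by move=> h; rewrite /trunc (mcoeff_mpoly a) // ltnS. Qed.

Lemma formal_mulXE i a : formal_mul (fpoly 'X i) a = fX i a.
Proof.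
apply/funext => m.
rewrite (@formal_mulE _ _ 'X i (trunc m a) m) => [|//|k]; last exact: mcoeff_trunc.
rewrite mcoeffXM /fX; case: eqP => // _; apply: mcoeff_trunc; exact: mdegB.
Qed.

Lemma formal_sumE (I : Type) (r : seq I) (F : I -> formal_rep K n) m :
  (\sum_(i <- r) F i) m = \sum_(i <- r) F i m.
Proof. by elim/big_rec2: _ => // i y1 y2 _ <-. Qed.

Lemma formal_germ_axioms :
  @germ_axioms K n (formal_germs K n) (fun a => (a : formal_rep K n) mnm0).
Proof.
have ag k (a : formal_rep K n) m := @mcoeff_trunc m a k.
split=> /=; try by move=> *; subst.
- move=> a b; apply/funext => m.
  rewrite (@formal_mulE a b (trunc m a) (trunc m b)) => [|k|k]; try exact: ag.
  by rewrite mulrC; symmetry; apply: formal_mulE => k; exact: ag.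
- move=> c a b d; apply/funext => m; rewrite !fctE.
  rewrite (@formal_mulE d (c *: a + b) (trunc m d) (c *: trunc m a + trunc m b)).
  + rewrite mulrDr -scalerAr mcoeffD mcoeffZ.
    by congr (c * _ + _); symmetry; apply: formal_mulE => k; exact: ag.
  + by move=> k; exact: ag.
  + by move=> k km; rewrite mcoeffD mcoeffZ !ag.
- by move=> c p q; apply/funext => m; rewrite mcoeffD mcoeffZ.
- move=> a; apply/funext => m; rewrite (@formal_mulE _ a 1 (trunc m a)) => [|//|k]; last exact: ag.
  by rewrite mul1r ag.
- move=> p q a; apply/funext => m.
  rewrite (@formal_mulE _ a (p * q) (trunc m a)) => [|//|k]; last exact: ag.
  rewrite -mulrA; symmetry; apply: formal_mulE => // k km; symmetry.
  by apply: formal_mulE => // l lk; apply: ag; exact: leq_trans km.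
- by move=> i c a b _ _; apply/funext => m; rewrite !fctE mulrDr; congr (_ + _); exact: mulrCA.
- move=> i; apply/funext => m; rewrite mcoeff1 -mdeg_eq0 mdegD mdeg1 addn1 /=.
  by rewrite mulr0.
- move=> i j a _; rewrite !formal_mulXE; apply/funext => m; exact: fD_fX.
- by rewrite mcoeff1 eqxx.
- by move=> i a; rewrite formal_mulXE /fX mnm0E.
- move=> a _; exists (fun i => fquo i a) => //; apply/funext => m.
  rewrite {1}(fhadamard a m) !fctE formal_sumE; congr (_ + _).
    by rewrite mcoeff1; case: eqP => _; rewrite ?[RHS]mulr1 ?[RHS]mulr0.
  by apply: eq_bigr => i _; rewrite formal_mulXE.
- move=> w k b hw _; exists (feuler_inv w k b) => //; apply/funext => m.
  rewrite -[RHS](feulerK w k) !fctE formal_sumE; congr (_ + _).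
  by apply: eq_bigr => i _; rewrite !fctE formal_mulXE.
Qed.

End FormalGerms.

Local Open Scope classical_set_scope.
Local Open Scope ring_scope.

(** * Germs of functions *)

Section FunctionGermAxioms.
Variables (K : numFieldType) (n : nat).

Local Notation V := ('rV[K]_n).
Implicit Types (g h : fun_rep K n) (i j : 'I_n).

Definition pderivable g (x : V) := forall i, derivable (g : V -> K^o) x 'e_i.

Lemma fun_pd_near i g h (x : V) : (\forall y \near x, g y = h y) ->
  fun_pd i g x = fun_pd i h x.
Proof. by move=> gh; apply: near_eq_derive. Qed.

Lemma pderivable_near g h (x : V) : (\forall y \near x, g y = h y) ->
  pderivable g x -> pderivable h x.
Proof. by move=> gh hg i; apply: (near_eq_derivable gh). Qed.

Lemma is_derive_coord i j (x : V) :
  is_derive x 'e_i (fun y : V => y ord0 j : K^o) (i == j)%:R.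
Proof.
have c : (fun h : K => h^-1 *: (((fun y : V => y ord0 j : K^o) \o shift x) (h *: 'e_i)
     - x ord0 j)) @ 0^' --> ((i == j)%:R : K^o).
  apply: cvg_near_cst; near=> h.
  rewrite /= !mxE addrK eqxx /= eq_sym scalerA mulVf ?scale1r //.
  by near: h; exact: nbhs_dnbhs_neq.
by apply: DeriveDef; [apply/cvg_ex; exists (i == j)%:R | exact: cvg_lim c].
Unshelve. all: by end_near. Qed.

Lemma fun_pd_lin i (c : K) g h (x : V) : pderivable g x -> pderivable h x ->
  fun_pd i (c *: g + h) x = c *: fun_pd i g x + fun_pd i h x.
Proof.
move=> hg hh; rewrite /fun_pd -(deriveZ _ (hg i)) -deriveD //; exact: derivableZ.
Qed.

Lemma pderivable_lin (c : K) g h (x : V) : pderivable g x -> pderivable h x ->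
  pderivable (c *: g + h) x.
Proof. by move=> hg hh i; apply: derivableD => //; exact: derivableZ. Qed.

Lemma fun_pd_mulX i j g (x : V) : pderivable g x ->
  fun_pd i (fun y => (y : V) ord0 j * g y : K^o) x =
    (i == j)%:R * g x + x ord0 j * fun_pd i g x :> K^o.
Proof.
move=> hg; rewrite /fun_pd; have [dc ec] := is_derive_coord i j x.
have := deriveM dc (hg i); rewrite ec => e.
by rewrite [LHS]e addrC [g x *: _]mulrC.
Qed.

Lemma pderivable_mulX j g (x : V) : pderivable g x ->
  pderivable (fun y => (y : V) ord0 j * g y : K^o) x.
Proof.
move=> hg i; have [dc _] := is_derive_coord i j x; exact: (derivableM dc (hg i)).
Qed.

Variable C : set (fun_rep K n).
Hypotheses (C0 : C 0) (C1 : C (fun=> 1))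
  (C_lin : forall (c : K) g h, C g -> C h -> C (c *: g + h))
  (C_pd : forall i g, C g -> C (fun_pd i g))
  (C_mulX : forall j g, C g -> C (fun y => (y : V) ord0 j * g y : K^o))
  (C_der : forall g, C g -> \forall x \near (0 : V), pderivable g x)
  (C_hadamard : forall g, C g -> exists2 b : 'I_n -> fun_rep K n,
     forall i, C (b i) &
     \forall x \near (0 : V), g x = g (0 : V) + \sum_i (x : V) ord0 i * b i x :> K)
  (C_euler : forall (w : 'I_n -> nat) (k : nat) b, (forall i, 0 < w i)%N -> C b ->
     exists2 g, C g & \forall x \near (0 : V),
       \sum_(i < n) (w i)%:R * ((x : V) ord0 i * fun_pd i g x) + k.+1%:R * g x = b x :> K).

Lemma sum_funE (I : Type) (r : seq I) (F : I -> fun_rep K n) (x : V) :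
  (\sum_(i <- r) F i) x = \sum_(i <- r) F i x.
Proof. by elim/big_rec2: _ => // i y1 y2 _ <-. Qed.

Lemma fun_germ_axioms :
  @germ_axioms K n (fun_germs C) (fun g => (g : fun_rep K n) (0 : V)).
Proof.
have mX i (g : fun_rep K n) :
    gmul (gpoly (mpolyX K (mnm1 i)) : rep (fun_germs C)) g
      = (fun y => (y : V) ord0 i * g y : K^o).
  by apply/funext => x /=; rewrite mevalXU.
have gp1 : gpoly 1 = (fun=> 1) :> rep (fun_germs C).
  by apply/funext => x /=; rewrite meval1.
split=> /=.
- by move=> a; near=> x.
- by move=> a b ab; near=> x; rewrite (near ab x).
- by move=> a b d ab bd; near=> x; rewrite (near ab x) // (near bd x).
- by move=> c a a' b b' ha hb; near=> x; rewrite !fctE (near ha x) // (near hb x).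
- by move=> a a' b b' ha hb; near=> x; rewrite (near ha x) // (near hb x).
(* Equality near 0 is equality near every point close to 0, so the derivatives agree at those
   points. *)
- move=> i a b /nbhs_interior ab; near=> x; apply: fun_pd_near; near: x; exact: ab.
- by move=> a b; apply/funext => x; rewrite mulrC.
- move=> c a b d; apply/funext => x; rewrite !fctE mulrDr; congr (_ + _).
  exact: mulrCA.
- by move=> c p q; apply/funext => x; rewrite mevalD mevalZ.
- exact: C0.
- by rewrite -[X in C X]/(gpoly 1 : rep (fun_germs C)) gp1.
- exact: C_lin.
- exact: C_pd.
- move=> i a Ca.
  rewrite -[X in C X]/(gmul (gpoly (mpolyX K (mnm1 i)) : rep (fun_germs C)) a) mX.
  exact: C_mulX.
- by move=> a; apply/funext => x; rewrite meval1 mul1r.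
- by move=> p q a; apply/funext => x; rewrite mevalM mulrA.
- move=> i c a b /C_der ha /C_der hb; near=> x; apply: fun_pd_lin.
    by near: x.
  by near: x.
- move=> i; near=> x; rewrite -[X in fun_pd i X]/(gpoly 1 : rep (fun_germs C)) gp1.
  exact: derive_cst.
- move=> i j a /C_der ha; near=> x.
  rewrite -[X in fun_pd i X]/(gmul (gpoly (mpolyX K (mnm1 j)) : rep (fun_germs C)) a) mX.
  rewrite fun_pd_mulX; last by near: x.
  by rewrite !fctE mevalXU.
- by move=> a b /nbhs_singleton.
- by [].
- by rewrite meval1.
- by move=> i a; rewrite mevalXU mxE mul0r.
- move=> a Ca; have [b Cb e] := C_hadamard Ca; exists b => //.
  near=> x; rewrite (near e x) // !fctE meval1 sum_funE; congr (_ + _).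
    by rewrite [RHS]mulr1.
  by apply: eq_bigr => i _; rewrite mevalXU.
- move=> w k b hw Cb; have [g Cg e] := C_euler k hw Cb; exists g => //.
  near=> x; rewrite -(near e x) // !fctE sum_funE; congr (_ + _).
  by apply: eq_bigr => i _; rewrite !fctE mevalXU.
Unshelve. all: by end_near. Qed.

End FunctionGermAxioms.

(** * Analytic germs *)

Section UnorderedSums.
Variables (K : numFieldType) (I : choiceType).
Implicit Types (u v : I -> K) (l : K) (A : {fset I}).

Definition fsum u A := \sum_(i <- A) u i.

(** Unconditional summation in explicit form. A positive [e] is real even when [K] is complex. *)
Definition hsum u l := forall e : K, 0 < e -> exists A0 : {fset I},
  forall A, fsubset A0 A -> `|l - fsum u A| < e.

Lemma hsumP u l : hsum u l <-> partial_sum u @ totally --> (l : K^o).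
Proof.
have E A : partial_sum u A = fsum u A by rewrite /fsum big_seq_fsetE.
split=> [h|h e e0].
  apply/(@cvgrPdist_lt _ _ _ _ (totally_filter)) => e e0; have [A0 hA] := h e e0.
  by exists A0 => // A /= A0A; rewrite E; exact: hA.
have /(@cvgrPdist_lt _ _ _ _ (totally_filter)) /(_ e e0) [A0 _ hA] := h.
by exists A0 => A /hA; rewrite E.
Qed.

Lemma fsum_lin (a : K) u v A : fsum (fun i => a * u i + v i) A = a * fsum u A + fsum v A.
Proof. by rewrite /fsum big_split mulr_sumr. Qed.

Lemma hsum_lin (a : K) u v l l' : hsum u l -> hsum v l' ->
  hsum (fun i => a * u i + v i) (a * l + l').
Proof.
(* The added 1 covers the case [a = 0]. *)
move=> hu hv e e0; pose e1 := e / 2 / (`|a| + 1).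
have a1 : 0 < `|a| + 1 by rewrite ltr_wpDl.
have e10 : 0 < e1 by rewrite !divr_gt0.
have e20 : 0 < e / 2 by rewrite divr_gt0.
have [A1 h1] := hu _ e10; have [A2 h2] := hv _ e20.
exists (A1 `|` A2)%fset => A; rewrite fsubUset => /andP[/h1 l1 /h2 l2].
rewrite fsum_lin opprD addrACA -mulrBr.
apply: le_lt_trans (ler_normD _ _) _; rewrite [e]splitr ler_ltD //.
rewrite normrM -[leRHS](divfK (lt0r_neq0 a1)) mulrC.
by apply: ler_pM => //; [exact: ltW | rewrite lerDl].
Qed.

Lemma hsum_le u l M : hsum u l -> (forall A, `|fsum u A| <= M) -> `|l| <= M.
Proof.
move=> hu hM; have M0 : 0 <= M by apply: le_trans (hM fset0).
(* The order of [K] may be partial; the norm of [l] and the nonnegative [M] are real, hence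
   comparable. *)
have lr : `|l| \is Num.real by rewrite normr_real.
rewrite real_leNgt ?ger0_real //; apply/negP => Ml.
have [A0 h] := hu (`|l| - M) ltac:(by rewrite subr_gt0).
have := h A0 (fsubset_refl _); apply/negP; rewrite -real_leNgt ?normr_real //; last first.
  by rewrite realB // ger0_real.
rewrite lerBlDr -{1}(subrK (fsum u A0) l).
by apply: le_trans (ler_normD _ _) _; rewrite lerD2l.
Qed.

Lemma hsum_uniq u l l' : hsum u l -> hsum u l' -> l = l'.
Proof.
move=> h h'; have h0 := hsum_lin (-1) h h'.
have : `|- 1 * l + l'| <= 0.
  apply: (hsum_le h0) => A; rewrite fsum_lin mulN1r addNr normr0 //.
by rewrite normr_le0 mulN1r addrC subr_eq0 => /eqP.
Qed.

Lemma fsum_le_norm u A : `|fsum u A| <= fsum (fun i => `|u i|) A.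
Proof. exact: ler_norm_sum. Qed.

(** A term off [A0] is the difference of two partial sums, each within 1 of [l]; this accounts for
    the 2. *)
Lemma hsum_bounded u l : hsum u l -> exists C, forall i, `|u i| <= C.
Proof.
move=> h; have [A0 hA] := h 1 ltr01.
exists (2 + fsum (fun i => `|u i|) A0) => i.
have s0 : 0 <= fsum (fun i => `|u i|) A0 by apply: sumr_ge0.
have [iA|iA] := boolP (i \in A0).
  rewrite /fsum (big_fsetD1 i) //= addrCA lerDl addr_ge0 //.
  by apply: sumr_ge0.
apply: le_trans (_ : 2 <= _); last by rewrite lerDl.
have -> : u i = (l - fsum u A0) - (l - fsum u (i |` A0)%fset).
  by rewrite {2}/fsum big_fsetU1 //= -/(fsum u A0); ring.
apply: le_trans (ler_normB _ _) _; rewrite -[2]/(1 + 1); apply: lerD; apply: ltW.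
  exact/hA/fsubset_refl.
by apply: hA; exact: fsubsetU1.
Qed.

Lemma hsum_single u i0 : (forall i, i != i0 -> u i = 0) -> hsum u (u i0).
Proof.
move=> h e e0; exists [fset i0]%fset => A; rewrite fsub1set => iA.
rewrite /fsum (big_fsetD1 i0) //= big1_fset ?addr0 ?subrr ?normr0 // => i.
by rewrite !inE => /andP[/h].
Qed.

End UnorderedSums.

(** The partial sum of [u] over [A] is that of [v] over the preimage of [A] under [phi]. Injectivity
    makes this preimage finite; it is built with the partial inverse [psi]. *)
Lemma hsum_reindex (K : numFieldType) (I J : choiceType) (phi : J -> I) (u : I -> K) (v : J -> K) l :
  injective phi -> (forall j, u (phi j) = v j) ->
  (forall i, (forall j, phi j != i) -> u i = 0) -> hsum v l -> hsum u l.
Proof.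
move=> inj uv u0 h e e0; have [A0 hA] := h e e0.
exists (phi @` A0)%fset => A sA.
have [B sB eB] : exists2 B : {fset J}, fsubset A0 B & fsum u A = fsum v B.
  have /choice [psi hpsi] : forall i, exists o : option J,
      (forall j, o = Some j -> phi j = i) /\ (o = None -> forall j, phi j != i).
    move=> i.
    have [[j ji]|nj] := pselect (exists j, phi j = i).
      by exists (Some j); split=> // k [<-].
    by exists None; split=> // _ j; apply/eqP => ji; apply: nj; exists j.
  have psiK j : psi (phi j) = Some j.
    case E : (psi (phi j)) => [k|]; first by rewrite (inj _ _ ((hpsi _).1 k E)).
    by have := (hpsi _).2 E j; rewrite eqxx.
  pose B : {fset J} := [fset j in pmap psi A]%fset.
  have BE j : (j \in B) = (phi j \in A).
    rewrite !inE mem_pmap; apply/mapP/idP => [[i iA]|jA].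
      by move=> /esym /(hpsi i).1 ->.
    by exists (phi j) => //; rewrite psiK.
  exists B.
    apply/fsubsetP => j jA0; rewrite BE; apply: (fsubsetP sA).
    by apply/imfsetP; exists j.
  rewrite /fsum; transitivity (\sum_(i <- (phi @` B)%fset) u i).
    symmetry; apply: big_fset_incl.
      by apply/fsubsetP => i /imfsetP[j /= jB ->]; rewrite -BE.
    move=> i iA iB; apply: u0 => j; apply: contraNneq iB => ji.
    by apply/imfsetP; exists j => //=; rewrite BE ji.
  rewrite big_imfset /=; last by move=> x y _ _; exact: inj.
  by apply: eq_bigr => j _; exact: uv.
by rewrite eB; exact: hA.
Qed.

(** The one completeness property of [K] on which the analytic case rests; through it, real analytic
    and holomorphic germs share their proofs. *)
Definition abs_summable_complete (K : numFieldType) := forall (I : choiceType)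
  (u : I -> K) (M : K), (forall A, fsum (fun i => `|u i|) A <= M) -> exists l, hsum u l.

(** A nonnegative family with bounded partial sums converges to their supremum, and [u] is the
    difference of the nonnegative families [|u| + u] and [|u|]. *)
Lemma abs_summable_complete_real (R : realType) : abs_summable_complete R.
Proof.
have pos (I : choiceType) (v : I -> R) (M : R) : (forall i, 0 <= v i) ->
    (forall A, fsum v A <= M) -> exists l, hsum v l.
  move=> v0 hM; pose S := range (fsum v); exists (sup S) => e e0.
  have hS : has_sup S.
    split; first by exists (fsum v fset0); exists fset0.
    by exists M => _ [A _ <-].
  have [_ [A0 _ <-] lA0] := sup_adherent e0 hS.
  exists A0 => A sA.
  have lA : fsum v A <= sup S by apply: ub_le_sup; [case: hS | exists A].
  have mono : fsum v A0 <= fsum v A.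
    rewrite /fsum [leRHS](big_fsetID _ (mem A0)) /=.
    rewrite (_ : [fset x in A | x \in A0]%fset = A0) ?lerDl ?sumr_ge0 //.
    by apply/fsetP => i; rewrite !inE; apply: andb_idl; exact: fsubsetP.
  by rewrite ger0_norm ?subr_ge0 // ltrBlDr -ltrBlDl (lt_le_trans _ mono) // addrC.
move=> I u M hM.
have [||l1 h1] := pos I (fun i => `|u i| + u i) (M + M).
- by move=> i; rewrite -lerBlDr sub0r -normrN ler_norm.
- move=> A; apply: le_trans (lerD (hM A) (hM A)).
  rewrite /fsum big_split /= lerD2l; apply: ler_sum => i _; exact: ler_norm.
have [||l2 h2] := pos I (fun i => `|u i|) M => //.
exists (-1 * l2 + l1).
rewrite (_ : u = (fun i => -1 * `|u i| + (`|u i| + u i))); first exact: hsum_lin.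
by apply/funext => i; rewrite mulN1r addKr.
Qed.

Lemma abs_summable_complete_complex (R : realType) : abs_summable_complete R[i].
Proof.
move=> I u M hM.
have ni : `|'i%C| = 1 :> R[i].
  by rewrite normc_def /= expr0n expr1n add0r sqrtr1.
have Re_sum (v : I -> R[i]) A : complex.Re (fsum v A) = fsum (fun i => complex.Re (v i)) A.
  by rewrite /fsum; elim/big_rec2: _ => // i x y _ <-; case: (v i) y => a b [].
have Re_conv (v : I -> R[i]) : (forall A, fsum (fun i => `|v i|) A <= M) ->
    exists l, hsum (fun i => complex.Re (v i)) l.
  move=> hv; apply: (@abs_summable_complete_real R I _ (complex.Re M)) => A.
  have : ((fsum (fun i => `|complex.Re (v i)|) A)%:C)%C <= M.
    apply: le_trans (hv A); rewrite /fsum rmorph_sum; apply: ler_sum => i _.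
    exact: normc_ge_Re.
  by rewrite lecE /= => /andP[].
have [l1 h1] := Re_conv u hM.
(* The real part of [u i * 'i] is minus the imaginary part of [u i]; hence [- l2] in the limit. *)
have [|l2 h2] := Re_conv (fun i => u i * 'i%C).
  move=> A; apply: le_trans (hM A); apply: ler_sum => i _.
  by rewrite normrM ni mulr1.
exists (l1 +i* (- l2))%C => e.
rewrite ltcE /= => /andP[/eqP Ime Ree].
have e2 : 0 < complex.Re e / 2 by rewrite divr_gt0.
have [A1 hA1] := h1 _ e2; have [A2 hA2] := h2 _ e2.
exists (A1 `|` A2)%fset => A; rewrite fsubUset => /andP[/hA1 d1 /hA2 d2].
have nR (x : R) : `|(x%:C)%C| = (`|x|%:C)%C :> R[i].
  by rewrite normc_def /= expr0n addr0 sqrtr_sqr.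
have -> : e = ((complex.Re e)%:C)%C by rewrite [LHS]complexE Ime mulr0 addr0.
rewrite [X in `|X|]complexE; apply: le_lt_trans (ler_normD _ _) _.
rewrite normrM nR nR ni mul1r.
rewrite -rmorphD /= ltcR [complex.Re e]splitr; apply: ltrD.
  have -> : complex.Re ((l1 +i* - l2)%C - fsum u A) = l1 - complex.Re (fsum u A).
    by case: (fsum u A).
  by rewrite Re_sum.
have -> : complex.Im ((l1 +i* - l2)%C - fsum u A) = - (l2 + complex.Im (fsum u A)).
  by case: (fsum u A) => a b /=; rewrite opprD.
rewrite normrN -[complex.Im _]opprK -ReiNIm.
by rewrite {1}/fsum mulr_suml -/(fsum (fun i => u i * 'i%C) A) Re_sum.
Qed.

(** * Convergent power series and termwise differentiation *)

Section PowerSeries.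
Variables (K : numFieldType) (n : nat).
Hypothesis Kc : abs_summable_complete K.
Local Notation V := ('rV[K]_n).
Implicit Types (c : formal_rep K n) (x y : V) (m : multinom n) (r rho : K) (i j : 'I_n).

Definition mon x m : K := \prod_i x ord0 i ^+ m i.

(** Made total by the value 0 where the series does not converge; elsewhere [hsum_uniq] makes the
    choice unambiguous. *)
Definition psum c x : K := xget 0 [set l | hsum (fun m => c m * mon x m) l].

Definition small r x := forall i, `|x ord0 i| <= r.

(** A Cauchy estimate at radius [rho] rather than convergence: a bound on coefficients passes easily
    through the operations below, and comparison with a geometric series gives absolute convergence
    on [small (rho / 2)]. *)
Definition conv rho c := 0 < rho /\ exists C : K, forall m, `|c m| * rho ^+ mdeg m <= C.

Lemma psumE c x l : hsum (fun m => c m * mon x m) l -> psum c x = l.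
Proof.
move=> h; rewrite /psum; case: xgetP => [_ -> h'|/(_ l) //].
exact: hsum_uniq h' h.
Qed.

Lemma mon_le r x m : small r x -> `|mon x m| <= r ^+ mdeg m.
Proof.
move=> h; rewrite mdegE -prodrXr /mon normr_prod; apply: ler_prod => i _.
by rewrite normr_ge0 normrX lerXn2r ?nnegrE // (le_trans _ (h i)).
Qed.

Lemma geom_le (N : nat) : \sum_(j < N) (2^-1 : K) ^+ j <= 2.
Proof.
have -> : \sum_(j < N) (2^-1 : K) ^+ j = 2 - 2 * 2^-1 ^+ N.
  elim: N => [|N IH]; first by rewrite big_ord0 mulr1 subrr.
  by rewrite big_ord_recr /= IH exprS; field.
by rewrite gerBl mulr_ge0 ?exprn_ge0 ?invr_ge0.
Qed.

(** A finite set of multi-indices lies in a cube, over which the sum factors into [n] geometric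
    sums, each at most 2. *)
Lemma multinom_geom (A : {fset multinom n}) : fsum (fun m => 2^-1 ^+ mdeg m : K) A <= 2 ^+ n.
Proof.
pose N := (\max_(m <- A) mdeg m).+1.
pose g (f : {ffun 'I_n -> 'I_N}) : multinom n := @Multinom n [tuple (f i : nat) | i < n].
have gE f i : g f i = f i by exact: mnmE.
have g_inj : injective g.
  by move=> f f' e; apply/ffunP => i; apply/val_inj; rewrite /= -!gE e.
pose s := [seq g f | f <- enum {: {ffun 'I_n -> 'I_N}}].
have us : uniq s by rewrite map_inj_uniq // enum_uniq.
have As : {subset A <= s}.
  move=> m mA; have mN i : (m i < N)%N.
    rewrite ltnS (@leq_trans (mdeg m)) //; last exact: leq_bigmax_seq.
    by rewrite mdegE (bigD1 i) //= leq_addr.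
  apply/mapP; exists [ffun i => Ordinal (mN i)]; first by rewrite mem_enum.
  by apply/mnmP => i; rewrite gE ffunE.
rewrite /fsum; apply: (@le_trans _ _ (\sum_(m <- s) 2^-1 ^+ mdeg m)).
  have -> : \sum_(m <- A) (2^-1 : K) ^+ mdeg m =
            \sum_(m <- s | m \in A) 2^-1 ^+ mdeg m.
    rewrite -[RHS]big_filter; apply: perm_big.
    apply: uniq_perm; rewrite ?fset_uniq ?filter_uniq // => m.
    by rewrite mem_filter andb_idr //; exact: As.
  rewrite [leRHS](bigID (fun m => m \in A)) /=.
  by rewrite lerDl sumr_ge0 // => m _; rewrite exprn_ge0 ?invr_ge0.
rewrite big_map big_enum /=.
have E f : (2^-1 : K) ^+ mdeg (g f) = \prod_i 2^-1 ^+ f i.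
  by rewrite mdegE -prodrXr; apply: eq_bigr => i _; rewrite gE.
under eq_bigr do rewrite E.
rewrite -(bigA_distr_bigA (fun (i : 'I_n) (j : 'I_N) => (2^-1 : K) ^+ j)) /=.
rewrite -[X in _ ^+ X](card_ord n) -prodr_const; apply: ler_prod => i _.
by rewrite geom_le sumr_ge0 // => j _; rewrite exprn_ge0 ?invr_ge0.
Qed.

Lemma term_le rho C c x m : 0 < rho -> (forall m, `|c m| * rho ^+ mdeg m <= C) ->
  small (rho / 2) x -> `|c m * mon x m| <= C * 2^-1 ^+ mdeg m.
Proof.
move=> r0 hC hx; rewrite normrM.
apply: le_trans (ler_wpM2l (normr_ge0 _) (mon_le m hx)) _.
by rewrite exprMn mulrA ler_wpM2r ?exprn_ge0 ?invr_ge0.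
Qed.

Lemma conv_hsum rho c x : conv rho c -> small (rho / 2) x ->
  hsum (fun m => c m * mon x m) (psum c x).
Proof.
move=> [r0 [C hC]] hx.
have [|l hl] := Kc (u := fun m => c m * mon x m) (M := C * 2 ^+ n).
  move=> A; apply: le_trans (_ : fsum (fun m => C * 2^-1 ^+ mdeg m) A <= _).
    by apply: ler_sum => m _; exact: term_le hC hx.
  rewrite /fsum -mulr_sumr ler_wpM2l ?multinom_geom //.
  by apply: le_trans (hC mnm0); rewrite mulr_ge0 ?exprn_ge0 // ltW.
by rewrite (psumE hl).
Qed.

Lemma conv_le rho rho' c : 0 < rho' -> rho' <= rho -> conv rho c -> conv rho' c.
Proof.
move=> r0' rr [r0 [C hC]]; split=> //; exists C => m; apply: le_trans (hC m).
by rewrite ler_wpM2l // lerXn2r // nnegrE ltW.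
Qed.

Lemma conv_lin rho (a : K) c c' : conv rho c -> conv rho c' -> conv rho (a *: c + c').
Proof.
move=> [r0 [C hC]] [_ [C' hC']]; split=> //; exists (`|a| * C + C') => m.
rewrite !fctE; apply: le_trans (_ : (`|a| * `|c m| + `|c' m|) * rho ^+ mdeg m <= _).
  rewrite ler_wpM2r ?exprn_ge0 ?(ltW r0) //.
  by apply: le_trans (ler_normD _ _) _; rewrite lerD2r [leLHS]normrM.
by rewrite mulrDl -mulrA lerD // ler_wpM2l.
Qed.

Lemma psum_lin rho (a : K) c c' x : conv rho c -> conv rho c' -> small (rho / 2) x ->
  psum (a *: c + c') x = a * psum c x + psum c' x.
Proof.
move=> hc hc' hx; apply: psumE.
have := hsum_lin a (conv_hsum hc hx) (conv_hsum hc' hx).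
rewrite (_ : (fun m => a * (c m * mon x m) + c' m * mon x m) =
   (fun m => (a *: c + c') m * mon x m)) //.
by apply/funext => m; rewrite !fctE mulrDl; congr (_ + _); exact: mulrA.
Qed.

Lemma mon0 x : mon x mnm0 = 1.
Proof. by rewrite /mon big1 // => i _; rewrite mnm0E expr0. Qed.

Lemma monD x m m' : mon x (mnm_add m m') = mon x m * mon x m'.
Proof. by rewrite /mon -big_split; apply: eq_bigr => i _; rewrite mnmDE exprD. Qed.

Lemma mon1 x i : mon x (mnm1 i) = x ord0 i.
Proof.
rewrite /mon (bigD1 i) //= mnm1E eqxx expr1 big1 ?mulr1 // => j ji.
by rewrite mnm1E eq_sym (negPf ji) expr0.
Qed.

Definition fcst (a : K) : formal_rep K n := fun m => if m == mnm0 then a else 0.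

Lemma psum_cst (a : K) x : psum (fcst a) x = a.
Proof.
apply: psumE.
have e : a = fcst a mnm0 * mon x mnm0 by rewrite /fcst eqxx mon0 mulr1.
rewrite [X in hsum _ X]e.
apply: (@hsum_single K _ (fun m => fcst a m * mon x m) mnm0) => m m0.
by rewrite /fcst (negPf m0) mul0r.
Qed.

Lemma psum_fX rho i c x : conv rho c -> small (rho / 2) x ->
  psum (fX i c) x = x ord0 i * psum c x.
Proof.
move=> hc hx; apply: psumE.
apply: (@hsum_reindex K _ _ (fun m => mnm_add m (mnm1 i)) _
  (fun m => x ord0 i * (c m * mon x m))).
- by move=> m m' /addIm.
- move=> m; rewrite /fX mnmDE mnm1E eqxx addn1 /= addmK monD mon1; ring.
- move=> m hm; rewrite /fX; case: eqP => [|/eqP mi]; first by rewrite mul0r.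
  by have := hm (mnm_sub m (mnm1 i)); rewrite submK ?lep1mP // eqxx.
have z : hsum (fun _ : multinom n => 0 : K) 0 by exact: (@hsum_single K _ (fun=> 0) mnm0).
have := hsum_lin (x ord0 i) (conv_hsum hc hx) z.
by rewrite addr0; under eq_fun do rewrite addr0.
Qed.

Lemma conv_fX rho i c : conv rho c -> conv rho (fX i c).
Proof.
move=> [r0 [C hC]]; split=> //; exists (C * rho) => m; rewrite /fX.
have C0 : 0 <= C by apply: le_trans (hC mnm0); rewrite mulr_ge0 ?exprn_ge0 // ltW.
case: eqP => [_|/eqP mi]; first by rewrite normr0 mul0r mulr_ge0 // ltW.
rewrite -{2}(submK (_ : lem (mnm1 i) m)) ?lep1mP // mdegD mdeg1 addn1 exprSr mulrA.
by rewrite ler_wpM2r // ltW.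
Qed.

Lemma conv_shift rho i c (d : multinom n -> K) : conv rho c ->
  (forall m, `|d m| <= `|c (mnm_add m (mnm1 i))|) -> conv rho d.
Proof.
move=> [r0 [C hC]] hd; split=> //; exists (C / rho) => m.
rewrite ler_pdivlMr // -mulrA -exprSr.
apply: le_trans (hC (mnm_add m (mnm1 i))); rewrite mdegD mdeg1 addn1.
by rewrite ler_wpM2r // exprn_ge0 // ltW.
Qed.

Lemma conv_fquo rho i c : conv rho c -> conv rho (fquo i c).
Proof. by move=> h; apply: (conv_shift h) => m; rewrite /fquo; case: ifP; rewrite ?normr0. Qed.

(** Halving the radius pays for the factor [m i + 1], which is at most [2 ^ mdeg m]. *)
Lemma conv_fD rho i c : conv rho c -> conv (rho / 2) (fD i c).
Proof.
move=> hc; have [r0 [C hC]] := hc.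
have [_ [C' hC']] := @conv_shift rho i c (fun m => c (mnm_add m (mnm1 i))) hc (fun m => lexx _).
split; first by rewrite divr_gt0.
exists C' => m; apply: le_trans (hC' m).
rewrite /fD normrM normr_nat exprMn; set b := `|c _|.
have -> : (m i).+1%:R * b * (rho ^+ mdeg m * 2^-1 ^+ mdeg m) =
  b * rho ^+ mdeg m * ((m i).+1%:R * 2^-1 ^+ mdeg m) by ring.
have b0 : 0 <= b by rewrite normr_ge0.
rewrite ler_piMr ?mulr_ge0 ?exprn_ge0 ?(ltW r0) //.
rewrite exprVn ler_pdivrMr ?exprn_gt0 // mul1r -natrX ler_nat.
apply: leq_trans (ltn_expl (m i) (ltnSn 1)) _; rewrite leq_exp2l //.
by rewrite mdegE (bigD1 i) //= leq_addr.
Qed.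

(** The factor [r ^+ 2] on the left stands for the exponent [k - 2] on the right and keeps the
    estimate uniform in small [k]. The remainders satisfy [E_(k+1) = (a + h) E_k + k h^2 a^(k-1)],
    and [k^2 + k <= (k+1)^2]. *)
Lemma binomial_remainder (r a h : K) (k : nat) : `|a| <= r -> `|a + h| <= r ->
  `|(a + h) ^+ k - a ^+ k - k%:R * h * a ^+ k.-1| * r ^+ 2 <= k%:R ^+ 2 * `|h| ^+ 2 * r ^+ k.
Proof.
move=> ar ahr; have r0 : 0 <= r by apply: le_trans ar.
elim: k => [|k IH]; first by rewrite !expr0 subrr !mul0r subr0 normr0 !mul0r !mulr_ge0 ?exprn_ge0.
have -> : (a + h) ^+ k.+1 - a ^+ k.+1 - k.+1%:R * h * a ^+ k.+1.-1 =
   (a + h) * ((a + h) ^+ k - a ^+ k - k%:R * h * a ^+ k.-1) + k%:R * h ^+ 2 * a ^+ k.-1.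
  by case: k {IH} => [|k] /=; rewrite ?exprS ?expr0 -?[in LHS]natr1; ring.
apply: le_trans (_ : (r * (k%:R ^+ 2 * `|h| ^+ 2 * r ^+ k) + k%:R * `|h| ^+ 2 * r ^+ k.+1) <= _).
  apply: le_trans (ler_wpM2r (exprn_ge0 2 r0) (ler_normD _ _)) _.
  rewrite mulrDl; apply: lerD.
    by rewrite normrM -mulrA; apply: ler_pM => //; rewrite mulr_ge0 ?exprn_ge0.
  rewrite !normrM normr_nat !normrX; case: k {IH} => [|k] /=; first by rewrite !mul0r.
  have -> : k.+1%:R * `|h| ^+ 2 * `|a| ^+ k * r ^+ 2 =
    k.+1%:R * `|h| ^+ 2 * r ^+ 2 * `|a| ^+ k by ring.
  have -> : k.+1%:R * `|h| ^+ 2 * r ^+ k.+2 = k.+1%:R * `|h| ^+ 2 * r ^+ 2 * r ^+ k.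
    by rewrite !exprS; ring.
  by rewrite ler_wpM2l ?mulr_ge0 ?exprn_ge0 // lerXn2r // nnegrE.
have -> : r * (k%:R ^+ 2 * `|h| ^+ 2 * r ^+ k) + k%:R * `|h| ^+ 2 * r ^+ k.+1 =
   (k%:R ^+ 2 + k%:R) * (`|h| ^+ 2 * r ^+ k.+1) by rewrite (exprS r); ring.
rewrite -mulrA ler_wpM2r ?mulr_ge0 ?exprn_ge0 //.
by rewrite -natrX -natrD -natrX ler_nat; lia.
Qed.

Definition dmon i x m : K := if m i == 0%N then 0 else (m i)%:R * mon x (mnm_sub m (mnm1 i)).

Lemma mon_remainder r x (h : K) i m : small r x -> small r (x + h *: 'e_i) ->
  `|mon (x + h *: 'e_i) m - mon x m - h * dmon i x m| * r ^+ 2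
    <= (m i)%:R ^+ 2 * `|h| ^+ 2 * r ^+ mdeg m.
Proof.
move=> hx hy.
pose P := \prod_(j < n | j != i) x ord0 j ^+ m j.
have r0 : 0 <= r by apply: le_trans (hx i).
have e1 : mon x m = x ord0 i ^+ m i * P by rewrite /mon (bigD1 i).
have yi : (x + h *: 'e_i) ord0 i = x ord0 i + h by rewrite !mxE !eqxx mulr1.
have e2 : mon (x + h *: 'e_i) m = (x ord0 i + h) ^+ m i * P.
  rewrite /mon (bigD1 i) //= yi; congr (_ * _); apply: eq_bigr => j ji.
  by rewrite !mxE (negPf ji) andbF mulr0 addr0.
have e3 : dmon i x m = (m i)%:R * x ord0 i ^+ (m i).-1 * P.
  rewrite /dmon; case: eqP => [->|_]; first by rewrite !mul0r.
  rewrite -mulrA; congr (_ * _); rewrite /mon (bigD1 i) //= mnmBE mnm1E eqxx subn1.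
  congr (_ * _); apply: eq_bigr => j ji.
  by rewrite mnmBE mnm1E eq_sym (negPf ji) subn0.
have -> : mon (x + h *: 'e_i) m - mon x m - h * dmon i x m =
  P * ((x ord0 i + h) ^+ m i - x ord0 i ^+ m i - (m i)%:R * h * x ord0 i ^+ (m i).-1).
  by rewrite e1 e2 e3; ring.
have hb := @binomial_remainder r (x ord0 i) h (m i) (hx i).
have hr : `|P| <= r ^+ (mdeg m - m i)%N.
  have -> : (mdeg m - m i)%N = (\sum_(j < n | j != i) m j)%N.
    by rewrite mdegE (bigD1 i) //= addKn.
  rewrite -prodrXr /P normr_prod; apply: ler_prod => j _.
  by rewrite normr_ge0 normrX lerXn2r // nnegrE.
rewrite normrM -[leLHS]mulrA.
apply: le_trans (_ : r ^+ (mdeg m - m i) * ((m i)%:R ^+ 2 * `|h| ^+ 2 * r ^+ m i) <= _).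
  by apply: ler_pM => //; [rewrite mulr_ge0 ?exprn_ge0 | apply: hb; rewrite -yi].
rewrite mulrCA -exprD subnK ?lexx //.
by rewrite mdegE (bigD1 i) //= leq_addr.
Qed.

Lemma hsum_dmon rho i c x : conv rho c -> small (rho / 4) x ->
  hsum (fun m => c m * dmon i x m) (psum (fD i c) x).
Proof.
move=> hc hx; apply: (@hsum_reindex K _ _ (fun m => mnm_add m (mnm1 i)) _
  (fun m => fD i c m * mon x m)).
- by move=> m m' /addIm.
- by move=> m; rewrite /dmon /fD mnmDE mnm1E eqxx addn1 /= addmK; ring.
- move=> m hm; rewrite /dmon; case: eqP => [|/eqP mi]; first by rewrite mulr0.
  by have := hm (mnm_sub m (mnm1 i)); rewrite submK ?lep1mP // eqxx.
apply: conv_hsum (conv_fD i hc) _ => j; apply: le_trans (hx j) _.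
by rewrite -mulrA -invfM -natrM.
Qed.

(** The remainders of the monomials are summed. At radius [rho / 8] the factor [(m i)^2], at most
    [4 ^ mdeg m], against [8 ^ mdeg m] leaves powers of 1/2, which [multinom_geom] bounds by
    [2 ^+ n]. *)
Lemma psum_remainder rho C i c x (h : K) : 0 < rho ->
  (forall m, `|c m| * rho ^+ mdeg m <= C) ->
  small (rho / 8) x -> small (rho / 8) (x + h *: 'e_i) ->
  `|psum c (x + h *: 'e_i) - psum c x - h * psum (fD i c) x| * (rho / 8) ^+ 2
     <= C * 2 ^+ n * `|h| ^+ 2.
Proof.
move=> r0 hC hx hy; have hc : conv rho c by split=> //; exists C.
have w2 y : small (rho / 8) y -> small (rho / 2) y.
  move=> h2 j; apply: le_trans (h2 j) _.
  by rewrite ler_wpM2l ?(ltW r0) // lef_pV2 ?posrE // ler_nat.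
have w4 y : small (rho / 8) y -> small (rho / 4) y.
  move=> h2 j; apply: le_trans (h2 j) _.
  by rewrite ler_wpM2l ?(ltW r0) // lef_pV2 ?posrE // ler_nat.
have s1 := conv_hsum hc (w2 _ hy); have s2 := conv_hsum hc (w2 _ hx).
have s3 := hsum_dmon i hc (w4 _ hx).
have s := hsum_lin (- h) s3 (hsum_lin (-1) s2 s1).
have r80 : 0 < rho / 8 by rewrite divr_gt0.
rewrite -ler_pdivlMr ?exprn_gt0 //.
have -> : psum c (x + h *: 'e_i) - psum c x - h * psum (fD i c) x =
  - h * psum (fD i c) x + (-1 * psum c x + psum c (x + h *: 'e_i)) by ring.
apply: hsum_le s _ => A; apply: le_trans (fsum_le_norm _ _) _.
apply: le_trans (_ : fsum (fun m => C * `|h| ^+ 2 / (rho / 8) ^+ 2 * 2^-1 ^+ mdeg m) A <= _); last first.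
  rewrite /fsum -mulr_sumr.
  have -> : C * 2 ^+ n * `|h| ^+ 2 / (rho / 8) ^+ 2 = C * `|h| ^+ 2 / (rho / 8) ^+ 2 * 2 ^+ n.
    by rewrite -!mulrA; congr (_ * _); rewrite mulrC -!mulrA; ring.
  have C0 : 0 <= C by apply: le_trans (hC mnm0); rewrite mulr_ge0 ?exprn_ge0 // ltW.
  rewrite ler_wpM2l ?multinom_geom //; apply: divr_ge0.
    by apply: mulr_ge0 => //; exact: exprn_ge0.
  by apply: exprn_ge0; exact: ltW.
apply: ler_sum => m _.
have -> : - h * (c m * dmon i x m) + (-1 * (c m * mon x m) + c m * mon (x + h *: 'e_i) m)
  = c m * (mon (x + h *: 'e_i) m - mon x m - h * dmon i x m) by ring.
rewrite mulrAC ler_pdivlMr ?exprn_gt0 // normrM -mulrA.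
apply: le_trans (ler_wpM2l (normr_ge0 _) (mon_remainder m hx hy)) _.
have -> : `|c m| * ((m i)%:R ^+ 2 * `|h| ^+ 2 * (rho / 8) ^+ mdeg m) =
   (`|c m| * rho ^+ mdeg m) * `|h| ^+ 2 * ((m i)%:R ^+ 2 * 8^-1 ^+ mdeg m).
  by rewrite exprMn; ring.
have -> : C * `|h| ^+ 2 * 2^-1 ^+ mdeg m = C * `|h| ^+ 2 * (4 ^+ mdeg m * 8^-1 ^+ mdeg m).
  by congr (_ * _); rewrite -exprMn; congr (_ ^+ _); field.
apply: ler_pM.
- by rewrite !mulr_ge0 ?exprn_ge0 // ltW.
- by rewrite mulr_ge0 ?exprn_ge0 ?invr_ge0.
- by rewrite ler_wpM2r ?exprn_ge0.
rewrite ler_wpM2r ?exprn_ge0 ?invr_ge0 // -!natrX ler_nat.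
rewrite -[4%N]/(2 ^ 2)%N -expnM mulnC expnM leq_exp2r //.
apply: leq_trans (ltnW (ltn_expl (m i) (ltnSn 1))) _; rewrite leq_exp2l //.
by rewrite mdegE (bigD1 i) //= leq_addr.
Qed.


Lemma conv_feuler rho (w : 'I_n -> nat) (k : nat) c : conv rho c -> conv rho (feuler_inv w k c).
Proof.
move=> [r0 [C hC]]; split=> //; exists C => m; apply: le_trans (hC m).
rewrite ler_wpM2r ?exprn_ge0 ?(ltW r0) // /feuler_inv normrM ler_piMr //.
by rewrite normfV normr_nat invf_le1 ?ltr0n ?addnS // ler1n.
Qed.

Lemma conv_cst rho (a : K) : 0 < rho -> conv rho (fcst a).
Proof.
move=> r0; split=> //; exists `|a| => m; rewrite /fcst; case: eqP => [->|_].
  by rewrite mdeg0 expr0 mulr1.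
by rewrite normr0 mul0r.
Qed.

End PowerSeries.

(** * The interface for analytic germs *)

Section AnalyticGerms.
Variables (K : numFieldType) (n : nat).
Hypothesis Kc : abs_summable_complete K.
Local Notation V := ('rV[K]_n).
Implicit Types (c : formal_rep K n) (g : fun_rep K n) (x : V) (r rho : K) (i j : 'I_n).

Lemma near_small r : 0 < r -> \forall x \near (0 : V), small r x.
Proof.
move=> r0; apply/nbhs_ballP; exists r => //= x [_ h] i.
by have := h ord0 i; rewrite -ball_normE /ball_ /= mxE sub0r normrN => /ltW.
Qed.

(** Summability at the point whose coordinates all equal [r / 2] bounds the terms there, which is
    the Cauchy estimate of radius [r / 2]. *)
Lemma analyticP g : analytic g <->
  exists rho c, conv rho c /\ \forall x \near (0 : V), g x = psum c x.
Proof.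
split=> [[c hc]|[rho [c [hc e]]]].
  have /nbhs_ballP[r /= r0 hr] := hc.
  have r20 : 0 < r / 2 by rewrite divr_gt0.
  pose a : V := const_mx (r / 2).
  have ba : ball (0 : V) r a.
    split=> // i j; rewrite -ball_normE /ball_ /= !mxE sub0r normrN ger0_norm ?ltW //.
    by rewrite gtr_pMr // invf_lt1 // ltr1n.
  have /hsumP /hsum_bounded [C hC] := hr a ba.
  exists (r / 2), c; split.
    split=> //; exists C => m; apply: le_trans (hC m).
    rewrite normrM; apply: ler_wpM2l => //.
    rewrite normr_prod mdegE -prodrXr; apply: ler_prod => i _.
    by rewrite exprn_ge0 ?(ltW r20) // mxE normrX ger0_norm ?lexx // ltW.
  by apply: filterS hc => x /hsumP /psumE.
exists c; have [r0 _] := hc.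
have r20 : 0 < rho / 2 by rewrite divr_gt0.
near=> x; apply/hsumP; rewrite (near e x) //; apply: (conv_hsum Kc hc).
by near: x; exact: near_small.
Unshelve. all: by end_near. Qed.

Lemma is_derive_psum rho i c : conv rho c ->
  \forall x \near (0 : V), is_derive x 'e_i (psum c : V -> K^o) (psum (fD i c) x).
Proof.
move=> [r0 [C hC]].
(* The coordinates of [x] and the increment are both kept below [rho / 16], hence those of
   [x + h *: 'e_i] below the [rho / 8] of [psum_remainder]. *)
have r16 : 0 < rho / 16 by rewrite divr_gt0.
have r8 : 0 < rho / 8 by rewrite divr_gt0.
apply: filterS (near_small r16) => x hx.
suff cv : (fun h : K => h^-1 *: (((psum c : V -> K^o) \o shift x) (h *: 'e_i)
      - (psum c x : K^o))) @ 0^' --> (psum (fD i c) x : K^o).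
  by apply: DeriveDef; [apply/cvg_ex; eexists; exact: cv | exact: cvg_lim cv].
have C0 : 0 <= C by apply: le_trans (hC mnm0); rewrite mulr_ge0 ?exprn_ge0 // ltW.
(* The quadratic remainder, once divided by [h], is at most [M] times the norm of [h]. *)
pose M := C * 2 ^+ n / (rho / 8) ^+ 2.
have M0 : 0 <= M.
  by apply: divr_ge0; [apply: mulr_ge0 => //; exact: exprn_ge0 | apply: exprn_ge0; exact: ltW].
have M1 : 0 < M + 1 by rewrite ltr_wpDl.
apply/cvgrPdist_le => e e0; near=> h.
have h0 : h != 0 by near: h; exact: nbhs_dnbhs_neq.
have h16 : `|h| <= rho / 16 by near: h; exact: dnbhs0_le.
have he : `|h| <= e / (M + 1) by near: h; apply: dnbhs0_le; rewrite divr_gt0.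
have s1 : small (rho / 8) x.
  move=> j; apply: le_trans (hx j) _.
  by rewrite ler_wpM2l ?(ltW r0) // lef_pV2 ?posrE // ler_nat.
have s2 : small (rho / 8) (x + h *: 'e_i).
  move=> j; rewrite !mxE eqxx /=; apply: le_trans (ler_normD _ _) _.
  have -> : rho / 8 = rho / 16 + rho / 16 by field.
  apply: lerD (hx j) _; rewrite normrM.
  by apply: le_trans h16; case: (j == i); rewrite ?normr1 ?mulr1 ?normr0 ?mulr0.
have := psum_remainder Kc r0 hC s1 s2.
rewrite -ler_pdivlMr ?exprn_gt0 // mulrAC -/M => hrem.
have -> : psum (fD i c) x - h^-1 *: (((psum c : V -> K^o) \o shift x) (h *: 'e_i)
    - (psum c x : K^o)) =
  - (h^-1 * (psum c (x + h *: 'e_i) - psum c x - h * psum (fD i c) x)).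
  rewrite /= [h *: 'e_i + x]addrC.
  by rewrite -[h^-1 *: _]/(h^-1 * (psum c (x + h *: 'e_i) - psum c x)); field.
rewrite normrN normrM normfV ler_pdivrMl ?normr_gt0 //.
apply: le_trans hrem _; rewrite expr2 mulrA mulrC.
rewrite ler_wpM2l //; apply: le_trans (ler_wpM2l M0 he) _.
rewrite mulrCA ler_piMr ?(ltW e0) // ler_pdivrMr // mul1r lerDl //.
Unshelve. all: by end_near. Qed.

Lemma near_all (P : 'I_n -> V -> Prop) : (forall i, \forall x \near (0 : V), P i x) ->
  \forall x \near (0 : V), forall i, P i x.
Proof. by move=> h; apply: (@filter_forall V _ P (nbhs (0 : V)) (nbhs_filter _) h). Qed.

Lemma psum_at0 rho c : conv rho c -> psum c 0 = c mnm0.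
Proof.
move=> hc; have [r0 _] := hc.
have s0 : small (rho / 2) (0 : V) by move=> i; rewrite mxE normr0 ltW // divr_gt0.
apply: psumE.
have -> : c mnm0 = c mnm0 * mon (0 : V) mnm0 by rewrite mon0 mulr1.
apply: (@hsum_single K _ (fun m => c m * mon (0 : V) m) mnm0) => m m0.
have [i mi] : exists i, m i != 0%N.
  apply/existsP; apply: contraNT m0 => /existsPn h; apply/eqP/mnmP => i.
  by rewrite mnm0E; apply/eqP; move: (h i); rewrite negbK.
by rewrite /mon (bigD1 i) //= mxE expr0n (negPf mi) mul0r mulr0.
Qed.

Lemma scale_fcst (a : K) c : a *: c = a *: c + @fcst K n 0.
Proof. by apply/funext => m; rewrite !fctE /fcst if_same addr0. Qed.

Lemma convZ rho (a : K) c : conv rho c -> conv rho (a *: c).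
Proof.
by move=> h; rewrite scale_fcst; apply: conv_lin => //; apply: conv_cst; case: h.
Qed.

Lemma psumZ rho (a : K) c x : conv rho c -> small (rho / 2) x ->
  psum (a *: c) x = a * psum c x.
Proof.
move=> h hx; rewrite scale_fcst (psum_lin Kc _ h _ hx); last by apply: conv_cst; case: h.
by rewrite psum_cst addr0.
Qed.

Lemma psum_sum rho (a0 : K) (c : 'I_n -> formal_rep K n) x : (forall i, conv rho (c i)) ->
  0 < rho -> small (rho / 2) x ->
  conv rho (@fcst K n a0 + \sum_i c i) /\
  psum (@fcst K n a0 + \sum_i c i) x = a0 + \sum_i psum (c i) x.
Proof.
move=> hc r0 hx.
have [h1 h2] : conv rho (\sum_i c i + @fcst K n a0) /\
    psum (\sum_i c i + @fcst K n a0) x = \sum_i psum (c i) x + a0.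
  elim: (index_enum 'I_n) => [|i s [IH1 IH2]].
    by rewrite !big_nil !add0r psum_cst; split=> //; exact: conv_cst.
  rewrite !big_cons -!addrA -[X in X + _]scale1r; split; first exact: conv_lin.
  by rewrite (psum_lin Kc _ (hc i) IH1 hx) mul1r IH2.
by rewrite addrC [a0 + _]addrC.
Qed.

Lemma analytic_germ_axioms :
  @germ_axioms K n (fun_germs (@analytic K n)) (fun g => (g : fun_rep K n) (0 : V)).
Proof.
have cst (a : K) : analytic ((fun=> a) : fun_rep K n).
  apply/analyticP; exists 1, (@fcst K n a); split; first exact: conv_cst.
  by near=> x; rewrite psum_cst.
apply: fun_germ_axioms.
- exact: cst.
- exact: cst.
- move=> a g h /analyticP[r [c [hc ec]]] /analyticP[r' [c' [hc' ec']]].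
  have [r0 _] := hc; have [r0' _] := hc'.
  (* A positive radius below both [r] and [r'], given by a rational expression because the order of
     [K] may be partial. *)
  pose rho := r * r' / (r + r').
  have rr : 0 < r + r' by rewrite addr_gt0.
  have rho0 : 0 < rho by rewrite divr_gt0 ?mulr_gt0.
  have rho20 : 0 < rho / 2 by rewrite divr_gt0.
  have k1 : conv rho c.
    by apply: conv_le hc => //; rewrite ler_pdivrMr // ler_wpM2l ?(ltW r0) // lerDr ltW.
  have k2 : conv rho c'.
    by apply: conv_le hc' => //; rewrite ler_pdivrMr // mulrC ler_wpM2l ?(ltW r0') // lerDl ltW.
  apply/analyticP; exists rho, (a *: c + c'); split; first exact: conv_lin.
  near=> x; rewrite !fctE (near ec x) // (near ec' x) //.
  by rewrite (psum_lin Kc a k1 k2) //; near: x; exact: near_small.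
- move=> i g /analyticP[r [c [hc ec]]]; apply/analyticP.
  exists (r / 2), (fD i c); split; first exact: conv_fD.
  have ec' := nbhs_interior ec; near=> x.
  rewrite (@fun_pd_near K n i g (psum c)); last by near: x; exact: ec'.
  have d : is_derive x 'e_i (psum c : V -> K^o) (psum (fD i c) x).
    by near: x; exact: is_derive_psum hc.
  by case: d.
- move=> j g /analyticP[r [c [hc ec]]]; apply/analyticP.
  have [r0 _] := hc; have r20 : 0 < r / 2 by rewrite divr_gt0.
  exists r, (fX j c); split; first exact: conv_fX.
  near=> x; rewrite (near ec x) // (psum_fX Kc j hc) //.
  by near: x; exact: near_small.
- move=> g /analyticP[r [c [hc ec]]].
  have ec' : \forall x \near (0 : V), \forall y \near x, psum c y = g y.
    by apply: filterS (nbhs_interior ec) => x; apply: filterS => y ->.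
  have hd := near_all (fun i => is_derive_psum i hc).
  near=> x; apply: (@pderivable_near K n (psum c)); first by near: x; exact: ec'.
  move=> i; have d : forall i, is_derive x 'e_i (psum c : V -> K^o) (psum (fD i c) x).
    by near: x; exact: hd.
  by case: (d i).
- move=> g /analyticP[r [c [hc ec]]].
  have [r0 _] := hc; have r20 : 0 < r / 2 by rewrite divr_gt0.
  exists (fun i => psum (fquo i c)) => [i|].
    by apply/analyticP; exists r, (fquo i c); split; [exact: conv_fquo | near=> x].
  have g0 : g (0 : V) = c mnm0 by rewrite (nbhs_singleton ec) (psum_at0 hc).
  near=> x; rewrite (near ec x) // g0.
  have hx : small (r / 2) x by near: x; exact: near_small.
  have := (psum_sum (c mnm0) (fun i => conv_fX i (conv_fquo i hc)) r0 hx).2.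
  have -> : @fcst K n (c mnm0) + \sum_i fX i (fquo i c) = c.
    by apply/funext => m; rewrite [RHS](fhadamard c m) !fctE formal_sumE.
  move=> ->; congr (_ + _); apply: eq_bigr => i _.
  by rewrite (psum_fX Kc i (conv_fquo i hc)).
- move=> w k b hw /analyticP[r [c [hc ec]]].
  have [r0 _] := hc; have r20 : 0 < r / 2 by rewrite divr_gt0.
  (* One half of the radius is lost by [fD], another by evaluating the series. *)
  have r40 : 0 < r / 2 / 2 by rewrite divr_gt0.
  pose q := feuler_inv w k c.
  have hq : conv r q by exact: conv_feuler.
  exists (psum q); first by apply/analyticP; exists r, q; split=> //; near=> x.
  have hd := near_all (fun i => is_derive_psum i hq).
  near=> x; rewrite (near ec x) //.
  have hx : small (r / 2 / 2) x by near: x; exact: near_small.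
  have hx2 : small (r / 2) x by near: x; exact: near_small.
  have pdE i : fun_pd i (psum q) x = psum (fD i q) x.
    have d : forall i, is_derive x 'e_i (psum q : V -> K^o) (psum (fD i q) x).
      by near: x; exact: hd.
    by case: (d i).
  under eq_bigr do rewrite pdE -(psum_fX Kc _ (conv_fD _ hq) hx).
  have qr : conv (r / 2) q.
    by apply: conv_le hq => //; rewrite ler_piMr ?(ltW r0) // invf_le1 // ler1n.
  have cF i : conv (r / 2) (fX i (fD i q)) by apply/conv_fX/conv_fD.
  have cE : c = k.+1%:R *: q + (@fcst K n 0 + \sum_i (w i)%:R *: fX i (fD i q)).
    apply/funext => m; rewrite -[LHS](feulerK w k) !fctE formal_sumE addrC.
    by congr (_ + _); rewrite /fcst if_same add0r.
  have [h1 h2] := psum_sum 0 (fun i => convZ (w i)%:R (cF i)) r20 hx.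
  have psE := congr1 (fun d : formal_rep K n => psum d x) cE.
  rewrite [RHS]psE (psum_lin Kc _ qr h1 hx) h2 add0r addrC.
  congr (_ + _); apply: eq_bigr => i _.
  by rewrite (psumZ _ (cF i) hx).
Unshelve. all: by end_near. Qed.

End AnalyticGerms.

(** * Smooth germs *)

Section UnitIntegral.
Variable R : realType.
Implicit Types (g h : R -> R) (t M : R).

Definition in01 t := 0 <= t <= 1.

(** Continuity on the whole line at each point of the interval, so two-sided at the ends: the
    integrands are defined beyond it. *)
Definition c01 g := forall t, in01 t -> {for t, continuous g}.

Definition int01 g : R := \int[@lebesgue_measure R]_(t in `[0, 1]) g t.

Lemma c01_within g : c01 g -> {within `[0, 1], continuous g}.
Proof.
move=> hg; apply: continuous_in_subspaceT => t; rewrite inE /= in_itv /=.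
exact: hg.
Qed.

Lemma c01_integrable g : c01 g ->
  (@lebesgue_measure R).-integrable `[0, 1] (EFin \o g).
Proof.
move=> hg; apply: continuous_compact_integrable; first exact: segment_compact.
exact: c01_within.
Qed.

Lemma c01_lin (c : R) g h : c01 g -> c01 h -> c01 (fun t => c * g t + h t).
Proof.
move=> hg hh t t01; apply: cvgD; last exact: hh.
by apply: cvgM; [exact: cvg_cst | exact: hg].
Qed.

Lemma int01_lin (c : R) g h : c01 g -> c01 h ->
  int01 (fun t => c * g t + h t) = c * int01 g + int01 h.
Proof.
move=> hg hh; rewrite /int01 RintegralD //=; last first.
- exact: c01_integrable.
- apply: (@c01_integrable (fun t => c * g t)) => t t01.
  by apply: cvgM; [exact: cvg_cst | exact: hg].
by rewrite RintegralZl //; exact: c01_integrable.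
Qed.

Lemma int01_le g M : c01 g -> (forall t, in01 t -> `|g t| <= M) -> `|int01 g| <= M.
Proof.
move=> hg hM; rewrite /int01.
apply: le_trans (le_normr_Rintegral _ (c01_integrable hg)) _ => //.
have <- : \int[@lebesgue_measure R]_(t in `[0, 1]) M = M.
  rewrite Rintegral_cst //.
  rewrite [X in _ * fine X](_ : _ = 1%E) ?mulr1 //.
  have := @lebesgue_measure_itv R `[0, 1].
  by rewrite /= lte_fin ltr01 oppr0 adde0.
apply: le_Rintegral => //.
- apply: (@c01_integrable (fun t => `|g t|)) => t t01.
  by apply: cvg_norm; exact: hg.
- by apply: (@c01_integrable (fun=> M)) => t t01; exact: cvg_cst.
Qed.

Lemma int01_FTC g h : (forall t, in01 t -> is_derive t (1 : R) h (g t)) -> c01 g ->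
  int01 g = h 1 - h 0.
Proof.
move=> hd hg.
have hc t : in01 t -> {for t, continuous h}.
  by move=> /hd[dh _]; exact/differentiable_continuous/derivable1_diffP.
have oo01 t : t \in `]0, 1[ -> in01 t.
  by rewrite in_itv /= => /andP[/ltW t0 /ltW t1]; rewrite /in01 t0.
have dh : derivable_oo_LRcontinuous h 0 1.
  split; first by move=> t /oo01 /hd[].
  - by apply: cvg_at_right_filter; apply: hc; rewrite /in01 lexx ler01.
  - by apply: cvg_at_left_filter; apply: hc; rewrite /in01 lexx ler01.
have e : {in `]0, 1[, (derive1 h) =1 g}.
  by move=> t /oo01 /hd [_]; rewrite derive1E.
have := continuous_FTC2 ltr01 (c01_within hg) dh e.
by rewrite /int01 /Rintegral => ->.
Qed.

End UnitIntegral.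

Section RowNorm.
Variables (R : realType) (n : nat).
Local Notation V := ('rV[R]_n).
Implicit Types (x y : V).

Lemma rv_coord_le x i : `|x ord0 i| <= `|x|.
Proof.
rewrite [leRHS]/Num.Def.normr /= mx_normrE.
exact: (le_bigmax _ (fun ij : 'I_1 * 'I_n => `|x ij.1 ij.2|) (ord0, i)).
Qed.

Lemma rv_norm_le x (M : R) : 0 <= M -> (forall i, `|x ord0 i| <= M) -> `|x| <= M.
Proof.
move=> M0 h; rewrite [leLHS]/Num.Def.normr /= mx_normrE.
by apply: bigmax_le => // -[i j] _ /=; rewrite ord1.
Qed.

Lemma rv_norm_lt x (M : R) : 0 < M -> (forall i, `|x ord0 i| < M) -> `|x| < M.
Proof.
move=> M0 h; rewrite [ltLHS]/Num.Def.normr /= mx_normrE.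
by apply: bigmax_lt => // -[i j] _ /=; rewrite ord1.
Qed.

Lemma rv_cvg (T : Type) (F : set_system T) (FF : Filter F) (u : T -> V) x :
  (forall i, (fun a => u a ord0 i) @ F --> x ord0 i) -> u @ F --> x.
Proof.
move=> h; apply/cvgrPdist_lt => e e0.
have : \forall a \near F, forall i, `|x ord0 i - u a ord0 i| < e.
  by apply: filter_forall => i; have /cvgrPdist_lt := h i; exact.
by apply: filterS => a ha; apply: rv_norm_lt => // i; rewrite !mxE.
Qed.

End RowNorm.

(** * Chain rule from continuous partial derivatives *)

Section ChainRule.
Variables (R : realType) (n : nat).
Local Notation V := ('rV[R]_n).
Implicit Types (g : fun_rep R n) (p x y : V).

Lemma is_derive_line g p (v : V) (s : R) : derivable (g : V -> R^o) (p + s *: v) v ->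
  is_derive s (1 : R) (fun u => g (p + u *: v) : R^o) ('D_v (g : V -> R^o) (p + s *: v)).
Proof.
have E : (fun h : R => h^-1 *: (((fun u : R => g (p + u *: v) : R^o) \o shift s) (h *: 1)
       - (g (p + s *: v) : R^o)))
   = (fun h : R => h^-1 *: (((g : V -> R^o) \o shift (p + s *: v)) (h *: v)
       - (g (p + s *: v) : R^o))).
  apply/funext => h /=; congr (_ *: (g _ - _)).
  by rewrite [h *: 1]mulr1 scalerDl addrCA.
by move=> d; apply: DeriveDef; rewrite /derivable /derive E.
Qed.

Lemma pd_MVT g i p (h : R) :
  (forall s : R, `|s| <= `|h| -> derivable (g : V -> R^o) (p + s *: 'e_i) 'e_i) ->
  exists2 s : R, `|s| <= `|h|
    & g (p + h *: 'e_i) - g p = h * fun_pd i g (p + s *: 'e_i).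
Proof.
move=> hd.
pose f (u : R) := g (p + u *: 'e_i) : R.
pose df (u : R) := fun_pd i g (p + u *: 'e_i) : R.
have f0 : f 0 = g p by rewrite /f scale0r addr0.
have dd s : `|s| <= `|h| -> is_derive s (1 : R) f (df s).
  by move=> sh; exact: is_derive_line (hd _ sh).
have key a b : a <= b -> (forall s, a <= s <= b -> `|s| <= `|h|) ->
    exists2 s, `|s| <= `|h| & f b - f a = df s * (b - a).
  move=> ab hab.
  have [||c cab e] := @MVT_segment R f df a b ab.
  - move=> s; rewrite in_itv /= => /andP[/ltW s1 /ltW s2].
    by apply/dd/hab; rewrite s1.
  - apply: continuous_in_subspaceT => s; rewrite inE /= in_itv /= => sab.
    have [ds _] := dd _ (hab _ sab).
    exact/differentiable_continuous/derivable1_diffP.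
  - by exists c => //; apply: hab; move: cab; rewrite in_itv.
rewrite -f0 -/(f h); have [h0|h0] := leP 0 h.
  have [|s sh e] := key _ _ h0.
    by move=> s /andP[s0 sh]; rewrite !ger0_norm // (le_trans s0).
  by exists s => //; rewrite e subr0 mulrC.
have [|s sh e] := key _ _ (ltW h0).
  by move=> s /andP[hs s0]; rewrite !ler0_norm // ?lerN2 // ltW.
by exists s => //; rewrite -opprB e sub0r mulrN opprK mulrC.
Qed.

(** Only partial derivatives are at hand, so the coordinates are moved one at a time. Each move is a
    mean value along an axis, at a point that tends to [y t0], where the partial derivatives are
    continuous. *)
Lemma chain_rule g (y : R -> V) (y' : 'I_n -> R) (t0 : R) :
  (\forall p \near y t0, pderivable g p) ->
  (forall i, {for y t0, continuous (fun_pd i g : V -> R^o)}) ->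
  (forall i, is_derive t0 (1 : R) (fun t => y t ord0 i : R^o) (y' i)) ->
  is_derive t0 (1 : R) (fun t => g (y t) : R^o) (\sum_i y' i * fun_pd i g (y t0)).
Proof.
move=> /nbhs_ballP[rho /= rho0 hrho] hc hy.
(* Only the coordinates listed in [s] have moved. *)
pose ys (s : seq 'I_n) (t : R) : V := \row_i (if i \in s then y t ord0 i else y t0 ord0 i).
have cy i : (fun h : R => y (h + t0) ord0 i) @ 0^' --> y t0 ord0 i.
  have [dy _] := hy i.
  have : {for t0, continuous (fun t => y t ord0 i)}.
    exact/differentiable_continuous/derivable1_diffP.
  by move=> /continuous_withinNshiftx.
have qy i : (fun h : R => h^-1 * (y (h + t0) ord0 i - y t0 ord0 i)) @ 0^' --> y' i.
  have E : (fun h : R => h^-1 *: (((fun t => y t ord0 i : R^o) \o shift t0) (h *: 1)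
      - (y t0 ord0 i : R^o))) = (fun h : R => h^-1 * (y (h + t0) ord0 i - y t0 ord0 i)).
    by apply/funext => h /=; rewrite [h *: 1]mulr1.
  by have [dy <-] := hy i; move: dy; rewrite /derivable /derive E; exact.
suff H s : uniq s -> (fun h : R => h^-1 *: (g (ys s (h + t0)) - g (y t0) : R^o)) @ 0^' -->
    (\sum_(i <- s) y' i * fun_pd i g (y t0) : R^o).
  have := H _ (index_enum_uniq 'I_n).
  have E : (fun h : R => h^-1 *: (g (ys (index_enum 'I_n) (h + t0)) - g (y t0) : R^o))
    = (fun h : R => h^-1 *: (((fun t => g (y t) : R^o) \o shift t0) (h *: 1) - (g (y t0) : R^o))).
    apply/funext => h /=; rewrite [h *: 1]mulr1; congr (_ *: (g _ - _)).
    by apply/rowP => i; rewrite mxE mem_index_enum.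
  rewrite E => c; apply: DeriveDef; last exact: cvg_lim c.
  by apply/cvg_ex; eexists; exact: c.
elim: s => [_|j s IH /= /andP[js us]].
  rewrite big_nil; apply: cvg_near_cst; near=> h.
  have -> : ys [::] (h + t0) = y t0 by apply/rowP => i; rewrite mxE.
  by rewrite subrr scaler0.
pose dlt (h : R) (i : 'I_n) := y (h + t0) ord0 i - y t0 ord0 i.
have ysE h : ys (j :: s) (h + t0) = ys s (h + t0) + dlt h j *: 'e_j.
  apply/rowP => i; rewrite !mxE inE eqxx /=.
  have [->|ij] := eqVneq i j; last by rewrite mulr0 addr0.
  by rewrite (negPf js) mulr1 /dlt addrC subrK.
(* The mean value point for each [h]; when some increment is not below [rho] it takes the arbitrary
   value 0. *)
have /choice [xi hxi] : forall h : R, exists x : V, (forall i, `|dlt h i| < rho) ->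
   g (ys (j :: s) (h + t0)) - g (ys s (h + t0)) = dlt h j * fun_pd j g x
   /\ forall i, `|x ord0 i - y t0 ord0 i| <= `|dlt h i|.
  move=> h.
  have [hr|] := pselect (forall i, `|dlt h i| < rho); last by exists 0.
  have bd u : `|u| <= `|dlt h j| ->
     forall i, `|(ys s (h + t0) + u *: 'e_j) ord0 i - y t0 ord0 i| <= `|dlt h i|.
    move=> hu i; rewrite !mxE eqxx /=; have [->|ij] := eqVneq i j.
      by rewrite (negPf js) mulr1 addrC addKr.
    by rewrite mulr0 addr0; case: ifP => // _; rewrite subrr normr0.
  have [u hu|u hu e] := @pd_MVT g j (ys s (h + t0)) (dlt h j).
    apply: hrho; rewrite -ball_normE /ball_ /= distrC.
    by apply: rv_norm_lt => // i; rewrite mxE [X in _ + X]mxE; exact: le_lt_trans (bd _ hu i) (hr i).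
  by exists (ys s (h + t0) + u *: 'e_j) => _; rewrite ysE e; split=> //; exact: bd.
have near_dlt : \forall h \near (0 : R)^', forall i, `|dlt h i| < rho.
  apply: filter_forall => i; have /cvgrPdist_lt /(_ _ rho0) := cy i.
  by apply: filterS => h; rewrite distrC.
have cxi : xi @ 0^' --> y t0.
  apply: rv_cvg => i; apply/cvgrPdist_lt => e e0.
  have /cvgrPdist_lt /(_ _ e0) c := cy i; near=> h.
  have [|_ /(_ i)] := hxi h; first by near: h.
  rewrite distrC => /le_lt_trans; apply; rewrite /dlt distrC; near: h; exact: c.
have cpd : (fun h => fun_pd j g (xi h)) @ 0^' --> fun_pd j g (y t0).
  exact: (cvg_comp _ _ cxi (hc j)).
rewrite big_cons addrC.
apply: cvg_trans; last exact: (cvgD (IH us) (cvgM (qy j) cpd)).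
apply: near_eq_cvg; near=> h.
have [|e _] := hxi h; first by near: h.
rewrite !fctE /= -[g (ys (j :: s) _)](subrK (g (ys s (h + t0)))) e.
by rewrite -/(dlt h j) -addrA [RHS]scalerDr addrC -mulrA.
Unshelve. all: by end_near. Qed.

End ChainRule.

(** * Smoothness on an open set *)

Section SmoothOn.
Variables (K : numFieldType) (n : nat).
Local Notation V := ('rV[K]_n).
Implicit Types (g h : fun_rep K n) (U : set V).

Definition smooth_on U g := forall x, U x -> forall s : seq 'I_n,
  {for x, continuous (iter_pd s g : V -> K^o)} /\ pderivable (iter_pd s g) x.

Lemma iter_pd_eq U g h : open U -> (forall x, U x -> g x = h x) ->
  forall s x, U x -> iter_pd s g x = iter_pd s h x.
Proof.
move=> oU gh; elim=> [//|i s IH] x Ux /=.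
by apply: fun_pd_near; near=> y; apply: IH; near: y; exact: open_nbhs_nbhs.
Unshelve. all: by end_near. Qed.

(* Coinduction: it is enough to find a class of functions stable, up to
   equality on [U], under partial derivatives. *)
Lemma smooth_on_coind U (P : fun_rep K n -> Prop) : open U ->
  (forall g, P g -> forall x, U x -> {for x, continuous (g : V -> K^o)} /\ pderivable g x) ->
  (forall g i, P g -> exists2 h, P h & forall x, U x -> fun_pd i g x = h x) ->
  forall g, P g -> smooth_on U g.
Proof.
move=> oU Pc Pd g Pg x Ux s.
have [h Ph gh] : exists2 h, P h & forall x, U x -> iter_pd s g x = h x.
  elim: s => [|i s [h Ph gh]] /=; first by exists g.
  have [h' Ph' hh'] := Pd h i Ph; exists h' => // z Uz; rewrite -hh' //.
  exact: (iter_pd_eq oU gh [:: i]).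
have e : \forall y \near x, h y = iter_pd s g y.
  by near=> y; rewrite gh //; near: y; exact: open_nbhs_nbhs.
have [ch dh] := Pc h Ph x Ux; split; last exact: pderivable_near dh.
suff : (iter_pd s g : V -> K^o) @ x --> (iter_pd s g x : K^o) by [].
by rewrite gh //; exact: (cvg_trans (near_eq_cvg e) ch).
Unshelve. all: by end_near. Qed.

Lemma smooth_on_pd U g i : smooth_on U g -> smooth_on U (fun_pd i g).
Proof.
move=> h x Ux s; have := h x Ux (rcons s i).
by rewrite /iter_pd foldr_rcons.
Qed.

Lemma smooth_onP U g x : smooth_on U g -> U x ->
  {for x, continuous (g : V -> K^o)} /\ pderivable g x.
Proof. by move=> h Ux; exact: (h x Ux [::]). Qed.

Lemma smooth_on_lin U (c : K) g h : open U -> smooth_on U g -> smooth_on U h ->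
  smooth_on U (c *: g + h).
Proof.
move=> oU hg hh; pose P f := exists a b,
  [/\ smooth_on U a, smooth_on U b & f = c *: a + b].
apply: (@smooth_on_coind U P oU); last by exists g, h.
- move=> _ [a [b [sa sb ->]]] x Ux.
  have [ca da] := smooth_onP sa Ux; have [cb db] := smooth_onP sb Ux.
  split; last exact: pderivable_lin.
  exact: (cvgD (cvgZl_tmp ca) cb).
- move=> _ i [a [b [sa sb ->]]]; exists (c *: fun_pd i a + fun_pd i b).
    by exists (fun_pd i a), (fun_pd i b); split; [exact: smooth_on_pd | exact: smooth_on_pd |].
  move=> x Ux; rewrite fun_pd_lin //.
    by have [] := smooth_onP sa Ux.
  by have [] := smooth_onP sb Ux.
Qed.

Lemma smooth_on_cst U (c : K) : open U -> smooth_on U (fun=> c).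
Proof.
move=> oU; pose P f := exists d : K, f = (fun=> d) :> fun_rep K n.
apply: (@smooth_on_coind U P oU); last by exists c.
  by move=> _ [d ->] x Ux; split; [exact: cst_continuous | move=> i; exact: derivable_cst].
move=> _ i [d ->]; exists (fun=> 0); first by exists 0.
by move=> x Ux; exact: derive_cst.
Qed.

(** The products [x_j b] alone are not stable under derivatives, but the functions [a + x_j b] are:
    differentiating moves a multiple of [b] into [a]. *)
Lemma smooth_on_mulX U j g : open U -> smooth_on U g ->
  smooth_on U (fun y => (y : V) ord0 j * g y : K^o).
Proof.
move=> oU hg; pose P f := exists a b,
  [/\ smooth_on U a, smooth_on U b & f = (fun y => a y + (y : V) ord0 j * b y : K^o)].
have mX b x : smooth_on U b -> U x ->
    {for x, continuous (fun y => (y : V) ord0 j * b y : K^o)} /\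
    pderivable (fun y => (y : V) ord0 j * b y : K^o) x.
  move=> sb Ux; have [cb db] := smooth_onP sb Ux; split; last exact: pderivable_mulX.
  exact: (cvgM (@coord_continuous _ _ _ ord0 j x) cb).
apply: (@smooth_on_coind U P oU).
- move=> _ [a [b [sa sb ->]]] x Ux.
  have [ca da] := smooth_onP sa Ux; have [cb db] := mX b x sb Ux.
  by split; [exact: (cvgD ca cb) | move=> i; exact: derivableD].
- move=> _ i [a [b [sa sb ->]]].
  exists (fun y => ((i == j)%:R *: b + fun_pd i a : fun_rep K n) y
              + (y : V) ord0 j * fun_pd i b y : K^o).
    exists ((i == j)%:R *: b + fun_pd i a), (fun_pd i b).
    split; [|exact: smooth_on_pd | by []].
    by apply: smooth_on_lin; [exact: oU | exact: sb | exact: smooth_on_pd].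
  move=> x Ux.
  have [ca da] := smooth_onP sa Ux; have [cb db] := smooth_onP sb Ux.
  have := @fun_pd_lin _ _ i 1 _ _ _ da (@pderivable_mulX _ _ j _ _ db).
  rewrite !scale1r [X in _ = _ + X](@fun_pd_mulX _ _ i j _ _ db) => e.
  rewrite [LHS]e addrA; congr (_ + _); exact: addrC.
- exists (fun=> 0), g; split; [exact: smooth_on_cst | exact: hg |].
  by apply/funext => x; rewrite add0r.
Qed.

End SmoothOn.

(** * Integrals along weighted dilations *)

Section Dilation.
Variables (R : realType) (n : nat).
Local Notation V := ('rV[R]_n).
Implicit Types (g b : fun_rep R n) (v : 'I_n -> nat) (t : R) (x : V).

Definition dil v t x : V := \row_i (t ^+ v i * x ord0 i).

(** With free [v] and [k] this family is closed under derivatives: differentiating in direction [i]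
    replaces [b] by [fun_pd i b] and adds [v i] to [k]. All weights 1 and [k = 0] give Hadamard's
    cofactors, [v = w] gives the solution of the Euler equation. *)
Definition dil_int v (k : nat) b : fun_rep R n :=
  fun x => int01 (fun t => t ^+ k * b (dil v t x)).

Definition box (r : R) : set V := [set x | `|x| < r].

Lemma open_box r : open (box r).
Proof.
rewrite -[box r]/((fun x : V => `|x|) @^-1` [set y | y < r]).
by apply: open_comp; [move=> x _; exact: norm_continuous | exact: open_lt].
Qed.

Lemma dil_norm v t x : in01 t -> `|dil v t x| <= `|x|.
Proof.
move=> /andP[t0 t1]; apply: rv_norm_le => // i; rewrite mxE normrM.
rewrite -[leRHS]mul1r; apply: ler_pM => //; last exact: rv_coord_le.
by rewrite ger0_norm ?exprn_ge0 // exprn_ile1.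
Qed.

Lemma box_dil r v t x : in01 t -> box r x -> box r (dil v t x).
Proof. by move=> t01; apply: le_lt_trans; exact: dil_norm. Qed.

Lemma continuous_exprn (k : nat) : continuous (fun t : R => t ^+ k).
Proof.
by move=> t; exact/differentiable_continuous/derivable1_diffP/exprn_derivable.
Qed.

Lemma continuous_dil v x : continuous (fun t => dil v t x).
Proof.
move=> t; apply: rv_cvg => i; rewrite mxE.
under [X in X @ _ --> _]eq_fun do rewrite mxE.
by apply: cvgM; [exact: continuous_exprn | exact: cvg_cst].
Qed.

Lemma c01_dil r v k b x : smooth_on (box r) b -> box r x ->
  c01 (fun t => t ^+ k * b (dil v t x)).
Proof.
move=> sb bx t t01; apply: cvgM; first exact: continuous_exprn.
have [cb _] := smooth_onP sb (box_dil v t01 bx).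
exact: (cvg_comp _ _ (@continuous_dil v x t) cb).
Qed.

(** Compactness of [[0, 1]] provides one [d] for all [t]. This uniformity stands in for dominated
    convergence when passing to the limit under the integral. *)
Lemma dil_tube r v b x (e : R) : smooth_on (box r) b -> box r x -> 0 < e ->
  exists2 d, 0 < d & forall z, `|z| < d -> forall t, in01 t ->
    `|b (dil v t x + z) - b (dil v t x)| < e.
Proof.
move=> sb bx e0.
suff /nbhs_ballP[d /= d0 hd] : nbhs (0 : V) (fun z => forall t, in01 t ->
    `|b (dil v t x + z) - b (dil v t x)| < e).
  by exists d => // z zd; apply: hd; rewrite -ball_normE /ball_ /= sub0r normrN.
have cpt := (compact_near_coveringP `[(0 : R), 1]).1 (@segment_compact R 0 1).
suff : \forall z \near (0 : V), `[(0 : R), 1] `<=`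
    (fun t => `|b (dil v t x + z) - b (dil v t x)| < e).
  by apply: filterS => z hz t t01; apply: hz; rewrite /= in_itv.
apply: (cpt V (nbhs (0 : V)) (fun z t => `|b (dil v t x + z) - b (dil v t x)| < e)).
move=> t0; rewrite /= in_itv /= => t01.
have [cb _] := smooth_onP sb (box_dil v t01 bx).
have e2 : 0 < e / 2 by rewrite divr_gt0.
have /nbhs_ballP[d /= d0 hd] :
    nbhs (dil v t0 x) (fun q => `|b (dil v t0 x) - b q| < e / 2).
  by move/cvgrPdist_lt: cb; exact.
have d2 : 0 < d / 2 by rewrite divr_gt0.
exists ([set t | `|dil v t0 x - dil v t x| < d / 2], [set z : V | `|z| < d / 2]).
  split => /=.
    by have /cvgrPdist_lt := @continuous_dil v x t0; exact.
  apply/nbhs_ballP; exists (d / 2) => // z.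
  by rewrite -ball_normE /ball_ /= sub0r normrN.
move=> [t z] [/= ht hz].
have h1 : `|b (dil v t0 x) - b (dil v t x)| < e / 2.
  apply: hd; rewrite -ball_normE /ball_ /=; apply: lt_le_trans ht _.
  by rewrite ler_pdivrMr // ler_peMr ?ler1n // ltW.
have h2 : `|b (dil v t0 x) - b (dil v t x + z)| < e / 2.
  apply: hd; rewrite -ball_normE /ball_ /= opprD addrA.
  apply: le_lt_trans (ler_normB _ _) _.
  by rewrite [d](splitr d) ltrD.
rewrite -(subrK (b (dil v t0 x)) (b (dil v t x + z))) -addrA.
by apply: le_lt_trans (ler_normD _ _) _; rewrite distrC [e](splitr e) ltrD.
Qed.


Lemma dilD v t x y : dil v t (x + y) = dil v t x + dil v t y.
Proof. by apply/rowP => i; rewrite !mxE mulrDr. Qed.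

Lemma dil_int_continuous r v k b x : smooth_on (box r) b -> box r x ->
  {for x, continuous (dil_int v k b : V -> R^o)}.
Proof.
move=> sb bx.
suff : (dil_int v k b : V -> R^o) @ x --> (dil_int v k b x : R^o) by [].
apply/(@cvgrPdist_le _ _ _ (nbhs x) (nbhs_filter x)) => e e0.
have [d d0 hd] := dil_tube v sb bx e0.
near=> y.
have by_ : box r y by near: y; apply: open_nbhs_nbhs; split=> //; exact: open_box.
have yx : `|y - x| < d by rewrite distrC; near: y; exact: cvgr_dist_lt.
rewrite distrC /dil_int.
rewrite -[int01 (fun t => _ * b (dil v t y))]addr0 addr0 addrC -mulN1r.
rewrite -int01_lin; [|exact: c01_dil sb _..].
apply: int01_le.
  by apply: c01_lin; exact: c01_dil sb _.
move=> t t01; rewrite mulN1r addrC -mulrBr normrM.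
rewrite -[e]mul1r; apply: ler_pM => //.
  have /andP[t0 t1] := t01; rewrite ger0_norm ?exprn_ge0 //; exact: exprn_ile1.
have -> : dil v t y = dil v t x + dil v t (y - x) by rewrite -dilD addrC subrK.
by apply/ltW/hd => //; exact: le_lt_trans (dil_norm _ _ t01) _.
Unshelve. all: by end_near. Qed.

(** Moving [x] by [h] along an axis moves its dilation by [t ^+ v i * h], whence the new exponent.
    By the mean value theorem the error integrand is an increment of [fun_pd i b] over a distance at
    most that of [h], bounded for all [t] by [dil_tube]. The intermediate point depends on [t], but
    enters only this pointwise bound. *)
Lemma is_derive_dil_int r v k b i x : smooth_on (box r) b -> box r x ->
  is_derive x 'e_i (dil_int v k b : V -> R^o) (dil_int v (k + v i) (fun_pd i b) x).
Proof.
move=> sb bx.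
have sd := smooth_on_pd i sb.
suff c : (fun h : R => h^-1 *: (((dil_int v k b : V -> R^o) \o shift x) (h *: 'e_i)
      - (dil_int v k b x : R^o))) @ 0^' --> (dil_int v (k + v i) (fun_pd i b) x : R^o).
  by apply: DeriveDef; [apply/cvg_ex; eexists; exact: c | exact: cvg_lim c].
apply/cvgrPdist_le => e e0.
have [d d0 hd] := dil_tube v sd bx e0.
have ei (u : R) : `|u *: ('e_i : V)| <= `|u|.
  apply: rv_norm_le => // j; rewrite !mxE eqxx /= normrM.
  by case: eqP; rewrite ?normr1 ?mulr1 ?normr0 ?mulr0.
near=> h.
have h0 : h != 0 by near: h; exact: nbhs_dnbhs_neq.
have hdh : `|h| < d by near: h; exact: dnbhs0_lt.
have hr : `|h| < r - `|x| by near: h; apply: dnbhs0_lt; rewrite subr_gt0.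
have box_line y u : `|y| <= `|x| -> `|u| <= `|h| -> box r (y + u *: 'e_i).
  move=> yx uh; apply: le_lt_trans (ler_normD _ _) _.
  by rewrite -(subrK `|x| r) addrC ltr_leD //; apply: le_lt_trans hr; apply: le_trans (ei u) uh.
have bh : box r (h *: 'e_i + x) by rewrite addrC; exact: box_line.
rewrite /= [h^-1 *: _]mulrBr opprB addrA.
have c1 := @c01_dil r v (k + v i) _ x sd bx.
have c2 := @c01_dil r v k _ x sb bx.
have c3 := @c01_dil r v k _ _ sb bh.
have -> : dil_int v (k + v i) (fun_pd i b) x + h^-1 * dil_int v k b x
      - h^-1 * dil_int v k b (h *: 'e_i + x)
  = int01 (fun t => - h^-1 * (t ^+ k * b (dil v t (h *: 'e_i + x)))
      + (h^-1 * (t ^+ k * b (dil v t x)) + t ^+ (k + v i) * fun_pd i b (dil v t x))).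
  rewrite (int01_lin _ c3) ?(int01_lin _ c2 c1) //; last exact: c01_lin.
  by rewrite addrC mulNr [X in _ + X]addrC.
apply: int01_le; first by apply: c01_lin => //; exact: c01_lin.
move=> t t01; have /andP[t0 t1] := t01.
have dE : dil v t (h *: 'e_i + x) = dil v t x + (t ^+ v i * h) *: 'e_i.
  apply/rowP => j; rewrite !mxE eqxx /= mulrDr addrC; congr (_ + _).
  by case: eqP => [->|]; rewrite ?mulr1 ?mulr0 // mulrA.
have tv : `|t ^+ v i * h| <= `|h|.
  by rewrite normrM ler_piMl // ger0_norm ?exprn_ge0 // exprn_ile1.
have [|s sh es] := @pd_MVT R n b i (dil v t x) (t ^+ v i * h).
  move=> s sh; apply: (smooth_onP sb _).2; apply: box_line.
    exact: dil_norm.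
  exact: le_trans sh tv.
have -> : - h^-1 * (t ^+ k * b (dil v t (h *: 'e_i + x)))
      + (h^-1 * (t ^+ k * b (dil v t x)) + t ^+ (k + v i) * fun_pd i b (dil v t x))
  = t ^+ (k + v i) * (fun_pd i b (dil v t x) - fun_pd i b (dil v t x + s *: 'e_i)).
  have -> : b (dil v t (h *: 'e_i + x)) =
      t ^+ v i * h * fun_pd i b (dil v t x + s *: 'e_i) + b (dil v t x).
    by rewrite -es dE subrK.
  by rewrite exprD; field.
rewrite normrM -[e]mul1r; apply: ler_pM => //.
  by rewrite ger0_norm ?exprn_ge0 // exprn_ile1.
rewrite distrC; apply/ltW/hd => //.
by apply: le_lt_trans (ei s) _; apply: le_lt_trans sh _; apply: le_lt_trans tv _.
Unshelve. all: by end_near. Qed.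

End Dilation.

(** * Hadamard's lemma and the Euler equation for smooth germs *)

Section SmoothGerms.
Variables (R : realType) (n : nat).
Local Notation V := ('rV[R]_n).
Implicit Types (g b : fun_rep R n) (v : 'I_n -> nat) (t r : R) (x : V).

Lemma fun_pd_dil_int r v k b i x : smooth_on (box r) b -> box r x ->
  fun_pd i (dil_int v k b) x = dil_int v (k + v i) (fun_pd i b) x.
Proof. by move=> sb bx; have [_] := is_derive_dil_int v k i sb bx. Qed.

Lemma smooth_on_dil_int r v k b : smooth_on (box r) b ->
  smooth_on (box r) (dil_int v k b).
Proof.
move=> sb; pose P f := exists l c, smooth_on (box r) c /\ f = dil_int v l c.
apply: (@smooth_on_coind _ _ (box r) P (@open_box R n r)); last by exists k, b.
- move=> _ [l [c [sc ->]]] x bx; split; first exact: dil_int_continuous sc bx.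
  by move=> i; have [] := is_derive_dil_int v l i sc bx.
- move=> _ i [l [c [sc ->]]]; exists (dil_int v (l + v i) (fun_pd i c)).
    by exists (l + v i)%N, (fun_pd i c); split; [exact: smooth_on_pd |].
  by move=> x; exact: fun_pd_dil_int.
Qed.

Lemma int01_sum (I : Type) (s : seq I) (c : I -> R) (F : I -> R -> R) (h : R -> R) (a : R) :
  (forall i, c01 (F i)) -> c01 h ->
  c01 (fun t => a * h t + \sum_(i <- s) c i * F i t) /\
  int01 (fun t => a * h t + \sum_(i <- s) c i * F i t)
    = a * int01 h + \sum_(i <- s) c i * int01 (F i).
Proof.
move=> hF hh; elim: s => [|i s [IHc IH]].
  have z : c01 (fun=> 0 : R) by move=> t _; exact: cst_continuous.
  have z0 : int01 (fun=> 0 : R) = 0.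
    have := int01_lin (-1) z z.
    by rewrite mulr0 addr0 mulN1r addNr.
  split.
    rewrite (_ : (fun t => _) = (fun t => a * h t + 0)); first exact: c01_lin hh z.
    by apply/funext => t; rewrite big_nil.
  rewrite (_ : (fun t => _) = (fun t => a * h t + 0)); first by rewrite int01_lin // z0 big_nil.
  by apply/funext => t; rewrite big_nil.
have E : (fun t => a * h t + \sum_(j <- i :: s) c j * F j t) =
    (fun t => c i * F i t + (a * h t + \sum_(j <- s) c j * F j t)).
  by apply/funext => t; rewrite big_cons addrCA.
by rewrite E big_cons addrCA -IH; split; [exact: c01_lin | exact: int01_lin].
Qed.

Lemma is_derive_exprn (k : nat) t :
  is_derive t (1 : R) (fun t => t ^+ k : R^o) (k%:R * t ^+ k.-1).
Proof.
by apply: DeriveDef; [exact: exprn_derivable | rewrite exp_derive [LHS]mulr1].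
Qed.

Lemma is_derive_dil r v b x t : smooth_on (box r) b -> box r x -> in01 t ->
  is_derive t (1 : R) (fun t => b (dil v t x) : R^o)
    (\sum_i ((v i)%:R * t ^+ (v i).-1 * x ord0 i) * fun_pd i b (dil v t x)).
Proof.
move=> sb bx t01; have bt := box_dil v t01 bx.
apply: (@chain_rule R n b (fun t => dil v t x) (fun i => (v i)%:R * t ^+ (v i).-1 * x ord0 i)).
- near=> p; apply: (smooth_onP sb _).2; near: p.
  by apply: open_nbhs_nbhs; split=> //; exact: open_box.
- by move=> i; exact: (smooth_onP (smooth_on_pd i sb) bt).1.
- move=> i; under eq_fun do rewrite mxE.
  have d := is_deriveM (is_derive_exprn (v i) t) (is_derive_cst (x ord0 i : R^o) t 1).
  by refine (is_derive_eq d _); rewrite scaler0 add0r [LHS]mulrC.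
Unshelve. all: by end_near. Qed.

Lemma dil0 v x : (forall i, 0 < v i)%N -> dil v 0 x = 0.
Proof. by move=> hv; apply/rowP => i; rewrite !mxE expr0n -(prednK (hv i)) mul0r. Qed.

Lemma dil1 v x : dil v 1 x = x.
Proof. by apply/rowP => i; rewrite !mxE expr1n mul1r. Qed.

(** Integrate the derivative of [b (t x)] in [t] from 0 to 1. *)
Lemma hadamard_dil r b x : smooth_on (box r) b -> box r x ->
  b x = b (0 : V) + \sum_i x ord0 i * dil_int (fun=> 1) 0 (fun_pd i b) x :> R.
Proof.
move=> sb bx.
have hF i : c01 (fun t => t ^+ 0 * fun_pd i b (dil (fun=> 1%N) t x)).
  exact: c01_dil (smooth_on_pd i sb) bx.
have z : c01 (fun=> 0 : R) by move=> t _; exact: cst_continuous.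
have [hc he] := int01_sum (index_enum 'I_n) (fun i => x ord0 i) 0 hF z.
rewrite [X in _ = X + _]mul0r add0r in he.
have := int01_FTC (h := fun t => b (dil (fun=> 1%N) t x)) _ hc.
rewrite he dil1 dil0 // => e; rewrite [X in _ + X]e; first by rewrite addrC subrK.
move=> t t01; have d := is_derive_dil (fun=> 1%N) sb bx t01.
refine (is_derive_eq d _); rewrite /= mul0r add0r; apply: eq_bigr => i _ /=.
by rewrite expr0 !mul1r.
Qed.

(** Integrate the derivative of [t ^+ k.+1 * b (dil w t x)] from 0 to 1: the boundary term at 0
    vanishes thanks to the positive exponent, the one at 1 is [b x]. *)
Lemma euler_dil r (w : 'I_n -> nat) (k : nat) b x : (forall i, 0 < w i)%N ->
  smooth_on (box r) b -> box r x ->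
  \sum_(i < n) (w i)%:R * (x ord0 i * fun_pd i (dil_int w k b) x)
    + k.+1%:R * dil_int w k b x = b x :> R.
Proof.
move=> hw sb bx.
have hF i : c01 (fun t => t ^+ (k + w i) * fun_pd i b (dil w t x)).
  exact: c01_dil (smooth_on_pd i sb) bx.
have hh : c01 (fun t => t ^+ k * b (dil w t x)) by exact: c01_dil sb bx.
have [hc he] := int01_sum (index_enum 'I_n) (fun i => (w i)%:R * x ord0 i) k.+1%:R hF hh.
have := int01_FTC (h := fun t => t ^+ k.+1 * b (dil w t x)) _ hc.
rewrite he dil1 expr1n mul1r expr0n mul0r subr0 => e; rewrite -[RHS]e.
  rewrite addrC; congr (_ + _); apply: eq_bigr => i _.
  by rewrite (fun_pd_dil_int _ _ _ sb bx) mulrA.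
move=> t t01; have db := is_derive_dil w sb bx t01.
have d := is_deriveM (is_derive_exprn k.+1 t) db.
refine (is_derive_eq d _); rewrite /= addrC; congr (_ + _).
  by rewrite [LHS]mulrC mulrA.
rewrite [LHS]mulr_sumr; apply: eq_bigr => i _ /=.
(* Positivity of [w i] allows one factor [t] to be shifted from the power of the dilation to
   [t ^+ k]. *)
have -> : t ^+ (k + w i) = t * t ^+ k * t ^+ (w i).-1.
  by rewrite -{1}(prednK (hw i)) addnS exprS exprD mulrA.
rewrite exprS; ring.
Qed.

Lemma smoothP g : smooth g <-> exists2 r, 0 < r & smooth_on (box r) g.
Proof.
split=> [|[r r0 sg]].
  move=> /nbhs_ballP[r /= r0 h]; exists r => // x bx s; apply: h.
  by rewrite -ball_normE /ball_ /= sub0r normrN.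
near=> x; move=> s; apply: (sg x); near: x.
by apply: open_nbhs_nbhs; split; [exact: open_box | rewrite /box /= normr0].
Unshelve. all: by end_near. Qed.

Lemma near_box r : 0 < r -> \forall x \near (0 : V), box r x.
Proof.
by move=> r0; apply: open_nbhs_nbhs; split; [exact: open_box | rewrite /box /= normr0].
Qed.

Lemma smooth_germ_axioms :
  @germ_axioms R n (fun_germs (@smooth R n)) (fun g => (g : fun_rep R n) (0 : V)).
Proof.
have sub r r' g : r' <= r -> smooth_on (box r) g -> smooth_on (box r') g.
  by move=> rr sg x bx; apply: sg; exact: lt_le_trans bx rr.
apply: fun_germ_axioms.
- apply/smoothP; exists 1 => //; exact: smooth_on_cst (@open_box R n 1).
- apply/smoothP; exists 1 => //; exact: smooth_on_cst (@open_box R n 1).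
- move=> c g h /smoothP[r r0 sg] /smoothP[r' r0' sh]; apply/smoothP.
  exists (Num.min r r'); first by rewrite lt_min r0.
  by apply: smooth_on_lin; [exact: open_box | apply: sub sg; rewrite ge_min lexx
    | apply: sub sh; rewrite ge_min lexx orbT].
- move=> i g /smoothP[r r0 sg]; apply/smoothP; exists r => //; exact: smooth_on_pd.
- move=> j g /smoothP[r r0 sg]; apply/smoothP; exists r => //.
  by apply: smooth_on_mulX => //; exact: open_box.
- move=> g /smoothP[r r0 sg]; apply: filterS (near_box r0) => x bx.
  exact: (smooth_onP sg bx).2.
- move=> g /smoothP[r r0 sg]; exists (fun i => dil_int (fun=> 1%N) 0 (fun_pd i g)).
    move=> i; apply/smoothP; exists r => //; apply: smooth_on_dil_int.
    exact: smooth_on_pd.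
  by apply: filterS (near_box r0) => x bx; exact: hadamard_dil sg bx.
- move=> w k b hw /smoothP[r r0 sb]; exists (dil_int w k b).
    by apply/smoothP; exists r => //; exact: smooth_on_dil_int.
  by apply: filterS (near_box r0) => x bx; exact: euler_dil hw sb bx.
Qed.

End SmoothGerms.

Local Close Scope classical_set_scope.

Theorem corollary3p19 (R : realType) (k : ground) (cat : category k) (n : nat)
    (hn : (3 <= n)%N) (w : 'I_n -> nat) (hw : forall i, (0 < w i)%N)
    (N : int) (f : mpoly n (ground_field R k))
    (hf : quasihomogeneous w N f)
    (hf0 : meval (fun=> 0) f = 0) :
  let G : germ_model (ground_field R k) n := germs R cat n in
  let fG : rep G := gpoly f in
  let d : int := N - \sum_(i < n) (w i)%:Z in
  forall (c : nat) (hc : codim fG c)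
    (s : nat) (hs : quotient_dim (quasihomogeneous w d)
                      [set 0 : mpoly n (ground_field R k)]%classic s)
    (B : {fset multinom n}) (hB : monomial_basis fG B),
  (forall alpha : tensor G, homogeneous n alpha ->
     exists! h : mpoly n (ground_field R k) * mpoly n (ground_field R k),
       [/\ quasihomogeneous w d h.1,
           {subset msupp h.2 <= B}
         & Bf fG (n - 2)%N n (alpha - top (gpoly (h.2 + f * h.1)))])
  /\ H2_dim (top fG) (c + s)%N.
Proof.
move=> G fG d c hc s hs B hB.
(* The case analysis on the category is confined to producing the interface. *)
have [ev ax] : exists ev : rep G -> ground_field R k, germ_axioms ev.
  rewrite /G; case: cat {f hf hf0 G fG hc d hs hB} => [|||k'].
  - by eexists; exact: analytic_germ_axioms (@abs_summable_complete_complex R).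
  - by eexists; exact: analytic_germ_axioms (@abs_summable_complete_real R).
  - by eexists; exact: smooth_germ_axioms.
  - by eexists; exact: formal_germ_axioms.
split=> [alpha|]; first exact: (normal_form ax hn hw hf hf0 hB).
exact: (H2_dimension ax hn hw hf hf0 hB hc hs).
Qed.
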